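(* Let $p \geq 1$ be a computable real with $p\neq 2$. Suppose $\mathcal{M}$ is either $\ell^p_n$ (for some $n\ge1$) or $\ell^p$, and suppose $(\mathcal{M} \oplus L^p[0,1])^\#$ is a computable presentation of $\mathcal{M} \oplus L^p[0,1]$. (1) If $\mathcal{M} = \ell^p_n$, then $P_{\{\mathbf{0}\} \oplus L^p[0,1]}$ is a $\emptyset'$-computable map of $(\mathcal{M} \oplus L^p[0,1])^\#$ into $(\mathcal{M} \oplus L^p[0,1])^\#$. (2) If $\mathcal{M} = \ell^p$, then $P_{\{\mathbf{0}\}\oplus L^p[0,1]}$ is a $\emptyset''$-computable map of $(\mathcal{M} \oplus L^p[0,1])^\#$ into $(\mathcal{M} \oplus L^p[0,1])^\#$.
   Context: $\mathcal{M}\oplus L^p[0,1]$ is the $L^p$-sum with norm $\|(u,f)\|=(\|u\|^p+\|f\|^p)^{1/p}$, and $P_{\{\mathbf{0}\}\oplus L^p[0,1]}$ is the projection $(u,f)\mapsto(\mathbf{0},f)$. Scalars are complex. A presentation of a Banach space $\mathcal{B}$ is a pair $(\mathcal{B},R)$ with $R:\mathbb{N}\to\mathcal{B}$ having dense linear span; rational vectors are $\sum_{j\le M}\alpha_jR(j)$, $\alpha_j\in\mathbb{Q}(i)$; the presentation is computable if the norm is computable on rational vectors. A map $T$ between presentations is $X$-computable if an $X$-oracle algorithm, given any sequence of rational vectors $(r_k)$ with $\|r_k-f\|<2^{-k}$, outputs such a sequence for $T(f)$. *)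

(* Defs.v *)
From HB Require Import structures.
From Stdlib Require Cantor.
From mathcomp Require Import all_boot all_order all_algebra.
From mathcomp Require Import complex.
From mathcomp Require Import all_classical all_reals all_analysis measurable_realfun.

Set Implicit Arguments.
Unset Strict Implicit.
Unset Printing Implicit Defensive.

Import Order.TTheory GRing.Theory Num.Theory.
Import numFieldNormedType.Exports.
Import ComplexField.Normc.

Local Arguments normc {R} x.

Local Open Scope classical_set_scope.
Local Open Scope ring_scope.
Local Open Scope complex_scope.

Section ComplexModulus.
Context (R : realType).
Implicit Types z : R[i].

Lemma normc_ge0 z : 0 <= normc z.
Proof. by case: z => a b; rewrite /normc sqrtr_ge0. Qed.

Lemma norm_normc z : `|z| = (normc z)%:C.
Proof. by case: z => a b; rewrite normc_def. Qed.

Lemma complex_norm_triangle (V : lmodType R[i]) (N : V -> R) :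
  (forall x y, N (x + y) <= N x + N y) ->
  forall x y, (N (x + y))%:C <= (N x)%:C + (N y)%:C.
Proof. by move=> ND x y; rewrite -rmorphD lecR. Qed.

Lemma complex_norm_homogeneous (V : lmodType R[i]) (N : V -> R) :
  (forall a x, N (a *: x) = normc a * N x) ->
  forall a x, (N (a *: x))%:C = `|a| * (N x)%:C.
Proof. by move=> NZ a x; rewrite NZ norm_normc -rmorphM. Qed.

Lemma complex_norm_definite (V : lmodType R[i]) (N : V -> R) :
  (forall x, N x = 0 -> x = 0) -> forall x, (N x)%:C = 0 -> x = 0.
Proof. by move=> N0 x -[/N0]. Qed.

End ComplexModulus.

Section ComplexLnorm.
Context d (T : measurableType d) (R : realType).
Variables (mu : {measure set T -> \bar R}) (p : R) (p1 : 1 <= p).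
Implicit Types f g : T -> R[i].

Definition cmeasurable : set (T -> R[i]) :=
  [set f | measurable_fun setT (fun x => complex.Re (f x)) /\
           measurable_fun setT (fun x => complex.Im (f x))].

Definition cLnorm f : \bar R := 'N[mu]_(p%:E)[EFin \o (normc \o f)].

Let p0 : 0 < p. Proof. exact: lt_le_trans p1. Qed.

Lemma cmeasurable_normc f : cmeasurable f -> measurable_fun setT (normc \o f).
Proof.
move=> [mr mi].
have -> : normc \o f =
    fun x => Num.sqrt ((complex.Re (f x)) ^+ 2 + (complex.Im (f x)) ^+ 2).
  by apply/funext => x /=; case: (f x).
apply: (@measurableT_comp _ _ _ _ _ _ (@Num.sqrt R)).
  by apply: continuous_measurable_fun => x; exact: sqrt_continuous.
by apply: measurable_funD; exact: measurable_funX.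
Qed.

Lemma cmeasurable0 : cmeasurable 0.
Proof. by split; exact: measurable_cst. Qed.

Lemma cmeasurableD f g : cmeasurable f -> cmeasurable g -> cmeasurable (f + g).
Proof.
move=> [fr fi] [gr gi]; split.
- rewrite (_ : (fun _ => _) = (fun x => complex.Re (f x) + complex.Re (g x))).
    exact: measurable_funD.
  by apply/funext => x; rewrite -raddfD.
- rewrite (_ : (fun _ => _) = (fun x => complex.Im (f x) + complex.Im (g x))).
    exact: measurable_funD.
  by apply/funext => x; rewrite -raddfD.
Qed.

Lemma cmeasurableZ (a : R[i]) f : cmeasurable f -> cmeasurable (a *: f).
Proof.
case: a => a b [fr fi]; split.
- rewrite (_ : (fun _ => _) =
    (fun x => a * complex.Re (f x) - b * complex.Im (f x))).
    by apply: measurable_funB; exact: measurable_funM.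
  by apply/funext => x; rewrite fctE; case: (f x).
- rewrite (_ : (fun _ => _) =
    (fun x => a * complex.Im (f x) + b * complex.Re (f x))).
    by apply: measurable_funD; exact: measurable_funM.
  by apply/funext => x; rewrite fctE; case: (f x).
Qed.

Lemma cLnormE f : cLnorm f = ((\int[mu]_x (normc (f x) `^ p)%:E) `^ p^-1)%E.
Proof.
rewrite /cLnorm unlock; congr (_ `^ _)%E; apply: eq_integral => x _ /=.
by rewrite ger0_norm ?normc_ge0.
Qed.

Lemma cLnorm_ge0 f : (0 <= cLnorm f)%E.
Proof. exact: Lnorm_ge0. Qed.

Lemma cLnorm0 : cLnorm 0 = 0%E.
Proof.
rewrite /cLnorm (_ : EFin \o _ = cst 0%E) ?Lnorm0 ?gt_eqF//.
by apply/funext => x; congr (_%:E); exact: normc0.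
Qed.

Lemma cLnormD f g : cmeasurable f -> cmeasurable g ->
  (cLnorm (f + g)%R <= cLnorm f + cLnorm g)%E.
Proof.
move=> mf mg.
have mnf := cmeasurable_normc mf; have mng := cmeasurable_normc mg.
apply: (@le_trans _ _ (Lnorm mu p%:E (EFin \o ((normc \o f) \+ (normc \o g))%R))).
  rewrite /cLnorm unlock; apply: gt0_ler_poweR.
  - by rewrite invr_ge0 ltW.
  - by rewrite in_itv/= leey andbT integral_ge0// => x _; exact: poweR_ge0.
  - by rewrite in_itv/= leey andbT integral_ge0// => x _; exact: poweR_ge0.
  - apply: ge0_le_integral => //.
    + by move=> x _; exact: poweR_ge0.
    + apply: (measurableT_comp (measurable_poweR p)).
      apply: measurableT_comp => //; apply: measurableT_comp => //.
      exact/cmeasurable_normc/cmeasurableD.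
    + apply: (measurableT_comp (measurable_poweR p)).
      apply: measurableT_comp => //; apply: measurableT_comp => //.
      exact: measurable_funD.
    + move=> x _ /=; rewrite lee_fin.
      apply: ge0_ler_powR; rewrite ?nnegrE ?normr_ge0 ?(ltW p0)//.
      by rewrite !ger0_norm ?addr_ge0 ?normc_ge0//; exact: le_normcD.
by apply: minkowski_EFin => //.
Qed.

Lemma cLnormZ (a : R[i]) f : cmeasurable f ->
  cLnorm (a *: f) = ((normc a)%:E * cLnorm f)%E.
Proof.
move=> mf; rewrite !cLnormE.
under eq_integral do rewrite fctE normcM powRM ?normc_ge0// EFinM.
rewrite ge0_integralZl//.
- rewrite poweRM ?lee_fin ?powR_ge0 ?integral_ge0//; last first.
    by move=> x _; rewrite lee_fin powR_ge0.
  by rewrite poweR_EFin -powRrM mulfV ?gt_eqF// powRr1 ?normc_ge0.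
- apply/measurable_EFinP.
  apply: (@measurableT_comp _ _ _ _ _ _ (@powR R ^~ p)) => //.
  exact: cmeasurable_normc.
- by move=> x _; rewrite lee_fin powR_ge0.
- by rewrite lee_fin powR_ge0.
Qed.

Lemma cLnorm_eq0 f : cmeasurable f ->
  cLnorm f = 0%E <-> f = (cst 0) %[ae mu].
Proof.
move=> mf; have mnf := cmeasurable_normc mf; split.
- move=> f0.
  have mE : measurable_fun setT (EFin \o (normc \o f)) by exact/measurable_EFinP.
  have := Lnorm_eq0_eq0 mE _ f0; rewrite lte_fin => /(_ p0).
  by apply: filterS => x /(_ I) [] /= fx _; exact: eq0_normc.
- move=> f0; rewrite cLnormE.
  rewrite (ae_eq_integral (cst 0%E)) ?integral0 ?poweR0r ?invr_eq0 ?gt_eqF//.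
  + apply/measurable_EFinP.
    by apply: (@measurableT_comp _ _ _ _ _ _ (@powR R ^~ p)).
  + apply: filterS f0 => x /(_ I) /= -> _.
    by rewrite normc0 powR0 ?gt_eqF.
Qed.

End ComplexLnorm.

Section SequenceNorms.
Context (R : realType) (p : R) (p1 : 1 <= p).
Implicit Types x y : nat -> R[i].

Let p0 : 0 < p. Proof. exact: lt_le_trans p1. Qed.

Lemma cmeasurable_nat x : cmeasurable x.
Proof. by split. Qed.

Definition lp_sum x : \bar R := (\sum_(0 <= i <oo) (normc (x i) `^ p)%:E)%E.

Lemma lp_sum_ge0 x : (0 <= lp_sum x)%E.
Proof. by apply: nneseries_ge0 => i _ _; rewrite lee_fin powR_ge0. Qed.

Lemma cLnorm_counting x : cLnorm counting p x = (lp_sum x `^ p^-1)%E.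
Proof.
rewrite cLnormE ge0_integral_count// => k.
by rewrite lee_fin powR_ge0.
Qed.

Lemma lp_sum_fin x : (cLnorm counting p x < +oo <-> lp_sum x < +oo)%E.
Proof.
rewrite cLnorm_counting; have := lp_sum_ge0 x.
case: (lp_sum x) => // [r _|_].
  by split => _; rewrite ?poweR_EFin ltry.
by rewrite poweRyr ?invr_eq0 ?gt_eqF.
Qed.

Definition lp_norm x : R := fine (lp_sum x) `^ p^-1.

Lemma lp_normE x : (lp_sum x < +oo)%E -> (lp_norm x)%:E = cLnorm counting p x.
Proof.
rewrite cLnorm_counting /lp_norm; have := lp_sum_ge0 x.
by case: (lp_sum x) => // r _ _; rewrite poweR_EFin.
Qed.

Lemma fin_lp_sumE n x : cLnorm (msum (fun i => \d_i) n) p x =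
  ((\sum_(i < n) normc (x i) `^ p) `^ p^-1)%:E.
Proof.
rewrite cLnormE ge0_integral_measure_sum//; last first.
  by move=> i _; rewrite lee_fin powR_ge0.
under eq_bigr do rewrite integral_dirac// diracT mul1e.
by rewrite sumEFin poweR_EFin.
Qed.

Lemma fin_lp_normD n x y :
  (\sum_(i < n) normc (x i + y i) `^ p) `^ p^-1 <=
  (\sum_(i < n) normc (x i) `^ p) `^ p^-1 +
  (\sum_(i < n) normc (y i) `^ p) `^ p^-1.
Proof.
have := cLnormD (msum (fun i : nat => \d_i) n) p1 (cmeasurable_nat x)
  (cmeasurable_nat y).
by rewrite (fin_lp_sumE n x) (fin_lp_sumE n y) (fin_lp_sumE n (x + y)) -EFinD lee_fin.
Qed.

End SequenceNorms.

Section FiniteSequenceSpace.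
Context (R : realType) (p : R).

(* The spaces take the proof of 1 <= p as a parameter because their normed    *)
(* module structures depend on it.                                            *)
Definition lpn (p1 : 1 <= p) (n : nat) : Type := {ffun 'I_n -> R[i]}.

Variables (p1 : 1 <= p) (n : nat).
HB.instance Definition _ :=
  GRing.Lmodule.copy (lpn p1 n) {ffun 'I_n -> R[i]}.

Definition lpn_norm (x : lpn p1 n) : R :=
  (\sum_(i < n) normc (x i) `^ p) `^ p^-1.

Let p0 : 0 < p. Proof. exact: lt_le_trans p1. Qed.

Let ext (x : lpn p1 n) (i : nat) : R[i] := oapp x 0 (insub i).

Let extE x (i : 'I_n) : ext x i = x i.
Proof. by rewrite /ext valK. Qed.

Let lpn_normD x y : lpn_norm (x + y) <= lpn_norm x + lpn_norm y.
Proof.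
have extS z : \sum_(i < n) normc (ext z i) `^ p = \sum_(i < n) normc (z i) `^ p.
  by apply: eq_bigr => i _; rewrite extE.
have extSD : \sum_(i < n) normc (ext x i + ext y i) `^ p =
    \sum_(i < n) normc ((x + y) i) `^ p.
  by apply: eq_bigr => i _; rewrite !extE ffunE.
by have := fin_lp_normD p1 n (ext x) (ext y); rewrite extSD !extS.
Qed.

Let lpn_normZ a x : lpn_norm (a *: x) = normc a * lpn_norm x.
Proof.
rewrite /lpn_norm.
under eq_bigr do rewrite ffunE normcM powRM ?normc_ge0//.
rewrite -mulr_sumr powRM ?powR_ge0//; last first.
  by apply: sumr_ge0 => i _; exact: powR_ge0.
by rewrite -powRrM mulfV ?gt_eqF// powRr1 ?normc_ge0.
Qed.

Let lpn_norm0_eq0 x : lpn_norm x = 0 -> x = 0.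
Proof.
move=> /powR_eq0_eq0 /eqP; rewrite psumr_eq0; last by move=> i _; exact: powR_ge0.
move=> /allP x0; apply/ffunP => i; rewrite ffunE.
have /eqP/powR_eq0_eq0 := x0 i (mem_index_enum i).
exact: eq0_normc.
Qed.

HB.instance Definition _ := Lmodule_isNormed.Build R[i] (lpn p1 n)
  (complex_norm_triangle lpn_normD) (complex_norm_homogeneous lpn_normZ)
  (complex_norm_definite lpn_norm0_eq0).

Lemma lpn_normE (x : lpn p1 n) : `|x| = (lpn_norm x)%:C.
Proof. by []. Qed.

End FiniteSequenceSpace.

Section SequenceSpace.
Context (R : realType) (p : R).

Definition lp_pred (p1 : 1 <= p) : {pred nat -> R[i]} :=
  mem [set x | (lp_sum p x < +oo)%E].

Variable p1 : 1 <= p.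

Let p0 : 0 < p. Proof. exact: lt_le_trans p1. Qed.

Let lp_submod_closed : submod_closed (lp_pred p1).
Proof.
split=> [|a x y]; rewrite !inE/=.
  by apply/(lp_sum_fin p1); rewrite cLnorm0.
move=> /(lp_sum_fin p1) xoo /(lp_sum_fin p1) yoo; apply/(lp_sum_fin p1).
apply: le_lt_trans (cLnormD _ p1 (cmeasurable_nat _) (cmeasurable_nat _)) _.
rewrite lte_add_pinfty// (cLnormZ _ p1 a (cmeasurable_nat x)).
by rewrite lte_mul_pinfty ?lee_fin ?normc_ge0.
Qed.

HB.instance Definition _ :=
  GRing.isSubmodClosed.Build _ _ (lp_pred p1) lp_submod_closed.

Record lp := LpSeq { lp_val :> nat -> R[i]; _ : lp_val \in lp_pred p1 }.

HB.instance Definition _ := [isSub for lp_val].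
HB.instance Definition _ := [Choice of lp by <:].
HB.instance Definition _ := [SubChoice_isSubLmodule of lp by <:].

Let lp_fin (x : lp) : (lp_sum p x < +oo)%E.
Proof. by have := valP x; rewrite inE. Qed.

Let lp_normD (x y : lp) : lp_norm p (x + y) <= lp_norm p x + lp_norm p y.
Proof.
have := cLnormD counting p1 (cmeasurable_nat x) (cmeasurable_nat y).
rewrite -(lp_normE (lp_fin x)) -(lp_normE (lp_fin y)) -EFinD.
by rewrite -(lp_normE (lp_fin (x + y))) lee_fin.
Qed.

Let lp_normZ a (x : lp) : lp_norm p (a *: x) = normc a * lp_norm p x.
Proof.
have := cLnormZ counting p1 a (cmeasurable_nat x).
by rewrite -(lp_normE (lp_fin x)) -(lp_normE (lp_fin (a *: x))) -EFinM => -[].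
Qed.

Let lp_norm0_eq0 (x : lp) : lp_norm p x = 0 -> x = 0.
Proof.
move=> x0; apply/val_inj/funext => i /=.
have sx0 : lp_sum p x = 0%E.
  have /powR_eq0_eq0 h := x0.
  by rewrite -(@fineK _ (lp_sum p x)) ?h// ge0_fin_numE ?lp_sum_ge0 ?lp_fin.
have : ((normc (x i) `^ p)%:E <= 0)%E.
  rewrite -sx0 /lp_sum (nneseriesD1 (n := i))//; last first.
    by move=> k _; rewrite lee_fin powR_ge0.
  apply: leeDl; apply: nneseries_ge0 => k _ _.
  by rewrite lee_fin powR_ge0.
rewrite lee_fin => xi0; apply/eq0_normc/(@powR_eq0_eq0 _ _ p)/eqP.
by rewrite eq_le xi0 powR_ge0.
Qed.

HB.instance Definition _ := Lmodule_isNormed.Build R[i] lp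
  (@complex_norm_triangle _ lp _ lp_normD)
  (@complex_norm_homogeneous _ lp _ lp_normZ)
  (@complex_norm_definite _ lp _ lp_norm0_eq0).

Lemma lp_normcE (x : lp) : `|x| = (lp_norm p x)%:C.
Proof. by []. Qed.

End SequenceSpace.

Section LebesgueSpace.
Context d (T : measurableType d) (R : realType).
Variables (mu : {measure set T -> \bar R}) (p : R).

Definition Lpfun_pred (p1 : 1 <= p) : {pred T -> R[i]} :=
  mem [set f | cmeasurable f /\ (cLnorm mu p f < +oo)%E].

Variable p1 : 1 <= p.

Let p0 : 0 < p. Proof. exact: lt_le_trans p1. Qed.

Let Lpfun_submod_closed : submod_closed (Lpfun_pred p1).
Proof.
split=> [|a f g]; rewrite !inE/=.
  by split; [exact: cmeasurable0 | rewrite cLnorm0].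
move=> [mf foo] [mg goo]; have maf := cmeasurableZ a mf.
split; first exact: cmeasurableD.
apply: le_lt_trans (cLnormD _ p1 maf mg) _.
rewrite lte_add_pinfty// (cLnormZ _ p1 a mf).
by rewrite lte_mul_pinfty ?lee_fin ?normc_ge0.
Qed.

HB.instance Definition _ :=
  GRing.isSubmodClosed.Build _ _ (Lpfun_pred p1) Lpfun_submod_closed.

Record Lpfun := LpFun { Lp_val :> T -> R[i]; _ : Lp_val \in Lpfun_pred p1 }.

HB.instance Definition _ := [isSub for Lp_val].
HB.instance Definition _ := [Choice of Lpfun by <:].
HB.instance Definition _ := [SubChoice_isSubLmodule of Lpfun by <:].

Lemma Lpfun_measurable (f : Lpfun) : cmeasurable f.
Proof. by have := valP f; rewrite inE => -[]. Qed.

Lemma Lpfun_finite (f : Lpfun) : (cLnorm mu p f < +oo)%E.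
Proof. by have := valP f; rewrite inE => -[]. Qed.

Definition Lpfun_norm (f : Lpfun) : R := fine (cLnorm mu p f).

Lemma Lpfun_normE f : (Lpfun_norm f)%:E = cLnorm mu p f.
Proof. by rewrite fineK// ge0_fin_numE ?cLnorm_ge0 ?Lpfun_finite. Qed.

Lemma Lpfun_norm_ge0 f : 0 <= Lpfun_norm f.
Proof. by rewrite fine_ge0 ?cLnorm_ge0. Qed.

Lemma Lpfun_normD f g : Lpfun_norm (f + g) <= Lpfun_norm f + Lpfun_norm g.
Proof.
have := cLnormD mu p1 (Lpfun_measurable f) (Lpfun_measurable g).
by rewrite -(Lpfun_normE f) -(Lpfun_normE g) -EFinD -(Lpfun_normE (f + g)) lee_fin.
Qed.

Lemma Lpfun_normZ a f : Lpfun_norm (a *: f) = normc a * Lpfun_norm f.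
Proof.
have := cLnormZ mu p1 a (Lpfun_measurable f).
by rewrite -(Lpfun_normE f) -(Lpfun_normE (a *: f)) -EFinM => -[].
Qed.

Definition ae_null : {pred Lpfun} :=
  mem [set f : Lpfun | (f : T -> R[i]) = cst 0 %[ae mu]].

Lemma ae_nullP f : (f \in ae_null) <-> Lpfun_norm f = 0.
Proof.
rewrite inE/= -(cLnorm_eq0 _ p1 (Lpfun_measurable f)) -Lpfun_normE.
by split => [[]|->].
Qed.

Lemma ae_null_scale a f : f \in ae_null -> a *: f \in ae_null.
Proof. by move=> /ae_nullP f0; apply/ae_nullP; rewrite Lpfun_normZ f0 mulr0. Qed.

Let ae_null_zmod_closed : zmod_closed ae_null.
Proof.
split=> [|f g /ae_nullP f0 /ae_nullP g0]; apply/ae_nullP.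
  by rewrite -(scale0r 0) Lpfun_normZ normc0 mul0r.
apply/eqP; rewrite eq_le Lpfun_norm_ge0 andbT.
rewrite (le_trans (Lpfun_normD _ _))// f0 -scaleN1r Lpfun_normZ g0.
by rewrite mulr0 addr0.
Qed.

HB.instance Definition _ :=
  GRing.isZmodClosed.Build Lpfun ae_null ae_null_zmod_closed.

Local Open Scope quotient_scope.

(* Functions that agree almost everywhere are identified. *)
Definition Lp : Type := Quotient.quot ae_null.

HB.instance Definition _ := Choice.on Lp.
HB.instance Definition _ := EqQuotient.on Lp.
HB.instance Definition _ := GRing.Zmodule.on Lp.

Lemma Lp_eqP (f g : Lpfun) : \pi_Lp f = \pi_Lp g <-> f - g \in ae_null.
Proof. by rewrite Quotient.idealrBE; split => /eqP. Qed.

Lemma Lp_piD (f g : Lpfun) : \pi_Lp (f + g) = \pi_Lp f + \pi_Lp g.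
Proof. by rewrite !piE. Qed.

Definition Lp_scale (a : R[i]) (u : Lp) : Lp := \pi_Lp (a *: repr u).

Lemma Lp_pi_scale a f : \pi_Lp (a *: f) = Lp_scale a (\pi_Lp f).
Proof.
apply/Lp_eqP; rewrite -scalerBr; apply/ae_null_scale/Lp_eqP.
by rewrite reprK.
Qed.

Let Lp_scalerA a b u : Lp_scale a (Lp_scale b u) = Lp_scale (a * b) u.
Proof. by rewrite -[u]reprK -(Lp_pi_scale b) -(Lp_pi_scale a) scalerA Lp_pi_scale. Qed.

Let Lp_scale1r : left_id 1 Lp_scale.
Proof. by move=> u; rewrite -[u]reprK -Lp_pi_scale scale1r. Qed.

Let Lp_scalerDr : right_distributive Lp_scale +%R.
Proof.
move=> a u v; rewrite -[u]reprK -[v]reprK -Lp_piD -!(Lp_pi_scale a).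
by rewrite scalerDr Lp_piD.
Qed.

Let Lp_scalerDl u : {morph Lp_scale^~ u : a b / a + b}.
Proof.
by move=> a b; rewrite -[u]reprK -(Lp_pi_scale (a + b)) scalerDl Lp_piD !Lp_pi_scale.
Qed.

HB.instance Definition _ := GRing.Zmodule_isLmodule.Build R[i] Lp
  Lp_scalerA Lp_scale1r Lp_scalerDr Lp_scalerDl.

Definition Lp_norm (u : Lp) : R := Lpfun_norm (repr u).

Lemma Lp_norm_pi f : Lp_norm (\pi_Lp f) = Lpfun_norm f.
Proof.
have H g h : g - h \in ae_null -> Lpfun_norm g <= Lpfun_norm h.
  move=> /ae_nullP gh; have := Lpfun_normD (g - h) h.
  by rewrite subrK gh add0r.
have e : repr (\pi_Lp f) - f \in ae_null by apply/Lp_eqP; rewrite reprK.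
by apply/eqP; rewrite eq_le !H// -opprB rpredN.
Qed.

Let Lp_normD u v : Lp_norm (u + v) <= Lp_norm u + Lp_norm v.
Proof. by rewrite -[u]reprK -[v]reprK -Lp_piD !Lp_norm_pi Lpfun_normD. Qed.

Let Lp_normZ a u : Lp_norm (a *: u) = normc a * Lp_norm u.
Proof. by rewrite -[u]reprK -[a *: _]Lp_pi_scale !Lp_norm_pi Lpfun_normZ. Qed.

Let Lp_norm0_eq0 u : Lp_norm u = 0 -> u = 0.
Proof.
rewrite -[u]reprK Lp_norm_pi => /ae_nullP u0.
have -> : 0 = \pi_Lp 0 by rewrite !piE.
by apply/Lp_eqP; rewrite subr0.
Qed.

HB.instance Definition _ := Lmodule_isNormed.Build R[i] Lp
  (complex_norm_triangle Lp_normD) (complex_norm_homogeneous Lp_normZ)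
  (complex_norm_definite Lp_norm0_eq0).

Lemma Lp_normE (u : Lp) : `|u| = (Lp_norm u)%:C.
Proof. by []. Qed.

End LebesgueSpace.

Section LpSum.
Context (R : realType) (p : R).

(* Alias of the product type, so that it does not inherit the sup norm. *)
Definition lpsum (p1 : 1 <= p) (U V : normedModType R[i]) : Type := (U * V)%type.

Variables (p1 : 1 <= p) (U V : normedModType R[i]).
HB.instance Definition _ := GRing.Lmodule.copy (lpsum p1 U V) (U * V)%type.

Let rnorm (W : normedModType R[i]) (w : W) : R := complex.Re `|w|.

Definition lpsum_norm (w : lpsum p1 U V) : R :=
  (complex.Re `|w.1| `^ p + complex.Re `|w.2| `^ p) `^ p^-1.

Let p0 : 0 < p. Proof. exact: lt_le_trans p1. Qed.

Let rnormE (W : normedModType R[i]) (w : W) : `|w| = (rnorm w)%:C.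
Proof. by rewrite RRe_real// normr_real. Qed.

Let rnorm_ge0 (W : normedModType R[i]) (w : W) : 0 <= rnorm w.
Proof. by rewrite -ler0c -rnormE. Qed.

Let rnormD (W : normedModType R[i]) (v w : W) :
  rnorm (v + w) <= rnorm v + rnorm w.
Proof. by rewrite -lecR [leRHS]rmorphD/= -(rnormE v) -(rnormE w) -rnormE ler_normD. Qed.

Let rnormZ (W : normedModType R[i]) a (w : W) :
  rnorm (a *: w) = normc a * rnorm w.
Proof. by rewrite /rnorm normrZ norm_normc rnormE -rmorphM. Qed.

Let pair_seq (a b : R) (i : nat) : R[i] := (if i == 0%N then a else b)%:C.

Let pair_seqE a b : 0 <= a -> 0 <= b ->
  \sum_(i < 2) normc (pair_seq a b i) `^ p = a `^ p + b `^ p.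
Proof.
have nC (c : R) : 0 <= c -> normc c%:C = c.
  by move=> c0; rewrite /normc/= expr0n addr0 sqrtr_sqr ger0_norm.
by move=> a0 b0; rewrite 2!big_ord_recl big_ord0 addr0 !nC.
Qed.

Let pair_seqD a b a' b' :
  (fun i => pair_seq a b i + pair_seq a' b' i) = pair_seq (a + a') (b + b').
Proof.
by apply/funext => i; rewrite /pair_seq; case: ifP => _; rewrite -rmorphD.
Qed.

Let minkowski2 a b a' b' : 0 <= a -> 0 <= b -> 0 <= a' -> 0 <= b' ->
  ((a + a') `^ p + (b + b') `^ p) `^ p^-1 <=
  (a `^ p + b `^ p) `^ p^-1 + (a' `^ p + b' `^ p) `^ p^-1.
Proof.
move=> a0 b0 a'0 b'0.
have := fin_lp_normD p1 2 (pair_seq a b) (pair_seq a' b').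
rewrite (pair_seqE a0 b0) (pair_seqE a'0 b'0).
rewrite -(pair_seqE (addr_ge0 a0 a'0) (addr_ge0 b0 b'0)).
by rewrite -pair_seqD.
Qed.

Let lpsum_normD w z : lpsum_norm (w + z) <= lpsum_norm w + lpsum_norm z.
Proof.
have h := minkowski2 (rnorm_ge0 w.1) (rnorm_ge0 w.2) (rnorm_ge0 z.1) (rnorm_ge0 z.2).
apply: le_trans h; apply: ge0_ler_powR.
- by rewrite invr_ge0 ltW.
- by rewrite nnegrE addr_ge0 ?powR_ge0.
- by rewrite nnegrE addr_ge0 ?powR_ge0.
apply: lerD; apply: ge0_ler_powR; rewrite ?nnegrE ?(ltW p0) ?addr_ge0//;
  by [exact: rnorm_ge0 | exact: rnormD].
Qed.

Let lpsum_normZ a w : lpsum_norm (a *: w) = normc a * lpsum_norm w.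
Proof.
rewrite /lpsum_norm -!/(rnorm _) !rnormZ !powRM ?normc_ge0 ?rnorm_ge0//.
rewrite -mulrDr powRM ?addr_ge0 ?powR_ge0//.
by rewrite -powRrM mulfV ?gt_eqF// powRr1 ?normc_ge0.
Qed.

Let lpsum_norm0_eq0 w : lpsum_norm w = 0 -> w = 0.
Proof.
move=> /powR_eq0_eq0 /eqP; rewrite paddr_eq0 ?powR_ge0// => /andP[].
move=> /eqP/powR_eq0_eq0 w1 /eqP/powR_eq0_eq0 w2.
by case: w w1 w2 => u v /= u0 v0; congr pair;
  apply/eqP; rewrite -normr_eq0 rnormE /rnorm ?u0 ?v0.
Qed.

HB.instance Definition _ := Lmodule_isNormed.Build R[i] (lpsum p1 U V)
  (complex_norm_triangle lpsum_normD) (complex_norm_homogeneous lpsum_normZ)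
  (complex_norm_definite lpsum_norm0_eq0).

Lemma lpsum_normE (w : lpsum p1 U V) : `|w| = (lpsum_norm w)%:C.
Proof. by []. Qed.

Definition proj_right (w : lpsum p1 U V) : lpsum p1 U V := (0, w.2).

End LpSum.

(* mrestr mu D maps X to mu (X `&` D): this is Lebesgue measure on [0, 1].    *)
Definition Lp01 (R : realType) (p : R) (p1 : 1 <= p) : normedModType R[i] :=
  Lp (mrestr (@lebesgue_measure R) (measurable_itv `[(0 : R), (1 : R)])) p1.

(* Unary partial recursive functions relative to an oracle; tuples of         *)
(* arguments are coded by Cantor pairing.                                     *)
Inductive prog : Type :=
  | Zero | Succ | Fst | Snd | Query
  | Pair of prog & prog
  | Comp of prog & prog
  | Prec of prog & prog
  | Mu of prog.

Definition npair (a b : nat) : nat := Cantor.to_nat (a, b).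
Definition nfst (n : nat) : nat := (Cantor.of_nat n).1.
Definition nsnd (n : nat) : nat := (Cantor.of_nat n).2.

(* computes O c n y: with oracle O, program c halts on input n with output y. *)
Fixpoint computes (O : nat -> nat) (c : prog) (n y : nat) {struct c} : Prop :=
  match c with
  | Zero => y = 0%N
  | Succ => y = n.+1
  | Fst => y = nfst n
  | Snd => y = nsnd n
  | Query => y = O n
  | Pair f g => exists a b,
      [/\ computes O f n a, computes O g n b & y = npair a b]
  | Comp f g => exists2 m, computes O g n m & computes O f m y
  | Prec f g =>
      (fix rec (k z : nat) {struct k} : Prop := match k with
       | 0%N => computes O f (nfst n) z
       | j.+1 => exists2 w, rec j w & computes O g (npair (nfst n) (npair j w)) z
       end) (nsnd n) y
  | Mu f => computes O f (npair n y) 0%N /\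
      forall m, (m < y)%N -> exists k, computes O f (npair n m) k.+1
  end.

Fixpoint prog_code (c : prog) : nat :=
  match c with
  | Zero => npair 0 0
  | Succ => npair 1 0
  | Fst => npair 2 0
  | Snd => npair 3 0
  | Query => npair 4 0
  | Pair f g => npair 5 (npair (prog_code f) (prog_code g))
  | Comp f g => npair 6 (npair (prog_code f) (prog_code g))
  | Prec f g => npair 7 (npair (prog_code f) (prog_code g))
  | Mu f => npair 8 (prog_code f)
  end.

Definition charfun (X : set nat) (n : nat) : nat := n \in X.

(* Programs are their own inputs: the diagonal halting set relative to X.     *)
Definition jump (X : set nat) : set nat :=
  [set e | exists2 c, e = prog_code c & exists y, computes (charfun X) c e y].

Definition oracle_join (f g : nat -> nat) (n : nat) : nat :=
  if odd n then g n./2 else f n./2.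

Definition rat_of_code (n : nat) : rat :=
  ((nfst (nfst n))%:R - (nsnd (nfst n))%:R) / (nsnd n).+1%:R.

Definition gauss_of_code (R : realType) (n : nat) : R[i] :=
  ratr (rat_of_code (nfst n)) +i* ratr (rat_of_code (nsnd n)).

Definition computable_real (R : realType) (x : R) : Prop :=
  exists c : prog, forall k : nat,
    exists2 q, computes (charfun set0) c k q &
               `|x - ratr (rat_of_code q)| < 2 ^- k.

Section Presentations.
Context (R : realType).
Implicit Types U V : normedModType R[i].

Definition linear_span V (r : nat -> V) : set V :=
  [set v | exists n (a : nat -> R[i]), v = \sum_(j < n) a j *: r j].

Record presentation V := Presentation {
  pres_fun :> nat -> V;
  pres_dense : dense (linear_span pres_fun)
}.

(* CodeSeq.decode is MathComp's effective bijection from nat to seq nat.      *)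
Definition rational_vector V (r : nat -> V) (n : nat) : V :=
  let s := CodeSeq.decode n in
  \sum_(j < size s) gauss_of_code R (nth 0%N s j) *: r j.

Definition computable_presentation V (P : presentation V) : Prop :=
  exists c : prog, forall n k : nat,
    exists2 q, computes (charfun set0) c (npair n k) q &
      `| `|rational_vector P n| - ratr (rat_of_code q) | < 2 ^- k :> R[i].

Definition is_name V (P : presentation V) (v : V) (g : nat -> nat) : Prop :=
  forall k : nat, `|rational_vector P (g k) - v| < 2 ^- k.

(* One program c works for all names g of all u; it may query both X and g.   *)
Definition computable_map (X : set nat) U V
    (P : presentation U) (Q : presentation V) (F : U -> V) : Prop :=
  exists c : prog, forall (u : U) (g : nat -> nat), is_name P u g ->
    exists2 h : nat -> nat, is_name Q (F u) h &
      forall k, computes (oracle_join (charfun X) g) c k (h k).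

End Presentations.

(* Main.v *)
Require Import Defs.
From Stdlib Require Cantor.
From mathcomp Require Import all_boot all_order all_algebra.
From mathcomp Require Import complex zify ring lra.
From mathcomp Require Import all_classical all_reals all_analysis measurable_realfun.

(** Write [w = (u, f)] with [u] in the atomic part [M]. Since [p <> 2],
    Clarkson's inequality quantifies disjointness of supports: two vectors [g],
    [h] of norm [t] are disjoint iff [g + h] and [g - h] both have norm
    [2^(1/p) t], and if this holds up to a small error then at every atom one of
    [g], [h] is small. Hence a sum of [N] almost disjoint vectors of equal norm
    [t < 2^-j], with a tolerance exponentially small in [N], has all atoms at
    most [3 * 2^-j]; conversely every [f] in [L^p[0,1]] is such a sum, by the
    intermediate value theorem. So the relation "[w] is within [q] of a level-[j]
    sum" is c.e., it holds whenever [`|u| < q], and it fails for some [j] whenever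
    [q < `|u|]. For [M = l^p_n] the level [j] is known in advance, so [0'] can
    decide (up to a prescribed error) whether [`|u|] is small and can certify
    lower bounds of [`|u|]; for [M = l^p] all [j] must be inspected, which takes
    [0'']. A rational vector [v] with small atomic part and [`|w - v|] close to
    a certified lower bound of [`|u|] is then close to [(0, f)], because
    [`|w - v|^p] is the sum of the p-th powers of the norms of the two components.
    Such a [v] is found by search. *)

Set Implicit Arguments.
Unset Strict Implicit.
Unset Printing Implicit Defensive.

Import Order.TTheory GRing.Theory Num.Theory.
Import numFieldNormedType.Exports.
Import ComplexField.Normc.

(** * Relative computability and the jump *)

(** The presentation gives access to norms of rational vectors only, never to components, so
    disjointness has to be read off from norms; for [p = 2] this fails, since the defect [clarkson]
    then vanishes identically. For [p < 2] and [p > 2] the inequality points in opposite directions;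
    the factor [Num.sg (2 - p)] is carried along so that both cases share one proof. The tolerance
    depends on [N] because at an atom all summands but one have to be below [t / N.+1] for the sum
    to stay below [3 * t]; the power of that threshold is only polynomially small, and
    [2 ^- (D * N.+1)] is a crude computable bound below it. The two jumps reflect two uses of the
    test set. A lower bound of [|u|] needs one failing level, which a search can look for, so [0']
    suffices in both cases. An upper bound for the atomic part of a candidate needs one level where
    small coordinates force a small norm, as in finite dimension, but all levels in [l^p], a Pi_1
    condition over [0']. *)

Lemma nfstE a b : nfst (npair a b) = a.
Proof. by rewrite /nfst /npair Cantor.cancel_of_to. Qed.

Lemma nsndE a b : nsnd (npair a b) = b.
Proof. by rewrite /nsnd /npair Cantor.cancel_of_to. Qed.

Lemma npairK n : npair (nfst n) (nsnd n) = n.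
Proof. by rewrite /npair /nfst /nsnd -surjective_pairing Cantor.cancel_to_of. Qed.

Lemma npair_inj a b a' b' : npair a b = npair a' b' -> a = a' /\ b = b'.
Proof.
move=> e; split.
  by have := congr1 nfst e; rewrite !nfstE.
by have := congr1 nsnd e; rewrite !nsndE.
Qed.

Section TotalRecursive.
Variable O : nat -> nat.
Implicit Types f g h : nat -> nat.

Definition recf f := exists c, forall n, computes O c n (f n).

Lemma recf_ext f g : f =1 g -> recf f -> recf g.
Proof. by move=> fg [c cf]; exists c => n; rewrite -fg. Qed.

Lemma recf_zero : recf (fun=> 0).
Proof. by exists Zero. Qed.

Lemma recf_fst : recf nfst.
Proof. by exists Fst. Qed.

Lemma recf_snd : recf nsnd.
Proof. by exists Snd. Qed.

Lemma recf_query : recf O.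
Proof. by exists Query. Qed.

Lemma recf_comp g f : recf g -> recf f -> recf (fun n => g (f n)).
Proof. by move=> [c cg] [d df]; exists (Comp c d) => n; exists (f n). Qed.

Lemma recf_succ f : recf f -> recf (fun n => (f n).+1).
Proof. by apply: recf_comp; exists Succ. Qed.

Lemma recf_nfst f : recf f -> recf (fun n => nfst (f n)).
Proof. exact: recf_comp recf_fst. Qed.

Lemma recf_nsnd f : recf f -> recf (fun n => nsnd (f n)).
Proof. exact: recf_comp recf_snd. Qed.

Lemma recf_cst m : recf (fun=> m).
Proof. by elim: m => [|m IH]; [exact: recf_zero|exact: recf_succ]. Qed.

Lemma recf_npair f g : recf f -> recf g -> recf (fun n => npair (f n) (g n)).
Proof.
by move=> [c cf] [d dg]; exists (Pair c d) => n; exists (f n), (g n).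
Qed.

Lemma recf_id : recf id.
Proof.
apply: (@recf_ext (fun n => npair (nfst n) (nsnd n))); first exact: npairK.
exact: recf_npair recf_fst recf_snd.
Qed.

(** [Prec] keeps the first component of its input as a parameter; the parameter chosen here is the
    whole input [n], so that [a], [b] and [k] may all depend on it. *)
Lemma recf_nat_rect a (b : nat -> nat -> nat -> nat) k :
  recf a -> recf (fun t => b (nfst t) (nfst (nsnd t)) (nsnd (nsnd t))) ->
  recf k -> recf (fun n => nat_rect _ (a n) (b n) (k n)).
Proof.
move=> [ca ha] [cb hb] hk.
pose F m := nat_rect _ (a (nfst m)) (b (nfst m)) (nsnd m).
apply: (@recf_ext (fun n => F (npair n (k n)))).
  by move=> n; rewrite /F nfstE nsndE.
apply: recf_comp; last by apply: recf_npair => //; exact: recf_id.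
exists (Prec ca cb) => m; rewrite /F /=.
elim: (nsnd m) => [|j IH] /=; first exact: ha.
by eexists; first exact: IH; have := hb (npair (nfst m) (npair j
  (nat_rect _ (a (nfst m)) (b (nfst m)) j))); rewrite !(nfstE, nsndE).
Qed.

Lemma recf_pred f : recf f -> recf (fun n => (f n).-1).
Proof.
move=> hf; apply: (@recf_ext (fun n => nat_rect _ 0 (fun j _ => j) (f n))).
  by move=> n; case: (f n).
by apply: recf_nat_rect => //; [exact: recf_zero|exact/recf_nfst/recf_snd].
Qed.

Lemma recf_addn f g : recf f -> recf g -> recf (fun n => f n + g n).
Proof.
move=> hf hg.
apply: (@recf_ext (fun n => nat_rect _ (f n) (fun _ w => w.+1) (g n))).
  by move=> n; elim: (g n) => [|j /= ->]; rewrite ?addn0 ?addnS.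
by apply: recf_nat_rect => //; exact/recf_succ/recf_nsnd/recf_snd.
Qed.

Lemma recf_subn f g : recf f -> recf g -> recf (fun n => f n - g n).
Proof.
move=> hf hg.
apply: (@recf_ext (fun n => nat_rect _ (f n) (fun _ w => w.-1) (g n))).
  by move=> n; elim: (g n) => [|j /= ->]; rewrite ?subn0 ?subnS.
by apply: recf_nat_rect => //; exact/recf_pred/recf_nsnd/recf_snd.
Qed.

Lemma recf_muln f g : recf f -> recf g -> recf (fun n => f n * g n).
Proof.
move=> hf hg.
apply: (@recf_ext (fun n => nat_rect _ 0 (fun _ w => f n + w) (g n))).
  by move=> n; elim: (g n) => [|j /= ->]; rewrite ?muln0 ?mulnS.
apply: recf_nat_rect => //; first exact: recf_zero.
by apply: recf_addn; [exact: recf_comp recf_fst|exact/recf_nsnd/recf_snd].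
Qed.

Lemma recf_expn f g : recf f -> recf g -> recf (fun n => f n ^ g n).
Proof.
move=> hf hg.
apply: (@recf_ext (fun n => nat_rect _ 1 (fun _ w => f n * w) (g n))).
  by move=> n; elim: (g n) => [|j /= ->]; rewrite ?expn0 ?expnS.
apply: recf_nat_rect => //; first exact: recf_cst.
by apply: recf_muln; [exact: recf_comp recf_fst|exact/recf_nsnd/recf_snd].
Qed.

Definition recb (b : nat -> bool) := recf (fun n => b n : nat).

Lemma recb_ext b b' : b =1 b' -> recb b -> recb b'.
Proof. by move=> e; apply: recf_ext => n; rewrite e. Qed.

Lemma recb_comp b f : recb b -> recf f -> recb (fun n => b (f n)).
Proof. exact: recf_comp. Qed.

Lemma recb_leq f g : recf f -> recf g -> recb (fun n => f n <= g n).
Proof.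
move=> hf hg; apply: (@recf_ext (fun n => 1 - (f n - g n))).
  by move=> n; rewrite /leq; case: (f n - g n).
by apply: recf_subn; [exact: recf_cst|exact: recf_subn].
Qed.

Lemma recb_neg b : recb b -> recb (fun n => ~~ b n).
Proof.
move=> hb; apply: (@recf_ext (fun n => 1 - b n)); first by move=> n; case: (b n).
by apply: recf_subn => //; exact: recf_cst.
Qed.

Lemma recb_and b b' : recb b -> recb b' -> recb (fun n => b n && b' n).
Proof.
move=> hb hb'; apply: (@recf_ext (fun n => b n * b' n)); last exact: recf_muln.
by move=> n; case: (b n); case: (b' n).
Qed.

Lemma recb_or b b' : recb b -> recb b' -> recb (fun n => b n || b' n).
Proof.
move=> hb hb'; apply: (@recb_ext (fun n => ~~ (~~ b n && ~~ b' n))).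
  by move=> n; rewrite negb_and !negbK.
by apply: recb_neg; apply: recb_and; exact: recb_neg.
Qed.

Lemma recb_eqn f g : recf f -> recf g -> recb (fun n => f n == g n).
Proof.
move=> hf hg; apply: (@recb_ext (fun n => (f n <= g n) && (g n <= f n))).
  by move=> n; rewrite eqn_leq.
by apply: recb_and; exact: recb_leq.
Qed.

Lemma recb_all (b : nat -> nat -> bool) k :
  recb (fun t => b (nfst t) (nsnd t)) -> recf k ->
  recb (fun n => all (b n) (iota 0 (k n))).
Proof.
move=> hb hk.
apply: (@recf_ext (fun n => nat_rect _ 1 (fun j w => w * b n j) (k n))).
  move=> n; elim: (k n) => // j IH.
  by rewrite -[in RHS]addn1 iotaD all_cat /= andbT add0n -mulnb -IH.
apply: recf_nat_rect => //; first exact: recf_cst.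
apply: recf_muln; first exact/recf_nsnd/recf_snd.
apply: (@recf_ext (fun t => b (nfst (npair (nfst t) (nfst (nsnd t))))
                              (nsnd (npair (nfst t) (nfst (nsnd t)))))).
  by move=> t; rewrite nfstE nsndE.
apply: (@recb_comp (fun t => b (nfst t) (nsnd t))) => //.
by apply: recf_npair; [exact: recf_fst|exact/recf_nfst/recf_snd].
Qed.

(** The program may diverge: it halts exactly on the inputs that have a witness, and this is what
    the jump detects. The negation of [b] is programmed because [Mu] looks for the output 0. *)
Lemma computes_search (b : nat -> nat -> bool) :
  recb (fun t => b (nfst t) (nsnd t)) ->
  exists c, forall n,
    (forall y, computes O c n y -> b n y) /\
    ((exists z, b n z) -> exists y, computes O c n y).
Proof.
move=> hb; have [c hc] := recb_neg hb.
(* [computes] is only a relation: its determinism identifies the output 0 reached by [Mu] with the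
   value known for [c]. *)
have cf c' : forall n y z, computes O c' n y -> computes O c' n z -> y = z.
  elim: c' => /=; try by move=> n y z -> ->.
  - move=> f IHf g IHg n y z [a1 [b1 [h1 h2 ->]]] [a2 [b2 [h3 h4 ->]]].
    by rewrite (IHf _ _ _ h1 h3) (IHg _ _ _ h2 h4).
  - move=> f IHf g IHg n y z [m1 h1 h2] [m2 h3 h4].
    by move: h2; rewrite (IHg _ _ _ h1 h3) => /IHf; apply.
  - move=> f IHf g IHg n; elim: (nsnd n) => [|j IH] y z; first exact: IHf.
    move=> [w1 h1 h2] [w2 h3 h4].
    by move: h2; rewrite (IH _ _ h1 h3) => /IHg; apply.
  - move=> f IH n y z [h1 h2] [h3 h4].
    case: (ltngtP y z) => // lt.
      by have [k /IH/(_ h1)] := h4 _ lt.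
    by have [k /IH/(_ h3)] := h2 _ lt.
exists (Mu c) => n; split.
  move=> y [h _]; have := cf _ _ _ _ h (hc _); rewrite nfstE nsndE.
  by case: (b n y).
move=> exz; exists (ex_minn exz); case: ex_minnP => m bm min; split.
  by have := hc (npair n m); rewrite nfstE nsndE bm.
move=> k km; exists 0; have := hc (npair n k); rewrite nfstE nsndE.
by case E: (b n k) => //; have := min k E; rewrite leqNgt km.
Qed.

Lemma recf_search (b : nat -> nat -> bool) :
  recb (fun t => b (nfst t) (nsnd t)) -> (forall n, exists z, b n z) ->
  exists2 g, recf g & forall n, b n (g n).
Proof.
move=> hb exz; have [c hc] := computes_search hb.
have /choice[g hg] n : exists y, computes O c n y by apply: (hc n).2.
by exists g; [exists c|move=> n; apply: (hc n).1].
Qed.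

(** Sigma_1 relative to [O] in normal form, a projection of an [O]-decidable relation. *)
Definition sig1 (S : set nat) := exists2 b : nat -> nat -> bool,
  recb (fun t => b (nfst t) (nsnd t)) & forall n, S n <-> exists z, b n z.

End TotalRecursive.

Fixpoint subst_query (q c : prog) : prog :=
  match c with
  | Query => q
  | Pair f g => Pair (subst_query q f) (subst_query q g)
  | Comp f g => Comp (subst_query q f) (subst_query q g)
  | Prec f g => Prec (subst_query q f) (subst_query q g)
  | Mu f => Mu (subst_query q f)
  | c => c
  end.

Lemma computes_subst O O' q : (forall n, computes O' q n (O n)) ->
  forall c n y, computes O c n y -> computes O' (subst_query q c) n y.
Proof.
move=> hq; elim=> //=.
- by move=> n y ->; exact: hq.
- move=> f IHf g IHg n y [a [b [ha hb ->]]]; exists a, b.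
  by split; [exact: IHf|exact: IHg|].
- by move=> f IHf g IHg n y [m h1 h2]; exists m; [exact: IHg|exact: IHf].
- move=> f IHf g IHg n; elim: (nsnd n) => [|j IH] y; first exact: IHf.
  by move=> [w h1 h2]; exists w; [exact: IH|exact: IHg].
- move=> f IHf n y [h1 h2]; split; first exact: IHf.
  by move=> m /h2[k hk]; exists k; exact: IHf.
Qed.

Lemma recf_turing O O' f : recf O' O -> recf O f -> recf O' f.
Proof.
by move=> [q hq] [c hc]; exists (subst_query q c) => n; exact/(computes_subst hq).
Qed.

Lemma recf_oracle0 O f : recf (charfun set0) f -> recf O f.
Proof.
apply: recf_turing; apply: (@recf_ext _ (fun=> 0)); last exact: recf_zero.
by move=> n; rewrite /charfun in_set0.
Qed.

Lemma prog_code_inj : injective prog_code.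
Proof.
elim=> [|||||f IHf g IHg|f IHf g IHg|f IHf g IHg|f IHf] [|||||f' g'|f' g'|f' g'|f'] //=;
  move=> /npair_inj[] //;
  by [move=> _ /npair_inj[] /IHf -> /IHg -> | move=> _ /IHf ->].
Qed.

Fixpoint const_prog (n : nat) : prog :=
  if n is m.+1 then Comp Succ (const_prog m) else Zero.

Lemma computes_const O n m y : computes O (const_prog n) m y <-> y = n.
Proof.
elim: n y => [|n IH] y //=; split => [[k /IH -> ->//]|->].
by exists n => //; exact/IH.
Qed.

(* By the s-m-n construction alone, no universal program being needed: the
   program that ignores its input and searches for a witness of [S n] halts
   on its own code if and only if [S n]. *)
Lemma sig1_jump X S : sig1 (charfun X) S ->
  recb (charfun (jump X)) (fun n => `[< S n >]).
Proof.
move=> [b hb bS]; have [c hc] := computes_search hb.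
pose e n := prog_code (Comp c (const_prog n)).
have he : recf (charfun (jump X)) e.
  apply: (@recf_ext _ (fun n => npair 6 (npair (prog_code c)
    (nat_rect _ (prog_code Zero) (fun _ w => npair 6 (npair (prog_code Succ) w)) n)))).
    by move=> n; congr npair; congr npair; elim: n => //= n ->.
  apply: recf_npair; first exact: recf_cst.
  apply: recf_npair; first exact: recf_cst.
  apply: (@recf_nat_rect _ (fun=> prog_code Zero)
    (fun _ _ w => npair 6 (npair (prog_code Succ) w)) id);
    [exact: recf_cst| |exact: recf_id].
  apply: recf_npair; first exact: recf_cst.
  by apply: recf_npair; [exact: recf_cst|exact/recf_nsnd/recf_snd].
apply: recf_ext (recf_comp (recf_query _) he) => n; congr nat_of_bool.
rewrite /charfun; apply/idP/asboolP => [|Sn].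
  rewrite inE => -[d /prog_code_inj <- [y [m /computes_const -> h]]].
  by apply/bS; exists y; exact: (hc n).1 h.
rewrite inE; exists (Comp c (const_prog n)) => //.
have [y hy] := (hc n).2 ((bS n).1 Sn); exists y, n => //.
exact/computes_const.
Qed.

(** [X] is Sigma_1 in itself with a dummy witness, hence decidable from its jump; oracle calls are
    then substituted. *)
Lemma recf_jump X f : recf (charfun X) f -> recf (charfun (jump X)) f.
Proof.
apply: recf_turing.
have /sig1_jump : sig1 (charfun X) X.
  exists (fun n _ => n \in X).
    exact: (@recf_comp _ (charfun X) nfst (recf_query _) (recf_fst _)).
  by move=> n; split => [Xn|[_]]; rewrite ?inE//; exists 0; rewrite inE.
by apply: recf_ext => n; rewrite /charfun; congr nat_of_bool; apply/asboolP/idP; rewrite inE.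
Qed.

(** * Codes of rational vectors *)

Definition recf2 O (h : nat -> nat -> nat) := recf O (fun t => h (nfst t) (nsnd t)).

Lemma recf2_comp O h f g : recf2 O h -> recf O f -> recf O g ->
  recf O (fun n => h (f n) (g n)).
Proof.
move=> hh hf hg; apply: recf_ext (recf_comp hh (recf_npair hf hg)) => n.
by rewrite nfstE nsndE.
Qed.

Lemma recb2_comp O (b : nat -> nat -> bool) f g :
  recb O (fun t => b (nfst t) (nsnd t)) -> recf O f -> recf O g ->
  recb O (fun n => b (f n) (g n)).
Proof. exact: (@recf2_comp O (fun x y => b x y)). Qed.

Create HintDb recf.
#[export] Hint Resolve recf_npair recf_addn recf_subn recf_muln recf_expn
  recf_nfst recf_nsnd recf_succ recf_pred recf_id recf_fst recf_snd
  recf_cst recb_leq recb_neg recb_and recb_or recb_eqn recb_all : recf.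

Lemma recf2_search O (b : nat -> nat -> nat -> bool) :
  recb O (fun t => b (nfst (nfst t)) (nsnd (nfst t)) (nsnd t)) ->
  (forall n m, exists z, b n m z) ->
  exists2 g, recf2 O g & forall n m, b n m (g n m).
Proof.
move=> hb exb.
have [g hg bg] := recf_search (b := fun n z => b (nfst n) (nsnd n) z) hb
  (fun n => exb _ _).
exists (fun n m => g (npair n m)); last first.
  by move=> n m; have := bg (npair n m); rewrite nfstE nsndE.
by apply: recf_ext hg => n; rewrite npairK.
Qed.


(** [CodeSeq.code] sends [a :: s] to [2 ^ a * (2 * code s + 1)]; head and tail of a nonempty list
    are found by searching for this factorisation. *)
Lemma recf_decode O : exists2 u, recf O u &
  forall n, CodeSeq.decode n =
    if n == 0%N then [::] else nfst (u n) :: CodeSeq.decode (nsnd (u n)).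
Proof.
pose b n z := ((n == 0%N) && (z == 0%N)) ||
  (~~ (n == 0%N) && (n == 2 ^ nfst z * (nsnd z * 2).+1)%N).
have hb : recb O (fun t => b (nfst t) (nsnd t)) by rewrite /b; auto 20 with recf nocore.
have [n|u hu bu] := recf_search hb.
  rewrite /b; case: eqVneq => [_|n0] /=; first by exists 0%N.
  case E : (CodeSeq.decode n) => [|a s].
    by have := CodeSeq.decodeK n; rewrite E => /esym/eqP; rewrite (negPf n0).
  exists (npair a (CodeSeq.code s)); rewrite nfstE nsndE muln2.
  by rewrite -{1}(CodeSeq.decodeK n) E.
exists u => // n; have := bu n; rewrite /b; case: eqVneq => [-> _ //|n0] /= /eqP.
rewrite muln2 => {1}->; rewrite -{1}(CodeSeq.decodeK (nsnd (u n))).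
exact: (CodeSeq.codeK (nfst (u n) :: CodeSeq.decode (nsnd (u n)))).
Qed.

Definition code_nth n j := nth 0%N (CodeSeq.decode n) j.

Lemma recf_code_nth O : recf2 O code_nth.
Proof.
have [u hu du] := recf_decode O.
pose tl n := if n == 0%N then 0%N else nsnd (u n).
pose hd n := if n == 0%N then 0%N else nfst (u n).
have cond f : recf O f -> recf O (fun n => if n == 0%N then 0%N else f n).
  move=> hf; apply: (@recf_ext _ (fun n => (~~ (n == 0%N)) * f n)%N).
    by move=> n; case: eqVneq => //= _; rewrite mul1n.
  by apply: recf_muln => //; apply: recb_neg; auto with recf nocore.
have htl : recf O tl by apply: cond; auto with recf nocore.
have hhd : recf O hd by apply: cond; auto with recf nocore.
have dtl n j : code_nth n j.+1 = code_nth (tl n) j.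
  by rewrite /code_nth /tl (du n); case: eqVneq => //= _; rewrite nth_nil.
have dhd n : code_nth n 0 = hd n.
  by rewrite /code_nth /hd (du n); case: eqVneq.
have dit n j : code_nth n j = hd (nat_rect _ n (fun _ w => tl w) j).
  rewrite -dhd -[j in LHS]add0n; elim: j (0%N) => [|j IH] i; first by rewrite addn0.
  by rewrite /= -dtl -IH addSnnS.
apply: (@recf_ext _ (fun t => hd (nat_rect _ (nfst t) (fun _ w => tl w) (nsnd t)))).
  by move=> t; rewrite dit.
apply: recf_comp => //.
apply: (@recf_nat_rect _ nfst (fun _ _ w => tl w)); try exact: recf_snd.
  exact: recf_fst.
by apply: recf_comp htl _; auto with recf nocore.
Qed.

Lemma size_decode n : (size (CodeSeq.decode n) <= n)%N.
Proof.
rewrite -{2}(CodeSeq.decodeK n); elim: (CodeSeq.decode n) => //= a s IH.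
have := expn_gt0 2 a; nia.
Qed.

Lemma code_nth_ext n j : (n <= j)%N -> code_nth n j = 0%N.
Proof.
by move=> nj; rewrite /code_nth nth_default// (leq_trans (size_decode n)).
Qed.

Section VectorCodes.
Local Open Scope ring_scope.
Local Open Scope complex_scope.
Variable R : realType.
Implicit Types V : normedModType R[i].

(** The code 0 denotes the scalar 0, so coefficient lists can be padded to any length that exceeds
    the code. Codes of different lengths are thereby compared coordinate by coordinate. *)
Lemma rational_vectorE V (r : nat -> V) n L : (n <= L)%N ->
  rational_vector r n = \sum_(j < L) gauss_of_code R (code_nth n j) *: r j.
Proof.
move=> nL; have z0 : gauss_of_code R 0%N = 0.
  have -> : gauss_of_code R 0 = ratr (rat_of_code 0%N) +i* ratr (rat_of_code 0%N) by [].
  have -> : rat_of_code 0%N = 0 by rewrite /rat_of_code subrr mul0r.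
  by rewrite raddf0.
have sL : (size (CodeSeq.decode n) <= L)%N.
  exact: leq_trans (size_decode n) nL.
rewrite /rational_vector -(subnKC sL) big_split_ord /=.
rewrite [X in _ = _ + X]big1 ?addr0// => i _.
by rewrite /code_nth nth_default ?leq_addr// z0 scale0r.
Qed.

(** Rationals are coded as [(a - b) / (d + 1)]: the two parts of the second numerator change places,
    and [.-1] undoes the offset of the denominator. *)
Definition rat_code_sub u v :=
  npair (npair (nfst (nfst u) * (nsnd v).+1 + nsnd (nfst v) * (nsnd u).+1)%N
               (nsnd (nfst u) * (nsnd v).+1 + nfst (nfst v) * (nsnd u).+1)%N)
        ((nsnd u).+1 * (nsnd v).+1).-1%N.

Lemma rat_of_code_sub u v :
  rat_of_code (rat_code_sub u v) = rat_of_code u - rat_of_code v.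
Proof.
rewrite /rat_of_code /rat_code_sub !(nfstE, nsndE) prednK ?muln_gt0//.
rewrite !(natrD, natrM).
have hu : (nsnd u).+1%:R != 0 :> rat by rewrite pnatr_eq0.
have hv : (nsnd v).+1%:R != 0 :> rat by rewrite pnatr_eq0.
by move: (nsnd u).+1 (nsnd v).+1 hu hv => du dv hu hv; field; rewrite hu hv.
Qed.

Definition gauss_code_sub u v :=
  npair (rat_code_sub (nfst u) (nfst v)) (rat_code_sub (nsnd u) (nsnd v)).

Lemma gauss_of_code_sub u v :
  gauss_of_code R (gauss_code_sub u v) = gauss_of_code R u - gauss_of_code R v.
Proof.
by rewrite /gauss_of_code /gauss_code_sub !(nfstE, nsndE) !rat_of_code_sub !raddfB.
Qed.

Lemma gauss_code_sub00 : gauss_code_sub 0%N 0%N = 0%N.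
Proof. by []. Qed.

Lemma recf_gauss_code_sub O : recf2 O gauss_code_sub.
Proof. rewrite /recf2 /gauss_code_sub /rat_code_sub; auto 50 with recf nocore. Qed.

(** A code of the difference is searched for rather than built. Entries of a code at positions
    beyond its own value are 0, so comparing entries below [n + m + z] is enough, and this is
    decidable. The function acts on codes alone and serves every space. *)
Lemma recf_vector_sub O : exists2 vs : nat -> nat -> nat, recf2 O vs &
  forall V (r : nat -> V) n m,
    rational_vector r (vs n m) = rational_vector r n - rational_vector r m.
Proof.
pose b n m z := all (fun j => code_nth z j ==
  gauss_code_sub (code_nth n j) (code_nth m j)) (iota 0 (n + m + z)%N).
have hn f g := @recf2_comp O code_nth f g (recf_code_nth O).
have hg f g := @recf2_comp O gauss_code_sub f g (recf_gauss_code_sub O).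
have [|n m|vs hvs bvs] := @recf2_search O b.
- apply: (@recb_all O (fun t j => code_nth (nsnd t) j ==
    gauss_code_sub (code_nth (nfst (nfst t)) j) (code_nth (nsnd (nfst t)) j))
    (fun t => nfst (nfst t) + nsnd (nfst t) + nsnd t)%N); last by auto with recf nocore.
  auto 20 with recf nocore.
- pose c j := gauss_code_sub (code_nth n j) (code_nth m j).
  exists (CodeSeq.code (mkseq c (n + m)%N)); apply/allP => j _; apply/eqP.
  rewrite /code_nth CodeSeq.codeK; have [jl|jl] := ltnP j (n + m)%N.
    by rewrite nth_mkseq.
  rewrite nth_default ?size_mkseq// -!/(code_nth _ _) !code_nth_ext ?gauss_code_sub00//.
    exact: leq_trans (leq_addl _ _) jl.
  exact: leq_trans (leq_addr _ _) jl.
exists vs => // V r n m; set L := (n + m + vs n m)%N.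
rewrite !(@rational_vectorE V r _ L) /L; try lia.
rewrite -sumrB; apply: eq_bigr => j _; rewrite -scalerBl -gauss_of_code_sub.
have /allP/(_ (j : nat)) := bvs n m; rewrite mem_iota add0n ltn_ord => /(_ isT)/eqP ->.
by [].
Qed.

End VectorCodes.

Local Open Scope classical_set_scope.
Local Open Scope ring_scope.
Local Open Scope complex_scope.

(** * Dyadic approximations of norms *)

Section RealNorm.
Variables (R : realType) (V : normedModType R[i]).
Implicit Types v w : V.

Definition rnorm v : R := complex.Re `|v|.

Lemma rnormE v : `|v| = (rnorm v)%:C.
Proof. by rewrite RRe_real// normr_real. Qed.

Lemma rnorm_ge0 v : 0 <= rnorm v.
Proof. by rewrite -ler0c -rnormE. Qed.

Lemma rnormD v w : rnorm (v + w) <= rnorm v + rnorm w.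
Proof. by rewrite -lecR [leRHS]rmorphD/= -!rnormE ler_normD. Qed.

Lemma rnormN v : rnorm (- v) = rnorm v.
Proof. by rewrite /rnorm normrN. Qed.

Lemma rnormB v w : rnorm (v - w) = rnorm (w - v).
Proof. by rewrite -rnormN opprB. Qed.

Lemma rnorm0 : rnorm (0 : V) = 0.
Proof. by rewrite /rnorm normr0. Qed.

Lemma rnorm_sum (I : Type) (s : seq I) (P : pred I) (F : I -> V) :
  rnorm (\sum_(i <- s | P i) F i) <= \sum_(i <- s | P i) rnorm (F i).
Proof.
elim/big_ind2: _ => // [|x a y b xa yb]; first by rewrite rnorm0.
by rewrite (le_trans (rnormD _ _))// lerD.
Qed.

Lemma ler_dist_rnorm v w : `|rnorm v - rnorm w| <= rnorm (v - w).
Proof.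
rewrite ler_distlC; apply/andP; split.
  by have := rnormD (v - w) w; rewrite subrK; lra.
by have := rnormD (w - v) v; rewrite subrK (rnormB w v); lra.
Qed.

End RealNorm.

Section DyadicApproximation.
Variable R : realType.

Lemma exp2_unbounded (x : R) : exists n, x <= 2 ^+ n.
Proof.
exists (Num.truncn `|x|).+1.
have /andP[_ h] := truncn_itv (normr_ge0 x).
apply: (le_trans (ler_norm x)); apply/ltW/(lt_trans h).
by rewrite -natrX ltr_nat ltn_expl.
Qed.

(** Integer approximations turn inequalities between norms into decidable inequalities between
    natural numbers. Of the error 2, one unit is the scaled rational error and one is rounding
    down. *)
Lemma recf_dyadic O (x : nat -> R) (q : nat -> nat -> nat) :
  (forall n, 0 <= x n) -> recf2 O q ->
  (forall n l, `|x n - ratr (rat_of_code (q n l))| < 2 ^- l) ->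
  exists2 a, recf2 O a & forall n l, `|2 ^+ l * x n - (a n l)%:R| <= 2.
Proof.
move=> x0 hq xq.
pose N n l := (2 ^ l * (nfst (nfst (q n l)) - nsnd (nfst (q n l))))%N.
pose D n l := (nsnd (q n l)).+1.
pose b n l z := (z * D n l <= N n l)%N && (N n l < z.+1 * D n l)%N.
have hqc f g := @recf2_comp O q f g hq.
have [||a ha ba] := @recf2_search O b.
- by rewrite /b /N /D; auto 30 with recf nocore.
- move=> n l; exists (N n l %/ D n l)%N.
  by rewrite /b leq_trunc_div ltn_ceil.
exists a => // n l; have /andP[] := ba n l; have := xq n l; have := x0 n.
rewrite /N /D /rat_of_code; move: (a n l) (x n) (nfst (nfst (q n l))) (nsnd (nfst (q n l))) (nsnd (q n l)).
move=> z y u v d y0.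
have d0 : 0 < d.+1%:R :> R by [].
have e0 : 0 < 2 ^+ l :> R by rewrite exprn_gt0.
rewrite fmorph_div rmorphB /= !ratr_nat => H h1 h2.
set X := (_ / _ : R) in H; have HX : X * d.+1%:R = u%:R - v%:R :> R.
  by rewrite /X mulfVK// gt_eqF.
have {}H : `|2 ^+ l * y - 2 ^+ l * X| < 1.
  by rewrite -mulrBr normrM gtr0_norm// -ltr_pdivlMl// mulr1.
have [vu|uv] := leqP v u.
  have {}HX : X * d.+1%:R = (u - v)%:R :> R by rewrite natrB.
  have : `|2 ^+ l * X - z%:R| <= 1.
    move: h1 h2; rewrite -(ler_nat R) -(ltr_nat R) !natrM natrX -HX.
    rewrite mulrA ler_pM2r// ltr_pM2r// => h1 h2.
    by rewrite ger0_norm ?subr_ge0// lerBlDl natr1 ltW.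
  have := ler_distD (2 ^+ l * X) (2 ^+ l * y) z%:R; lra.
(* A negative approximation is truncated to 0, which is harmless as [x n] is nonnegative. *)
move: h1; have /eqP -> : (u - v == 0)%N by rewrite subn_eq0 ltnW.
rewrite muln0 leqn0 muln_eq0 orbF => /eqP ->; rewrite subr0 ger0_norm ?mulr_ge0//.
have : 2 ^+ l * X <= 0.
  rewrite pmulr_rle0// -(pmulr_lle0 _ d0) HX subr_le0 ler_nat; exact: ltnW.
move: H; rewrite ltr_norml; lra.
Qed.

Lemma recf_norm_approx (V : normedModType R[i]) (P : presentation V) :
  computable_presentation P ->
  exists2 a, recf2 (charfun set0) a &
    forall n l, `|2 ^+ l * rnorm (rational_vector P n) - (a n l)%:R| <= 2.
Proof.
move=> [c hc].
have /choice[q hq] t : exists y, computes (charfun set0) c t y /\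
    `|rnorm (rational_vector P (nfst t)) - ratr (rat_of_code y)| < 2 ^- (nsnd t).
  have [y h1] := hc (nfst t) (nsnd t); rewrite npairK in h1 => h2.
  exists y; split => //; move: h2.
  have -> : ratr (rat_of_code y) = (ratr (rat_of_code y) : R)%:C.
    by rewrite -[LHS](fmorph_rat (real_complex R)).
  rewrite rnormE -rmorphB normc_def /= expr0n addr0 sqrtr_sqr.
  have -> : 2 ^- nsnd t = (2 ^- nsnd t : R)%:C by rewrite fmorphV rmorphXn rmorph_nat.
  by rewrite ltcR.
apply: (@recf_dyadic _ _ (fun n l => q (npair n l))).
- by move=> n; exact: rnorm_ge0.
- by exists c => t; have := (hq t).1; rewrite npairK.
- by move=> n l; have := (hq (npair n l)).2; rewrite nfstE nsndE.
Qed.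

Variables (p : R) (p1 : 1 <= p).
Hypothesis p_computable : computable_real p.

Definition kappa : R := 2 `^ p^-1.

Let p0 : 0 < p. Proof. exact: lt_le_trans p1. Qed.

Lemma kappa_powR : kappa `^ p = 2.
Proof. by rewrite -powRrM mulVf ?gt_eqF// powRr1. Qed.

Lemma kappa_gt1 : 1 < kappa.
Proof.
have : (1 : R) `^ p^-1 < 2 `^ p^-1.
  by apply: gt0_ltr_powR; rewrite ?invr_gt0 ?nnegrE// ltr1n.
by rewrite powR1.
Qed.

Lemma kappa_le2 : kappa <= 2.
Proof. by rewrite -[leRHS]powRr1// ler_powR ?ler1n// invf_le1. Qed.

Lemma ln_kappa : ln kappa = ln 2 / p.
Proof. by rewrite ln_powR mulrC. Qed.

Let ler_ln_nat a b c d : (0 < a)%N -> (0 < c)%N ->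
  (a ^ b <= c ^ d)%N = (b%:R * ln (a%:R : R) <= d%:R * ln c%:R).
Proof.
move=> a0 c0; rewrite -(ler_nat R) !natrX -[LHS]ler_ln ?posrE ?exprn_gt0 ?ltr0n//.
by rewrite !lnXn ?ltr0n// !mulr_natl.
Qed.

(** The tests in [b] say [(k / 2 ^ l) ^ s <= 2] for a rational [s >= p] and
    [2 <= ((k + 2) / 2 ^ l) ^ s] for a rational [s <= p], with denominators cleared; the rationals
    are [(A m + 2) / 2 ^ m] and [(A m - 2) / 2 ^ m]. They enclose [2 ^ l * kappa] between [k] and
    [k + 2]. *)
Lemma recf_kappa_approx : exists2 K, recf (charfun set0) K &
  forall l, `|2 ^+ l * kappa - (K l)%:R| <= 2.
Proof.
have [A hA pA] : exists2 A, recf (charfun set0) A &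
    forall m, `|2 ^+ m * p - (A m)%:R| <= 2.
  have [c hc] := p_computable.
  have /choice[q hq] m : exists y, computes (charfun set0) c m y /\
      `|p - ratr (rat_of_code y)| < 2 ^- m.
    by have [y h1 h2] := hc m; exists y.
  have [|||a ha pa] := @recf_dyadic (charfun set0) (fun=> p) (fun _ m => q m).
  - by move=> _; exact: ltW.
  - by apply: recf_comp (recf_snd _); exists c => m; exact: (hq m).1.
  - by move=> _ m; exact: (hq m).2.
  exists (a 0%N); last by move=> m; exact: pa.
  by apply: (recf2_comp ha); auto with recf nocore.
pose b l z := [&& (0 < nfst z)%N,
  (nfst z ^ (A (nsnd z) + 2) <= 2 ^ (2 ^ nsnd z + l * (A (nsnd z) + 2)))%N &
  (2 ^ (2 ^ nsnd z + l * (A (nsnd z) - 2)) <= (nfst z + 2) ^ (A (nsnd z) - 2))%N].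
have hAc f := @recf_comp _ A f hA.
have [||K hK bK] := @recf_search (charfun set0) b.
- by rewrite /b; auto 30 with recf nocore.
- move=> l; pose x := 2 ^+ l * kappa.
  have k1 := kappa_gt1; have e0 : 0 < 2 ^+ l :> R by rewrite exprn_gt0.
  have xe : 2 ^+ l < x by rewrite /x ltr_pMr.
  (* Both inequalities must be strict for finite precision to confirm them. The width is 2 because
     [2 ^ l * kappa] may be an integer, as for [p = 1]; then [k] is that integer minus one. *)
  have [k k0 /andP[kx xk]] : exists2 k, (0 < k)%N & k%:R < x < k.+2%:R.
    have x0 : 0 <= x by lra.
    have /andP[t1 t2] := truncn_itv x0; set t := Num.truncn x in t1 t2.
    have x1 : 1 < x by apply: le_lt_trans xe; rewrite exprn_ege1// ler1n.
    have t0 : (0 < t)%N.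
      by rewrite -(ltr_nat R); move: t2; rewrite -natr1; lra.
    case: (eqVneq t%:R x) => tx; last first.
      exists t; rewrite // lt_neqAle tx t1 /= (lt_trans t2)// ltr_nat//.
    have t2' : (1 < t)%N by rewrite -(ltr_nat R) tx.
    exists t.-1; first by rewrite -ltnS prednK.
    by rewrite -tx !ltr_nat; move: (t) t0 => [//|u] _; rewrite /= !ltnS leqnn ?leqnSn.
  have k0R : 0 < k%:R :> R by rewrite ltr0n.
  pose y := ln (k%:R / 2 ^+ l) : R; pose y' := ln (k.+2%:R / 2 ^+ l) : R.
  have ylt : y < ln 2 / p.
    rewrite -ln_kappa ltr_ln ?posrE ?divr_gt0//; last by lra.
    by rewrite ltr_pdivrMr// mulrC.
  have ygt : ln 2 / p < y'.
    rewrite -ln_kappa ltr_ln ?posrE ?divr_gt0//; last by lra.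
    by rewrite ltr_pdivlMr// mulrC.
  have {}ylt : 0 < ln 2 - y * p by rewrite subr_gt0 -ltr_pdivlMr.
  have {}ygt : 0 < y' * p - ln 2 by rewrite subr_gt0 -ltr_pdivrMr.
  (* The exponents [A m + 2] and [A m - 2] differ from [2 ^ m * p] by at most 4; for this [m] that
     error, times the logarithms [y] and [y'], fits into the gaps left by the strict
     inequalities. *)
  have [m] := exp2_unbounded (4 * `|y| / (ln 2 - y * p) + 4 * `|y'| / (y' * p - ln 2)).
  have f1 : 0 <= 4 * `|y| / (ln 2 - y * p) by rewrite divr_ge0 ?mulr_ge0// ltW.
  have f2 : 0 <= 4 * `|y'| / (y' * p - ln 2) by rewrite divr_ge0 ?mulr_ge0// ltW.
  move=> fm; have {f2} : 4 * `|y| / (ln 2 - y * p) <= 2 ^+ m by lra.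
  have {f1 fm} : 4 * `|y'| / (y' * p - ln 2) <= 2 ^+ m by lra.
  rewrite !ler_pdivrMr// => h1 h2.
  have ly : 0 <= `|y| by []. have ly' : 0 <= `|y'| by [].
  have yy := ler_norm y; have yy' := ler_norm y'.
  exists (npair k m); rewrite /b !(nfstE, nsndE) k0 /=.
  have M0 : 0 < 2 ^+ m :> R by rewrite exprn_gt0.
  have ln20 : 0 < ln 2 :> R by rewrite ln_gt0// ltr1n.
  have := pA m; rewrite ler_norml => /andP[am1 am2].
  apply/andP; split.
    rewrite ler_ln_nat//; have -> : ln k%:R = y + l%:R * ln 2 :> R.
      by rewrite /y ln_div ?posrE// lnXn// mulr_natl subrK.
    rewrite !natrD natrM natrX natrD.
    suff : ((A m)%:R + 2) * y <= 2 ^+ m * ln 2 by nra.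
    have : ((A m)%:R + 2) * y <= ((A m)%:R + 2) * y by [].
    have : ((A m)%:R + 2) * y <= (2 ^+ m * p) * y + 4 * `|y|.
      have : `|((A m)%:R + 2 - 2 ^+ m * p) * y| <= 4 * `|y|.
        by rewrite normrM ler_wpM2r// ler_norml; lra.
      by rewrite ler_norml; lra.
    by nra.
  rewrite ler_ln_nat ?addn2//; have -> : ln k.+2%:R = y' + l%:R * ln 2 :> R.
    by rewrite /y' ln_div ?posrE// lnXn// mulr_natl subrK.
  rewrite !natrD natrM natrX.
  suff : 2 ^+ m * ln 2 <= (A m - 2)%:R * y' by nra.
  have : `|((A m - 2)%:R - 2 ^+ m * p) * y'| <= 4 * `|y'|.
    rewrite normrM ler_wpM2r//.
    have [a2|a2] := leqP 2 (A m); first by rewrite natrB// ler_norml; lra.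
    have /eqP -> : (A m - 2 == 0)%N by rewrite subn_eq0 ltnW.
    have : (A m)%:R < 2 :> R by rewrite (ltr_nat R _ 2).
    have : 0 < 2 ^+ m * p by rewrite mulr_gt0.
    by rewrite mulr0n ler_norml; lra.
  by rewrite ler_norml; nra.
exists (fun l => nfst (K l)); first exact: recf_nfst.
move=> l; have /and3P[] := bK l; move: (nfst (K l)) (nsnd (K l)) => k m k0.
have e0 : 0 < 2 ^+ l :> R by rewrite exprn_gt0.
have M0 : 0 < 2 ^+ m :> R by rewrite exprn_gt0.
have ln20 : 0 < ln 2 :> R by rewrite ln_gt0// ltr1n.
have k0R : 0 < k%:R :> R by rewrite ltr0n.
have kap0 : 0 < kappa by have := kappa_gt1; lra.
have := pA m; rewrite ler_norml => /andP[am1 am2].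
have k2 : (0 < k + 2)%N by rewrite addn2.
rewrite !ler_ln_nat// {k2} !(natrD, natrM, natrX) => h1 h2.
have k2 : 0 < k%:R + 2 :> R by rewrite addr_gt0.
pose y := ln (k%:R / 2 ^+ l) : R; pose y' := ln ((k%:R + 2) / 2 ^+ l) : R.
have Ey : ln k%:R = y + l%:R * ln 2 :> R.
  by rewrite /y ln_div ?posrE// lnXn// mulr_natl subrK.
have Ey' : ln (k%:R + 2) = y' + l%:R * ln 2 :> R.
  by rewrite /y' ln_div ?posrE// lnXn// mulr_natl subrK.
have {Ey}h1 : ((A m)%:R + 2) * y <= 2 ^+ m * ln 2 by rewrite Ey in h1; nra.
have {Ey'}h2 : 2 ^+ m * ln 2 <= (A m - 2)%:R * y' by rewrite Ey' in h2; nra.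
have ylk : y <= ln kappa.
  rewrite ln_kappa ler_pdivlMr//; have [y0|y0] := leP y 0; first by rewrite (le_trans _ (ltW ln20))// mulr_le0_ge0// ltW.
  have : (2 ^+ m * p) * y <= 2 ^+ m * ln 2.
    by apply: le_trans h1; rewrite ler_wpM2r//; [exact: ltW|lra].
  by rewrite -mulrA ler_pM2l// mulrC.
have y'lk : ln kappa <= y'.
  rewrite ln_kappa ler_pdivrMr//.
  have hpos : 0 < (A m - 2)%:R * y' by apply: lt_le_trans h2; rewrite mulr_gt0.
  have [a2|a2] := leqP 2 (A m); last first.
    by move: hpos; have /eqP -> : (A m - 2 == 0)%N by [rewrite subn_eq0 ltnW]; rewrite mul0r ltxx.
  have y'0 : 0 < y'.
    by rewrite ltNge; apply/negP => y'0; move: hpos; rewrite ltNge mulr_ge0_le0.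
  have : 2 ^+ m * ln 2 <= (2 ^+ m * p) * y'.
    by apply: (le_trans h2); rewrite ler_wpM2r//; [exact: ltW|rewrite natrB//; lra].
  by rewrite -mulrA ler_pM2l// mulrC.
move: ylk; rewrite ler_ln ?posrE ?divr_gt0// ler_pdivrMr// => h3.
move: y'lk; rewrite ler_ln ?posrE ?divr_gt0// ler_pdivlMr// => h4.
rewrite ler_norml; lra.
Qed.

End DyadicApproximation.

(** * Clarkson's inequality at a point *)

Section PowerConvexity.
Variable R : realType.
Implicit Types (r x y t : R).

Lemma powR_convex r t x y : 1 <= r -> 0 <= t <= 1 -> 0 <= x -> 0 <= y ->
  (t * x + (1 - t) * y) `^ r <= t * x `^ r + (1 - t) * y `^ r.
Proof.
move=> r1 /andP[t0 t1] x0 y0.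
have := @convex_powR R r r1 (@Itv01 R t t0 t1) x y.
by rewrite !inE /= !in_itv /= !andbT => /(_ x0 y0); rewrite !convRE.
Qed.

Lemma powR_concave r t x y : 0 < r <= 1 -> 0 <= t <= 1 -> 0 <= x -> 0 <= y ->
  t * x `^ r + (1 - t) * y `^ r <= (t * x + (1 - t) * y) `^ r.
Proof.
move=> /andP[r0 r1] t01 x0 y0; have /andP[t0 t1] := t01.
have t1' : 0 <= 1 - t by rewrite subr_ge0.
have := powR_convex (r := r^-1) _ t01 (powR_ge0 x r) (powR_ge0 y r).
rewrite invf_ge1// -!powRrM divff ?gt_eqF// !powRr1// => /(_ r1).
have u0 : 0 <= t * x `^ r + (1 - t) * y `^ r by rewrite addr_ge0 ?mulr_ge0 ?powR_ge0.
have v0 : 0 <= t * x + (1 - t) * y by rewrite addr_ge0 ?mulr_ge0.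
move=> /(ge0_ler_powR (ltW r0)); rewrite !nnegrE powR_ge0 v0 => /(_ isT isT).
by rewrite -powRrM mulVf ?gt_eqF// powRr1.
Qed.

(** The sign of [1 - r] merges the concave, linear and convex cases. *)
Lemma powR_sg_concave r t x y : 0 < r -> 0 <= t <= 1 -> 0 <= x -> 0 <= y ->
  Num.sg (1 - r) * (t * x `^ r + (1 - t) * y `^ r) <=
  Num.sg (1 - r) * (t * x + (1 - t) * y) `^ r.
Proof.
move=> r0 t01 x0 y0; case: (ltgtP r 1) => r1.
- by rewrite gtr0_sg ?subr_gt0// !mul1r powR_concave// r0 ltW.
- by rewrite ltr0_sg ?subr_lt0// !mulN1r lerN2 powR_convex// ltW.
- by rewrite r1 subrr sgr0 !mul0r.
Qed.

Variable p : R.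
Hypothesis p1 : 1 <= p.

(** The defect in the parallelogram law with exponent [p]: for [p] other than 2 it vanishes only
    when [a] or [b] is 0. *)
Definition clarkson (a b : R[i]) : R :=
  2 * normc a `^ p + 2 * normc b `^ p - normc (a + b) `^ p - normc (a - b) `^ p.

Lemma normc_sqr_powR (a : R[i]) : normc a `^ p =
  (complex.Re a ^+ 2 + complex.Im a ^+ 2) `^ (p / 2).
Proof.
case: a => x y /=; rewrite [in RHS]mulrC powRrM; congr (_ `^ _).
by rewrite powR12_sqrt// addr_ge0// sqr_ge0.
Qed.

Lemma clarksonC a b : clarkson a b = clarkson b a.
Proof.
rewrite /clarkson (addrC b a) -(opprB a b).
have -> : normc (- (a - b)) = normc (a - b).
  by case: (a - b) => x y /=; rewrite !sqrrN.
lra.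
Qed.

(** Let [A], [B] be the squared moduli, [r = p / 2], [B <= A] and, for definiteness, [r < 1]. By the
    parallelogram law the squared moduli of [a + b] and [a - b] have mean [A + B], so concavity
    bounds the sum of their r-th powers by twice that of [A + B]. The pairs [B, A + B] and
    [2 * B, A] have the same sum and the second is less spread out, so concavity again bounds the
    r-th power of [A + B] through those of [2 * B], [A] and [B]. The powers of [A] cancel and a
    multiple of that of [B] remains. *)
Lemma clarkson_ge a b : 2 * `|2 - 2 `^ (p / 2)| * (Num.min (normc a) (normc b)) `^ p <=
  Num.sg (2 - p) * clarkson a b.
Proof.
wlog ab : a b / normc b <= normc a.
  move=> H; have /orP[/H//|/H] := le_total (normc b) (normc a).
  by rewrite minC clarksonC.
rewrite min_r//; set s := Num.sg (2 - p); set r := p / 2.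
have p0 : 0 < p by exact: lt_le_trans p1.
have r0 : 0 < r by rewrite divr_gt0.
have -> : s = Num.sg (1 - r).
  rewrite /s /r; have -> : 2 - p = 2 * (1 - p / 2) by field.
  by rewrite sgrM (_ : Num.sg 2 = 1) ?mul1r// gtr0_sg.
pose A : R := complex.Re a ^+ 2 + complex.Im a ^+ 2.
pose B : R := complex.Re b ^+ 2 + complex.Im b ^+ 2.
have A0 : 0 <= A by rewrite addr_ge0// sqr_ge0.
have B0 : 0 <= B by rewrite addr_ge0// sqr_ge0.
have BA : B <= A.
  move: ab; rewrite /A /B; case: (a) (b) => x y [z w] /=.
  by rewrite ler_sqrt// addr_ge0// sqr_ge0.
rewrite /clarkson !normc_sqr_powR -/r -/A -/B.
set X : R := complex.Re (a + b) ^+ 2 + _; set Y : R := complex.Re (a - b) ^+ 2 + _.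
have X0 : 0 <= X by rewrite addr_ge0// sqr_ge0.
have Y0 : 0 <= Y by rewrite addr_ge0// sqr_ge0.
have XY : X + Y = 2 * (A + B).
  by rewrite /X /Y /A /B; case: (a) (b) => x y [z w] /=; ring.
have half01 : 0 <= (2^-1 : R) <= 1 by rewrite invr_ge0 ler0n invf_le1 ?ler1n.
have := powR_sg_concave r0 half01 X0 Y0.
have -> : 2^-1 * X + (1 - 2^-1) * Y = A + B by lra.
have : Num.sg (1 - r) * (B `^ r + (A + B) `^ r) <=
       Num.sg (1 - r) * ((2 * B) `^ r + A `^ r).
  have [A00|A00] := eqVneq A 0.
    have B00 : B = 0 by lra.
    by rewrite A00 B00 mulr0 addr0.
  have A1 : 0 < A by rewrite lt0r A00.
  have t01 : 0 <= B / A <= 1 by rewrite divr_ge0//= ler_pdivrMr// mul1r.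
  have AB0 := addr_ge0 A0 B0.
  have := powR_sg_concave r0 t01 B0 AB0; have := powR_sg_concave r0 t01 AB0 B0.
  have -> : B / A * (A + B) + (1 - B / A) * B = 2 * B by field.
  have -> : B / A * B + (1 - B / A) * (A + B) = A by field.
  rewrite !mulrDr !mulrDl; lra.
have -> : 2 * `|2 - 2 `^ r| * B `^ r =
    2 * Num.sg (1 - r) * (2 * B `^ r - (2 * B) `^ r).
  rewrite powRM// -mulrBl mulrA; congr (_ * _); rewrite -mulrA; congr (_ * _).
  case: (ltgtP r 1) => r1.
  - rewrite gtr0_sg ?subr_gt0// mul1r ger0_norm// subr_ge0.
    by rewrite -[leRHS]powRr1// ler_powR ?ler1n ?ltW.
  - rewrite ltr0_sg ?subr_lt0// mulN1r ler0_norm// subr_le0.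
    by rewrite -[leLHS]powRr1// ler_powR ?ler1n ?ltW.
  - by rewrite r1 subrr sgr0 powRr1// subrr normr0 mul0r.
rewrite !mulrDr; lra.
Qed.

Lemma clarkson_coef_gt0 : p != 2 -> 0 < 2 * `|2 - 2 `^ (p / 2)|.
Proof.
move=> p2; rewrite mulr_gt0// normr_gt0 subr_eq0; apply/negP => /eqP e.
have /(congr1 (@ln R)) := e; rewrite ln_powR => /eqP.
rewrite -{1}[ln 2]mul1r (inj_eq (mulIf _)); last by rewrite gt_eqF// ln_gt0// ltr1n.
by move=> /eqP e1; move/eqP: p2; lra.
Qed.

Lemma clarkson_ge0 a b : 0 <= Num.sg (2 - p) * clarkson a b.
Proof. by apply: le_trans (clarkson_ge a b); rewrite !mulr_ge0 ?powR_ge0. Qed.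

End PowerConvexity.

(** * Almost disjoint families *)

Section AlmostDisjoint.
Variables (R : realType) (p : R).
Hypotheses (p1 : 1 <= p) (p_neq2 : p != 2).

Let p0 : 0 < p. Proof. exact: lt_le_trans p1. Qed.

(** An integer [P] above [p] turns the claim into linear bounds on integer powers of [1 + d] and
    [1 - d], which follow by induction. *)
Lemma powR_perturb (P : nat) (d t x : R) : p <= P%:R -> 0 <= d <= 1 -> 0 <= t ->
  0 <= x -> `|x - t| <= d * t -> `|x `^ p - t `^ p| <= 2 ^+ P * d * t `^ p.
Proof.
move=> pP /andP[d0 d1] t0 x0 /[!ler_distlC] /andP[lx ux].
have hi : (1 + d) `^ p <= 1 + 2 ^+ P * d.
  have d1' : 1 <= 1 + d by rewrite lerDl.
  apply: (le_trans (ler_powR d1' pP)); rewrite powR_mulrn ?(le_trans _ d1')//.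
  suff : (1 + d) ^+ P <= 1 + (2 ^+ P - 1) * d by lra.
  elim: P {pP} => [|P IH]; first by rewrite !expr0 subrr mul0r addr0.
  have e1 : 1 <= 2 ^+ P :> R by rewrite exprn_ege1// ler1n.
  rewrite !exprS; have := ler_wpM2l (ltW (lt_le_trans ltr01 d1')) IH.
  have : (2 ^+ P - 1) * d * d <= (2 ^+ P - 1) * d by rewrite ler_piMr// mulr_ge0// subr_ge0.
  lra.
have lo : 1 - 2 ^+ P * d <= (1 - d) `^ p.
  have d2 : 0 <= 1 - d by rewrite subr_ge0.
  have [->|dn1] := eqVneq d 1.
    rewrite subrr powR0 ?gt_eqF// mulr1 subr_le0 exprn_ege1// ler1n//.
  have d3 : 0 < 1 - d <= 1 by rewrite subr_gt0 lt_neqAle dn1 d1 gerBl.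
  apply: le_trans (ger_powR d3 pP); rewrite powR_mulrn//.
  elim: P {pP hi} => [|P IH]; first by rewrite !expr0 mul1r gerBl.
  have e1 : 1 <= 2 ^+ P :> R by rewrite exprn_ege1// ler1n.
  rewrite !exprS; have := ler_wpM2l d2 IH.
  have : 0 <= (2 ^+ P - 1) * d by rewrite mulr_ge0// subr_ge0.
  have : 0 <= 2 ^+ P * d * d by rewrite !mulr_ge0.
  lra.
have tp0 := powR_ge0 t p.
have h1 : x `^ p <= (1 + 2 ^+ P * d) * t `^ p.
  apply: (@le_trans _ _ (((1 + d) * t) `^ p)).
    by apply: (ge0_ler_powR (ltW p0)); rewrite ?nnegrE ?mulr_ge0 ?addr_ge0//; lra.
  by rewrite powRM ?addr_ge0// ler_wpM2r.
have h2 : (1 - 2 ^+ P * d) * t `^ p <= x `^ p.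
  apply: (@le_trans _ _ (((1 - d) * t) `^ p)).
    by rewrite powRM ?subr_ge0// ler_wpM2r.
  by apply: (ge0_ler_powR (ltW p0)); rewrite ?nnegrE ?mulr_ge0 ?subr_ge0//; lra.
by apply/andP; split; lra.
Qed.

(** At most one entry can exceed [tau]; it is bounded by [M] and all others by [tau]. *)
Lemma sum_pairwise_min (N : nat) (F : 'I_N -> R) (M tau : R) :
  0 <= M -> 0 <= tau -> (forall i, F i <= M) ->
  (forall i k : 'I_N, (k < i)%N -> Num.min (F i) (F k) <= tau) ->
  \sum_i F i <= M + N%:R * tau.
Proof.
move=> M0 t0 FM Fm.
have Fsum (Q : pred 'I_N) : (forall i, Q i -> F i <= tau) ->
    \sum_(i | Q i) F i <= N%:R * tau.
  move=> h; apply: (le_trans (ler_sum _ h)).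
  rewrite sumr_const -[tau *+ _]mulr_natl ler_wpM2r// ler_nat -[leqRHS]card_ord.
  exact: max_card.
case: (pickP (fun i => tau < F i)) => [i Fi|h].
  rewrite (bigD1 i)//= lerD// Fsum// => k ki.
  have := ki; rewrite neq_ltn => /orP[] lt; have := Fm _ _ lt.
    by rewrite ge_min leNgt Fi.
  by rewrite ge_min [X in _ || X]leNgt Fi orbF.
apply: ler_wpDl => //; apply: Fsum => i _.
by rewrite leNgt h.
Qed.

Variable W : normedModType R[i].

Definition clarksonN (v w : W) : R :=
  2 * rnorm v `^ p + 2 * rnorm w `^ p - rnorm (v + w) `^ p - rnorm (v - w) `^ p.

Definition almost_disjoint (d t : R) (N : nat) (g : nat -> W) : Prop :=
  (forall i, (i < N)%N -> `|rnorm (g i) - t| <= d * t) /\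
  (forall i k, (i < N)%N -> (k < i)%N ->
    `|rnorm (g i + g k) - kappa p * t| <= d * t /\
    `|rnorm (g i - g k) - kappa p * t| <= d * t).

(** The common interface of the atoms of [l^p_n] and [l^p]: pointwise defects all have the sign of
    [2 - p], so the one at a single atom is at most the defect of the whole norm. *)
Definition clarkson_coordinate (ev : W -> R[i]) : Prop :=
  (forall w, normc (ev w) <= rnorm w) /\
  (forall v w, Num.sg (2 - p) * clarkson p (ev v) (ev w) <=
               Num.sg (2 - p) * clarksonN v w).

Lemma almost_disjoint_coordinate : exists D : nat, forall N (d t : R) g ev,
  clarkson_coordinate ev -> 0 <= d <= 2 ^- (D * N.+1) -> 0 <= t ->
  almost_disjoint d t N g -> \sum_(i < N) normc (ev (g i)) <= 3 * t.
Proof.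
have c0 := clarkson_coef_gt0 p_neq2; set c := 2 * _ in c0.
have [C cC] := exp2_unbounded c^-1.
pose P := (Num.truncn p).+1.
have pP : p <= P%:R.
  by have /andP[_ /ltW] := truncn_itv (ltW p0).
(* In [D], [P + 3] absorbs the error factor [2 ^+ P * 8], [C] the Clarkson constant [c], and the
   last [P] the p-th power of [N.+1], which is at most [2 ^ (P * N.+1)]. *)
exists (P + 3 + C + P)%N => N d t g ev [evn evc] /andP[d0 dD] t0 [gt gk].
have d1 : d <= 1.
  apply: (le_trans dD); rewrite invf_le1 ?exprn_gt0//.
  by rewrite exprn_ege1// ler1n.
have kap0 : 0 < kappa p by apply: lt_trans (kappa_gt1 p1).
(* If both entries exceeded [t / N.+1], the defect at this atom would be larger than the total
   defect, which almost disjointness keeps near 0. *)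
have key (i k : 'I_N) : (k < i)%N ->
    Num.min (normc (ev (g i))) (normc (ev (g k))) <= t / N.+1%:R.
  move=> ki; rewrite leNgt; apply/negP => lt.
  have := clarkson_ge p1 (ev (g i)) (ev (g k)); rewrite -/c; set m := Num.min _ _ in lt *.
  move=> /le_trans /(_ (evc _ _)) h.
  have d01 : 0 <= d <= 1 by rewrite d0.
  have tp0 := powR_ge0 t p.
  have kt0 : 0 <= kappa p * t by rewrite mulr_ge0// ltW.
  have kt : d * t <= d * (kappa p * t).
    by rewrite ler_wpM2l// ler_peMl// ltW// kappa_gt1.
  have [p_ m_] := gk i k (ltn_ord i) ki.
  have n1 := powR_perturb pP d01 t0 (rnorm_ge0 _) (gt i (ltn_ord i)).
  have n2 := powR_perturb pP d01 t0 (rnorm_ge0 _) (gt k (ltn_ord k)).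
  have n3 := powR_perturb pP d01 kt0 (rnorm_ge0 _) (le_trans p_ kt).
  have n4 := powR_perturb pP d01 kt0 (rnorm_ge0 _) (le_trans m_ kt).
  (* For exact norms the defect is 0. Each of its four terms is off by at most [2 * 2 ^+ P * d]
     times the power of [t], either through its coefficient 2 or because the p-th power of [kappa p]
     is 2. *)
  have {n3 n4 n1 n2}h2 : `|clarksonN (g i) (g k)| <= 2 ^+ P * 8 * d * t `^ p.
    move: n1 n2 n3 n4; rewrite powRM ?(ltW kap0)// kappa_powR// /clarksonN.
    rewrite !ler_distlC => /andP[? ?] /andP[? ?] /andP[? ?] /andP[? ?].
    by apply/andP; split; lra.
  have {h h2} h : c * m `^ p <= 2 ^+ P * 8 * d * t `^ p.
    apply: (le_trans h); apply: le_trans h2; apply: (le_trans (ler_norm _)).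
    by rewrite normrM ler_piMl// normr_sg; case: (_ != _).
  have tN0 : 0 <= t / N.+1%:R by rewrite divr_ge0.
  have m0 : 0 <= m by apply: ltW; exact: le_lt_trans lt.
  have := gt0_ltr_powR p0; move=> /(_ _ _ _ _ lt); rewrite !nnegrE tN0 m0 => /(_ isT isT).
  rewrite powRM// ?invr_ge0// => lt2.
  have lt3 : t `^ p * 2 ^- (P * N.+1) < m `^ p.
    apply: le_lt_trans lt2; rewrite ler_wpM2l//.
    have iN : 0 < (N.+1%:R^-1 : R) <= 1 by rewrite invr_gt0 ltr0n invf_le1// ler1n.
    apply: le_trans (ger_powR iN pP); rewrite powR_mulrn ?invr_ge0//.
    rewrite exprVn lef_pV2 ?posrE ?exprn_gt0// mulnC exprM lerXn2r ?nnegrE ?exprn_ge0//.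
    by rewrite -natrX ler_nat ltnW// ltn_expl.
  have : c * (t `^ p * 2 ^- (P * N.+1)) < 2 ^+ P * 8 * d * t `^ p.
    by apply: lt_le_trans h; rewrite ltr_pM2l.
  apply/negP; rewrite -leNgt [leRHS]mulrCA [leRHS]mulrC ler_wpM2r//.
  have -> : 2 ^+ P * 8 = 2 ^+ (P + 3) :> R by rewrite exprD; congr (_ * _); ring.
  apply: (@le_trans _ _ (2 ^+ (P + 3) * 2 ^- ((P + 3 + C + P) * N.+1))).
    by rewrite ler_wpM2l// exprn_ge0.
  apply: (@le_trans _ _ (2 ^- C * 2 ^- (P * N.+1))); last first.
    rewrite ler_wpM2r ?invr_ge0 ?exprn_ge0// -[leRHS]invrK lef_pV2 ?posrE ?exprn_gt0//.
    by rewrite invr_gt0.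
  rewrite -invfM -exprD -ler_pdivlMl ?exprn_gt0// -invfM -exprD lef_pV2 ?posrE ?exprn_gt0//.
  rewrite ler_weXn2l ?ler1n//.
  have hE : (P + 3 + C + P * N.+1 <= (P + 3 + C + P) * N.+1)%N.
    by rewrite (mulnDl _ P) leq_add2r leq_pmulr.
  by move: hE; clear; lia.
apply: (@le_trans _ _ ((1 + d) * t + N%:R * (t / N.+1%:R))).
  apply: sum_pairwise_min => //.
  - by rewrite mulr_ge0// addr_ge0.
  - by rewrite divr_ge0.
  - move=> i; apply: (le_trans (evn _)); have := gt i (ltn_ord i).
    by rewrite ler_distlC => /andP[]; lra.
have : N%:R * (t / N.+1%:R) <= t.
  by rewrite mulrCA ler_piMr// ler_pdivrMr// mul1r ler_nat.
have : d * t <= t by rewrite ler_piMl.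
have -> : 3 * t = (t + t) + t by ring.
by rewrite mulrDl mul1r => h1 h2; apply: lerD => //; exact: lerD.
Qed.

End AlmostDisjoint.

(** * Equal splitting in [L^p[0,1]] *)

Section Restriction.
Context d (T : measurableType d) (R : realType).
Variables (mu : {measure set T -> \bar R}) (p : R) (p1 : 1 <= p).
Implicit Types (f g : Lpfun mu p1) (A : set T).

Let p0 : 0 < p. Proof. exact: lt_le_trans p1. Qed.

Definition pmass f A : \bar R := (\int[mu]_(x in A) (normc (f x) `^ p)%:E)%E.

Lemma measurable_powR_normc f : measurable_fun setT (fun x => normc (f x) `^ p).
Proof.
apply: (@measurableT_comp _ _ _ _ _ _ (@powR R ^~ p)) => //.
exact/cmeasurable_normc/Lpfun_measurable.
Qed.

Lemma pmass_fin f A : measurable A -> pmass f A \is a fin_num.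
Proof.
move=> mA; rewrite ge0_fin_numE; last first.
  by apply: integral_ge0 => x _; rewrite lee_fin powR_ge0.
have : (pmass f setT < +oo)%E.
  have := Lpfun_finite f; rewrite cLnormE; apply: lty_poweRy.
  by rewrite invr_eq0 gt_eqF.
apply: le_lt_trans; apply: ge0_subset_integral => //.
  exact/measurable_EFinP/measurable_powR_normc.
by move=> x _; rewrite lee_fin powR_ge0.
Qed.

Lemma pmassU f A B : measurable A -> measurable B -> [disjoint A & B] ->
  fine (pmass f (A `|` B)) = fine (pmass f A) + fine (pmass f B).
Proof.
move=> mA mB AB; rewrite /pmass ge0_integral_setU//.
- by rewrite fineD//; exact: pmass_fin.
- exact/measurable_EFinP/measurable_funTS/measurable_powR_normc.
- by move=> x _; rewrite lee_fin powR_ge0.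
Qed.

Lemma Lpfun_norm_pmass f g A : measurable A ->
  (forall x, normc (g x) `^ p = \1_A x * normc (f x) `^ p) ->
  Lpfun_norm g = fine (pmass f A) `^ p^-1.
Proof.
move=> mA gf; rewrite /Lpfun_norm cLnormE fine_poweR; congr (fine _ `^ _).
rewrite /pmass [RHS]integral_mkcond; apply: eq_integral => x _.
rewrite gf patchE indicE; case: (x \in A); by rewrite ?mul1r ?mul0r.
Qed.

Lemma restr_Lpfun_pred f A : measurable A ->
  (fun x => (\1_A x)%:C * f x) \in Lpfun_pred mu p1.
Proof.
move=> mA; have [fr fi] := Lpfun_measurable f.
have m1 : measurable_fun setT (\1_A : T -> R) by exact: measurable_indic.
rewrite inE; split.
  split.
    rewrite (_ : (fun _ => _) = (fun x => \1_A x * complex.Re (f x))).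
      exact: measurable_funM.
    by apply/funext => x; case: (f x) => a b /=; rewrite mul0r subr0.
  rewrite (_ : (fun _ => _) = (fun x => \1_A x * complex.Im (f x))).
    exact: measurable_funM.
  by apply/funext => x; case: (f x) => a b /=; rewrite mul0r addr0.
rewrite cLnormE; apply: poweR_lty.
have : pmass f A \is a fin_num by exact: pmass_fin.
rewrite ge0_fin_numE; last first.
  by apply: integral_ge0 => x _; rewrite lee_fin powR_ge0.
apply: le_lt_trans; rewrite /pmass [leRHS]integral_mkcond.
rewrite le_eqVlt; apply/orP; left; apply/eqP; apply: eq_integral => x _.
have nC (b : bool) : normc ((b%:R : R)%:C) = b%:R.
  by rewrite /= expr0n addr0 sqrtr_sqr ger0_norm.
rewrite patchE indicE normcM nC; case: (x \in A); first by rewrite mul1r.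
by rewrite mul0r powR0 ?gt_eqF.
Qed.

Definition restr_Lpfun f A (mA : measurable A) : Lpfun mu p1 :=
  LpFun (restr_Lpfun_pred f mA).

End Restriction.

Section EqualSplitting.
Variables (R : realType) (p : R) (p1 : 1 <= p).

Let p0 : 0 < p. Proof. exact: lt_le_trans p1. Qed.

Let mu := mrestr (@lebesgue_measure R) (measurable_itv `[(0 : R), (1 : R)]).

Variable f : Lpfun mu p1.

Let ray (x : R) : set R := [set` `]-oo, x]].
Let mray x : measurable (ray x). Proof. exact: measurable_itv. Qed.
Let cut x : Lpfun mu p1 := restr_Lpfun f (mray x).
Let G x := fine (pmass f (ray x)).

Let oc (x y : R) : set R := [set` `]x, y]].
Let moc x y : measurable (oc x y). Proof. exact: measurable_itv. Qed.

Let G_add x y : x <= y -> G y = G x + fine (pmass f (oc x y)).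
Proof.
move=> xy; rewrite /G -pmassU//.
  congr (fine (pmass _ _)); rewrite /ray /oc -itv_bndbnd_setU//; by rewrite ?bnd_simp.
- exact: mray.
- exact: moc.
apply/disj_setPS => z []; rewrite /ray /oc /= !in_itv /= => zx.
by rewrite ltNge zx.
Qed.

Let oc_ge0 x y : 0 <= fine (pmass f (oc x y)).
Proof. by apply/fine_ge0/integral_ge0 => z _; rewrite lee_fin powR_ge0. Qed.

Let G_mono x y : x <= y -> G x <= G y.
Proof. by move=> xy; rewrite (G_add xy) lerDl. Qed.

(** Absolute continuity of the integral: the mass on [oc a b] is small when its Lebesgue measure
    [b - a] is. This is where the absence of atoms in [L^p[0,1]] enters. *)
Let G_continuous : continuous G.
Proof.
move=> x; apply/cvgrPdist_lt => e e0.
have intf : mu.-integrable setT (EFin \o (fun x => normc (f x) `^ p)).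
  apply/integrableP; split; first exact/measurable_EFinP/measurable_powR_normc.
  have := pmass_fin f (@measurableT _ _); rewrite ge0_fin_numE; last first.
    by apply: integral_ge0 => z _; rewrite lee_fin powR_ge0.
  apply: le_lt_trans; rewrite le_eqVlt; apply/orP; left; apply/eqP.
  by apply: eq_integral => z _ /=; rewrite ger0_norm ?powR_ge0.
have [d [d0 hd]] := integral_normr_continuous intf e0.
have key a b : a <= b -> b - a < d -> `|G b - G a| < e.
  move=> ab bad; rewrite (G_add ab) addrC addKr ger0_norm//.
  have := hd (oc a b) (measurable_itv _).
  rewrite /Rintegral; have -> : (\int[mu]_(x0 in oc a b) `|normc (f x0) `^ p|%:E)%E =
      pmass f (oc a b).
    by apply: eq_integral => z _ /=; rewrite ger0_norm ?powR_ge0.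
  apply; rewrite /mu /mrestr; apply: (@le_lt_trans _ _ (lebesgue_measure (oc a b))).
    apply: le_measure; rewrite ?inE; last exact: subIsetl.
      by apply: measurableI; [exact: moc|exact: measurable_itv].
    exact: moc.
  rewrite lebesgue_measure_itv /= lte_fin; case: ifP => _; rewrite ?lte_fin//.
near=> y; have yd : `|x - y| < d by near: y; apply/nbhs_ballP; exists d.
move: yd; have [xy|/ltW yx] := leP x y => yd.
  rewrite distrC; apply: key => //.
  by move: yd; rewrite distrC ger0_norm// subr_ge0.
apply: key => //.
by move: yd; rewrite ger0_norm// subr_ge0.
Unshelve. all: by end_near. Qed.

Let mu_null A : measurable A -> A `&` [set` `[(0 : R), (1 : R)]] = set0 ->
  fine (pmass f A) = 0.
Proof.
move=> mA A0; rewrite /pmass null_set_integral//.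
- exact/measurable_EFinP/measurable_funTS/measurable_powR_normc.
- by rewrite -[LHS]/(lebesgue_measure (A `&` [set` `[(0 : R), (1 : R)]])) A0 measure0.
Qed.

Let G_lo : G (-1) = 0.
Proof.
apply: mu_null => //; apply/seteqP; split => // z [].
by rewrite /ray /= !in_itv /=; lra.
Qed.

Let cut_norm (g : Lpfun mu p1) A : measurable A ->
  (forall x, normc (g x) `^ p = \1_A x * normc (f x) `^ p) ->
  Lpfun_norm g = fine (pmass f A) `^ p^-1.
Proof. exact: Lpfun_norm_pmass. Qed.

Let normc_cases (b : bool) (z : R[i]) : normc ((b%:R : R)%:C * z) `^ p =
  b%:R * normc z `^ p.
Proof.
by case: b; rewrite ?mul1r// mul0r mul0r normc0 powR0// gt_eqF.
Qed.

Let normcN_ (z : R[i]) : normc (- z) = normc z.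
Proof. by case: z => a b /=; rewrite !sqrrN. Qed.

Let cutE x z : (cut x : R -> R[i]) z = ((z <= x)%R%:R : R)%:C * f z.
Proof.
congr (_%:C * _); rewrite indicE; congr (nat_of_bool _)%:R.
by rewrite /ray mem_setE in_itv.
Qed.

Let f_cut : Lpfun_norm (f - cut 1) = 0.
Proof.
have mA : measurable (~` ray 1) by exact: measurableC.
rewrite (Lpfun_norm_pmass mA (f := f)); last first.
  move=> z; rewrite -[_ z]/(f z - (cut 1 : R -> R[i]) z) cutE.
  rewrite indicE in_setC /ray mem_setE in_itv /=; case: (z <= 1).
    by rewrite mul1r subrr normc0 powR0 ?gt_eqF//= mul0r.
  by rewrite mul0r subr0 mul1r.
rewrite (mu_null mA) ?powR0 ?invr_eq0 ?gt_eqF//.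
apply/seteqP; split => // z []; rewrite /ray /= !in_itv /=.
by move=> z1 /andP[_ z1']; apply: z1.
Qed.

Let norm_piece a b : a <= b ->
  Lpfun_norm (cut b - cut a) = (G b - G a) `^ p^-1.
Proof.
move=> ab; rewrite (G_add ab) [G a + _]addrC addrK; apply: cut_norm; first exact: moc.
move=> z.
rewrite -[_ z]/(cut b z - cut a z) !cutE -mulrBl indicE /oc mem_setE in_itv /=.
have [za|za] := leP z a.
  by rewrite (le_trans za ab) subrr mul0r normc0 powR0 ?gt_eqF//= mul0r.
by rewrite subr0 normc_cases.
Qed.

(** The sign [(-1) ^+ e] treats sum and difference of two disjoint pieces at once: their moduli
    agree pointwise. *)
Let norm_pieces (e : bool) a b c d : a <= b -> b <= c -> c <= d ->
  Lpfun_norm ((cut d - cut c) + (-1) ^+ e *: (cut b - cut a)) =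
  ((G b - G a) + (G d - G c)) `^ p^-1.
Proof.
move=> ab bc cd.
have -> : (G b - G a) + (G d - G c) = fine (pmass f (oc a b `|` oc c d)).
  rewrite pmassU//; first by rewrite (G_add ab) (G_add cd); ring.
  - exact: moc.
  - exact: moc.
  apply/disj_setPS => z []; rewrite /oc /= !in_itv /=.
  by move=> /andP[_ zb] /andP[cz _]; lra.
apply: cut_norm; first by apply: measurableU; exact: moc.
move=> z; rewrite -[_ z]/((cut d z - cut c z) + (-1) ^+ e * (cut b z - cut a z)).
rewrite !cutE -!mulrBl indicE in_setU /oc !mem_setE !in_itv /=.
have [zb|bz] := leP z b.
  have zc := le_trans zb bc; have zd := le_trans zc cd.
  rewrite zc zd subrr mul0r add0r; have [za|za] := leP z a.
    by rewrite subrr mul0r mulr0 normc0 powR0 ?gt_eqF//= [c < z]ltNge zc /= mul0r.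
  by rewrite subr0 /=; case: e; rewrite ?expr1 ?expr0 ?mulN1r ?mul1r ?normcN_.
have az := le_lt_trans ab bz.
rewrite [z <= a]leNgt az subrr mul0r mulr0 addr0 andbF /=.
have [zc|cz] := leP z c.
  by rewrite (le_trans zc cd) subrr mul0r normc0 powR0 ?gt_eqF//= mul0r.
by rewrite subr0 normc_cases.
Qed.

Local Notation pi g := (\pi_(Lp mu p1)%qT g : Lp01 p1).

Let rnorm_pi (g : Lpfun mu p1) : rnorm (pi g) = Lpfun_norm g.
Proof. by rewrite -Lp_norm_pi. Qed.

Let piB (g h : Lpfun mu p1) : pi (g - h) = pi g - pi h.
Proof. by rewrite !piE. Qed.

Let pi_eq (g h : Lpfun mu p1) : Lpfun_norm (g - h) = 0 -> pi g = pi h.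
Proof. by move=> gh; apply/Lp_eqP/ae_nullP. Qed.

Let pi_eq0 (g : Lpfun mu p1) : Lpfun_norm g = 0 -> pi g = 0.
Proof.
by move=> g0; rewrite (pi_eq (h := 0)) ?subr0// !piE.
Qed.

(** The cumulative mass [G] is cut by the intermediate value theorem at the levels [i * (T / N)];
    the pieces of [f] between consecutive cut points are disjoint and have equal mass. *)
Lemma pi_equal_split (e : R) : 0 < e ->
  exists (N : nat) (t : R) (g : nat -> Lp01 p1),
    [/\ 0 < t < e, pi f = \sum_(i < N) g i,
        forall i, (i < N)%N -> rnorm (g i) = t &
        forall i k, (i < N)%N -> (k < i)%N ->
          rnorm (g i + g k) = kappa p * t /\ rnorm (g i - g k) = kappa p * t].
Proof.
move=> e0; pose T := G 1.
have hlo : pi (cut (-1)) = 0.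
  apply: pi_eq0; rewrite (cut_norm (mray (-1))).
    by rewrite -/(G (-1)) G_lo powR0// invr_eq0 gt_eqF.
  by move=> z; rewrite cutE normc_cases indicE /ray mem_setE in_itv.
have T0 : 0 <= T by apply/fine_ge0/integral_ge0 => z _; rewrite lee_fin powR_ge0.
have hf : pi f = pi (cut 1) - pi (cut (-1)).
  by rewrite hlo subr0; apply: pi_eq.
(* If [f] vanishes almost everywhere, the empty family serves, with an arbitrary positive [t] below
   [e]. *)
have [TE|Tn0] := eqVneq T 0.
  exists 0%N, (e / 2), (fun=> 0); rewrite big_ord0 hf -piB; split => //.
    by rewrite divr_gt0//= ltr_pdivrMr// ltr_pMr// ltr1n.
  by apply: pi_eq0; rewrite norm_piece ?G_lo ?subr0 -/T ?TE ?powR0 ?invr_eq0 ?gt_eqF//; lra.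
have {Tn0}T0 : 0 < T by rewrite lt0r Tn0.
pose N := (Num.truncn (T / e `^ p)).+1.
have N0 : 0 < N%:R :> R by rewrite ltr0n.
have TN0 : 0 < T / N%:R by rewrite divr_gt0.
pose t := (T / N%:R) `^ p^-1.
have t0 : 0 < t by rewrite powR_gt0.
have te : t < e.
  have ep0 : 0 < e `^ p by rewrite powR_gt0.
  have -> : e = (e `^ p) `^ p^-1 by rewrite -powRrM divff ?gt_eqF// powRr1// ltW.
  apply: gt0_ltr_powR; rewrite ?invr_gt0 ?nnegrE ?ltW//.
  have /andP[_] := truncn_itv (ltW (divr_gt0 T0 ep0)); rewrite -/N => h.
  by rewrite ltr_pdivrMr// mulrC -ltr_pdivrMr.
(* The end points are prescribed so that the telescoping sum starts at [-1], where [cut] is null,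
   and ends at [1], where it is [f] almost everywhere. *)
have exx i : exists x, (i <= N)%N ->
    [/\ G x = i%:R * (T / N%:R), i = 0%N -> x = -1 & i = N -> x = 1].
  have [->|i0] := eqVneq i 0%N; first by exists (-1); rewrite G_lo mul0r.
  have [->|iN] := eqVneq i N.
    by exists 1 => _; split => //; rewrite mulrCA divff ?gt_eqF// mulr1.
  have [iN'|iN'] := leqP i N; last by exists 0.
  have l1 : (-1 : R) <= 1 by lra.
  have [|x _ Gx] := @IVT R G (-1) 1 (i%:R * (T / N%:R)) l1 (continuous_subspaceT G_continuous).
    rewrite G_lo -/T min_l ?(ltW T0)// max_r ?(ltW T0)//.
    rewrite mulr_ge0 ?(ltW TN0)//= mulrCA ler_piMr ?(ltW T0)//.
    by rewrite ler_pdivrMr// mul1r ler_nat.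
  by exists x => _; split => // /eqP; rewrite ?(negPf i0) ?(negPf iN).
have {exx}[x hx] := choice exx.
have x_le i k : (i <= k)%N -> (k <= N)%N -> x i <= x k.
  move=> ik kN; rewrite leNgt; apply/negP => lt.
  have [Gi _ _] := hx i (leq_trans ik kN); have [Gk _ _] := hx k kN.
  have := G_mono (ltW lt); rewrite Gi Gk ler_pM2r// ler_nat => ki.
  have e1 : i = k by apply/eqP; rewrite eqn_leq ik.
  by rewrite e1 ltxx in lt.
have dG i : (i < N)%N -> G (x i.+1) - G (x i) = T / N%:R.
  move=> iN; have [-> _ _] := hx i (ltnW iN); have [-> _ _] := hx i.+1 iN.
  by rewrite -mulrBl -natrB// subSnn mul1r.
exists N, t, (fun i => pi (cut (x i.+1)) - pi (cut (x i))); split.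
- by rewrite t0.
- rewrite -(big_mkord xpredT (fun i => pi (cut (x i.+1)) - pi (cut (x i)))).
  rewrite telescope_sumr// hf; have [_ _ ->//] := hx N (leqnn N).
  by have [_ -> //] := hx 0%N (leq0n N).
- by move=> i iN; rewrite -piB rnorm_pi norm_piece ?x_le// dG.
move=> i k iN ki.
have kN := ltn_trans ki iN.
have kap : kappa p * t = (T / N%:R + T / N%:R) `^ p^-1.
  rewrite /kappa /t -powRM ?(ltW TN0)//; congr (_ `^ _); ring.
have Hn (b : bool) : Lpfun_norm ((cut (x i.+1) - cut (x i)) +
    (-1) ^+ b *: (cut (x k.+1) - cut (x k))) = kappa p * t.
  by rewrite norm_pieces ?x_le ?(ltnW iN)// !dG.
split.
  rewrite -(Hn false) expr0 scale1r -rnorm_pi.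
  by congr (rnorm _); rewrite -!piB [RHS]Lp_piD.
rewrite -(Hn true) expr1 scaleN1r -rnorm_pi.
by congr (rnorm _); rewrite -!piB.
Qed.

End EqualSplitting.

Lemma Lp01_equal_split (R : realType) (p : R) (p1 : 1 <= p) (u : Lp01 p1) (e : R) :
  0 < e ->
  exists (N : nat) (t : R) (g : nat -> Lp01 p1),
    [/\ 0 < t < e, u = \sum_(i < N) g i,
        forall i, (i < N)%N -> rnorm (g i) = t &
        forall i k, (i < N)%N -> (k < i)%N ->
          rnorm (g i + g k) = kappa p * t /\ rnorm (g i - g k) = kappa p * t].
Proof.
move=> e0; have [N [t [g h]]] := pi_equal_split (repr u) e0.
by exists N, t, g; move: h; rewrite reprK.
Qed.

(** * Density and norms of sums *)

Section Density.
Variable R : realType.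

Lemma rat_of_code_surj (x : rat) : exists q, rat_of_code q = x.
Proof.
have [m Em] : exists m, denq x = m.+1%:Z.
  by have := denq_gt0 x; case: (denq x) => // -[|m] // _; exists m.
have dq0 : m.+1%:R != 0 :> rat by rewrite pnatr_eq0.
have xE : x = (numq x)%:~R / m.+1%:R by rewrite -[LHS]divq_num_den Em.
case E : (numq x) xE => [k|k] ->.
  by exists (npair (npair k 0) m); rewrite /rat_of_code !(nfstE, nsndE) subr0.
exists (npair (npair 0 k.+1) m); rewrite /rat_of_code !(nfstE, nsndE) sub0r.
by rewrite NegzE mulrNz.
Qed.

Lemma gauss_of_code_dense (z : R[i]) (e : R) : 0 < e ->
  exists q, normc (z - gauss_of_code R q) < e.
Proof.
move=> e0; case: z => x y; have e2 : 0 < e / 2 by rewrite divr_gt0.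
have near_rat (s : R) : exists q, `|s - ratr (rat_of_code q)| < e / 2.
  have lt : s < s + e / 2 by rewrite ltrDl.
  have [r] := rat_in_itvoo lt; rewrite in_itv /= => /andP[r1 r2].
  have [q Eq] := rat_of_code_surj r; exists q.
  by rewrite Eq distrC ger0_norm ?subr_ge0 ?(ltW r1)// ltrBlDl.
have [qx hx] := near_rat x; have [qy hy] := near_rat y.
exists (npair qx qy); rewrite /gauss_of_code nfstE nsndE.
set u := x - _ in hx; set v := y - _ in hy.
have -> : (x +i* y) - (ratr (rat_of_code qx) +i* ratr (rat_of_code qy)) =
  u%:C + (0 +i* v) by rewrite /u /v; simpc.
apply: (le_lt_trans (le_normcD _ _)); rewrite [ltRHS]splitr.
by rewrite /= !expr0n /= addr0 add0r !sqrtr_sqr ltrD.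
Qed.

Lemma rational_vector_code (V : normedModType R[i]) (r : nat -> V) n (q : nat -> nat) :
  rational_vector r (CodeSeq.code (mkseq q n)) =
  \sum_(j < n) gauss_of_code R (q j) *: r j.
Proof.
rewrite /rational_vector CodeSeq.codeK size_mkseq.
by apply: eq_bigr => j _; rewrite nth_mkseq.
Qed.

Lemma rnormZ (V : normedModType R[i]) a (v : V) : rnorm (a *: v) = normc a * rnorm v.
Proof. by rewrite /rnorm normrZ norm_normc rnormE -rmorphM. Qed.

Lemma rational_vector_dense (V : normedModType R[i]) (P : presentation V) v (e : R) :
  0 < e -> exists n, rnorm (rational_vector P n - v) < e.
Proof.
move=> e0; have e2 : 0 < e / 2 by rewrite divr_gt0.
have [w [wv [n [a wE]]]] : (ball v (e / 2)%:C) `&` linear_span P !=set0.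
  apply: (pres_dense P).
    by exists v; apply: ballxx; rewrite ltcR.
  by apply: ball_open; rewrite ltcR.
have {}wv : rnorm (w - v) < e / 2.
  move: wv; rewrite -ball_normE /= rnormE ltcR; by rewrite rnormB.
pose S := \sum_(j < n) rnorm (P j).
have S0 : 0 <= S by apply: sumr_ge0 => j _; exact: rnorm_ge0.
have eS : 0 < e / 2 / (S + 1) by rewrite divr_gt0// ltr_wpDl.
have [q hq] := choice (fun j => gauss_of_code_dense (a j) eS).
exists (CodeSeq.code (mkseq q n)); rewrite rational_vector_code.
rewrite -(subrK w (\sum_(j < n) _)) -addrA.
apply: (le_lt_trans (rnormD _ _)); rewrite [ltRHS]splitr; apply: ler_ltD => //.
rewrite wE -sumrB; apply: (le_trans (rnorm_sum _ _ _)).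
apply: (@le_trans _ _ (\sum_(j < n) e / 2 / (S + 1) * rnorm (P j))).
  apply: ler_sum => j _; rewrite -scalerBl rnormZ ler_wpM2r ?rnorm_ge0//.
  have := hq j; have -> : normc (gauss_of_code R (q j) - a j) = normc (a j - gauss_of_code R (q j)).
    by rewrite -[a j - _]opprB; case: (_ - _) => x y /=; rewrite !sqrrN.
  exact: ltW.
rewrite -mulr_sumr -/S mulrAC ler_pdivrMr ?ltr_wpDl// ler_wpM2l ?ltW//.
by rewrite ltrDl.
Qed.

End Density.

Section LpSumNorm.
Variables (R : realType) (p : R) (p1 : 1 <= p) (U V : normedModType R[i]).
Local Notation W := (lpsum p1 U V).
Implicit Types w : W.

Let p0 : 0 < p. Proof. exact: lt_le_trans p1. Qed.

Lemma lpsum_rnormE w : rnorm w = (rnorm w.1 `^ p + rnorm w.2 `^ p) `^ p^-1.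
Proof. by []. Qed.

Lemma lpsum_rnorm_powR w : rnorm w `^ p = rnorm w.1 `^ p + rnorm w.2 `^ p.
Proof.
by rewrite lpsum_rnormE -powRrM mulVf ?gt_eqF// powRr1// addr_ge0 ?powR_ge0.
Qed.

Lemma lpsum_rnorm1 w : rnorm w.1 <= rnorm w.
Proof.
have -> : rnorm w.1 = (rnorm w.1 `^ p) `^ p^-1.
  by rewrite -powRrM divff ?gt_eqF// powRr1// rnorm_ge0.
rewrite lpsum_rnormE; apply: ge0_ler_powR; rewrite ?invr_ge0 ?(ltW p0)//.
- by rewrite nnegrE powR_ge0.
- by rewrite nnegrE addr_ge0 ?powR_ge0.
- by rewrite lerDl powR_ge0.
Qed.

Lemma lpsum_rnorm2 w : rnorm w.2 <= rnorm w.
Proof.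
have -> : rnorm w.2 = (rnorm w.2 `^ p) `^ p^-1.
  by rewrite -powRrM divff ?gt_eqF// powRr1// rnorm_ge0.
rewrite lpsum_rnormE; apply: ge0_ler_powR; rewrite ?invr_ge0 ?(ltW p0)//.
- by rewrite nnegrE powR_ge0.
- by rewrite nnegrE addr_ge0 ?powR_ge0.
- by rewrite lerDr powR_ge0.
Qed.

Lemma rnorm_inr (v : V) : rnorm ((0, v) : W) = rnorm v.
Proof.
rewrite lpsum_rnormE /= rnorm0 powR0 ?gt_eqF// add0r -powRrM divff ?gt_eqF//.
by rewrite powRr1// rnorm_ge0.
Qed.

Lemma rnorm_inl (u : U) : rnorm ((u, 0) : W) = rnorm u.
Proof.
rewrite lpsum_rnormE /= rnorm0 powR0 ?gt_eqF// addr0 -powRrM divff ?gt_eqF//.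
by rewrite powRr1// rnorm_ge0.
Qed.

End LpSumNorm.

(** * Coordinates of the atomic part *)

Section LebesgueClarkson.
Context d (T : measurableType d) (R : realType).
Variables (mu : {measure set T -> \bar R}) (p : R) (p1 : 1 <= p).

Let p0 : 0 < p. Proof. exact: lt_le_trans p1. Qed.

(** The defect of the norms is the integral of the pointwise defects, which all have the sign of
    [2 - p]. *)
Lemma Lp_clarkson_ge0 (u v : Lp mu p1) : 0 <= Num.sg (2 - p) * clarksonN p u v.
Proof.
pose F (f : Lpfun mu p1) x := normc (f x) `^ p.
have intF f : mu.-integrable setT (EFin \o F f).
  apply/integrableP; split; first exact/measurable_EFinP/measurable_powR_normc.
  have := pmass_fin f (@measurableT _ _); rewrite ge0_fin_numE; last first.
    by apply: integral_ge0 => z _; rewrite lee_fin powR_ge0.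
  apply: le_lt_trans; rewrite le_eqVlt; apply/orP; left; apply/eqP.
  by apply: eq_integral => z _ /=; rewrite ger0_norm ?powR_ge0.
have intD (h k : T -> R) : mu.-integrable setT (EFin \o h) ->
    mu.-integrable setT (EFin \o k) -> mu.-integrable setT (EFin \o (fun x => h x + k x)).
  by move=> hh hk; exact: (integrableD measurableT hh hk).
have intB (h k : T -> R) : mu.-integrable setT (EFin \o h) ->
    mu.-integrable setT (EFin \o k) -> mu.-integrable setT (EFin \o (fun x => h x - k x)).
  by move=> hh hk; exact: (integrableB measurableT hh hk).
have intZ (c : R) (h : T -> R) : mu.-integrable setT (EFin \o h) ->
    mu.-integrable setT (EFin \o (fun x => c * h x)).
  by move=> hh; exact: (integrableZl measurableT c hh).
have normF f : rnorm (\pi_(Lp mu p1)%qT f : Lp mu p1) `^ p = \int[mu]_x F f x.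
  rewrite -[rnorm _]/(Lp_norm (\pi_(Lp mu p1)%qT f)) Lp_norm_pi.
  rewrite (@Lpfun_norm_pmass _ _ _ _ _ p1 f f setT)//; last first.
    by move=> x; rewrite indicT mul1r.
  by rewrite -powRrM mulVf ?gt_eqF// powRr1// fine_ge0// integral_ge0// => x _; rewrite lee_fin powR_ge0.
rewrite -[u]reprK -[v]reprK; set f := repr u; set g := repr v.
have -> : clarksonN p (\pi_(Lp mu p1)%qT f : Lp mu p1) (\pi_(Lp mu p1)%qT g) =
    \int[mu]_x clarkson p (f x) (g x).
  rewrite /clarksonN -!Lp_piD.
  have -> : \pi_(Lp mu p1)%qT f - \pi_(Lp mu p1)%qT g = \pi_(Lp mu p1)%qT (f - g) :> Lp mu p1.
    by rewrite !piE.
  rewrite (normF f) (normF g) (normF (f + g)) (normF (f - g)) -!RintegralZl// -RintegralD ?intZ//.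
  by rewrite -!RintegralB ?intB ?intD ?intZ.
rewrite -RintegralZl//; last first.
  exact: (intB _ _ (intB _ _ (intD _ _ (intZ 2 _ (intF f)) (intZ 2 _ (intF g)))
    (intF (f + g))) (intF (f - g))).
by apply: Rintegral_ge0 => x _; exact: clarkson_ge0.
Qed.

End LebesgueClarkson.

Section SequenceCoordinates.
Variables (R : realType) (p : R) (p1 : 1 <= p).

Let p0 : 0 < p. Proof. exact: lt_le_trans p1. Qed.

Let root_le (a b : R) : 0 <= a -> 0 <= b -> a <= b `^ p -> a `^ p^-1 <= b.
Proof.
move=> a0 b0 ab; have -> : b = (b `^ p) `^ p^-1.
  by rewrite -powRrM divff ?gt_eqF// powRr1.
by apply: ge0_ler_powR; rewrite ?invr_ge0 ?(ltW p0) ?nnegrE ?powR_ge0.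
Qed.

Let psum_le (K : nat) (x : nat -> R[i]) (e : R) : 0 <= e ->
  (forall i, normc (x i) <= e) ->
  (\sum_(i < K) normc (x i) `^ p) `^ p^-1 <= K%:R * e.
Proof.
move=> e0 xe.
have -> : K%:R * e = ((K%:R * e) `^ p) `^ p^-1.
  by rewrite -powRrM divff ?gt_eqF// powRr1// mulr_ge0.
apply: ge0_ler_powR; rewrite ?invr_ge0 ?(ltW p0)// ?nnegrE ?powR_ge0//.
  by apply: sumr_ge0 => i _; exact: powR_ge0.
apply: (@le_trans _ _ (\sum_(i < K) e `^ p)).
  apply: ler_sum => i _; apply: ge0_ler_powR; rewrite ?(ltW p0) ?nnegrE ?normc_ge0//.
rewrite sumr_const card_ord -[_ *+ _]mulr_natl powRM// ler_wpM2r ?powR_ge0//.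
case: K => [|K]; first exact: powR_ge0.
by rewrite le1r_powR// ler1n.
Qed.

Let clarksonN_sum (V : normedModType R[i]) n (c : nat -> V -> R[i]) :
  (forall i x y, c i (x + y) = c i x + c i y) -> (forall i x, c i (- x) = - c i x) ->
  (forall x, rnorm x `^ p = \sum_(i < n) normc (c i x) `^ p) ->
  forall x y, clarksonN p x y = \sum_(k < n) clarkson p (c k x) (c k y).
Proof.
move=> cD cN rE x y; rewrite /clarksonN !rE 2!mulr_sumr -big_split -!sumrB.
by apply: eq_bigr => k _; rewrite !cD cN.
Qed.

Section FiniteCoordinates.
Variable n : nat.

(** Indices beyond the dimension give 0, so that atoms are numbered by [nat] in both sequence
    spaces. *)
Definition lpn_coord (i : nat) (x : lpn p1 n) : R[i] := oapp x 0 (insub i).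

Lemma lpn_coordE (i : 'I_n) x : lpn_coord i x = x i.
Proof. by rewrite /lpn_coord valK. Qed.

Lemma lpn_coordD i x y : lpn_coord i (x + y) = lpn_coord i x + lpn_coord i y.
Proof.
rewrite /lpn_coord; case: insub => [j|] /=; last by rewrite addr0.
by rewrite ffunE.
Qed.

Lemma lpn_coordN i x : lpn_coord i (- x) = - lpn_coord i x.
Proof.
rewrite /lpn_coord; case: insub => [j|] /=; last by rewrite oppr0.
by rewrite ffunE.
Qed.

Lemma lpn_rnormE (x : lpn p1 n) :
  rnorm x = (\sum_(i < n) normc (lpn_coord i x) `^ p) `^ p^-1.
Proof.
rewrite -[LHS]/(lpn_norm x); congr (_ `^ _).
by apply: eq_bigr => i _; rewrite lpn_coordE.
Qed.

Lemma lpn_rnorm_powR (x : lpn p1 n) :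
  rnorm x `^ p = \sum_(i < n) normc (lpn_coord i x) `^ p.
Proof.
rewrite lpn_rnormE -powRrM mulVf ?gt_eqF// powRr1//.
by apply: sumr_ge0 => i _; exact: powR_ge0.
Qed.

Lemma lpn_clarkson_coordinate i : clarkson_coordinate p (lpn_coord i).
Proof.
have NE x y : Num.sg (2 - p) * clarksonN p x y =
    \sum_(k < n) Num.sg (2 - p) * clarkson p (lpn_coord k x) (lpn_coord k y).
  rewrite -mulr_sumr; congr (_ * _).
  by apply: clarksonN_sum => *; [exact: lpn_coordD|exact: lpn_coordN|exact: lpn_rnorm_powR].
case: (ltnP i n) => [lt|ge]; last first.
  have z x : lpn_coord i x = 0 by rewrite /lpn_coord insubN// -leqNgt.
  split => [x|x y]; first by rewrite z normc0 rnorm_ge0.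
  rewrite NE !z /clarkson addr0 subr0 normc0 powR0 ?gt_eqF// mulr0 addr0 !subr0 mulr0.
  by apply: sumr_ge0 => k _; exact: clarkson_ge0.
have [j ->] : exists j : 'I_n, i = j by exists (Ordinal lt).
split => [x|x y].
  have -> : normc (lpn_coord j x) = (normc (lpn_coord j x) `^ p) `^ p^-1.
    by rewrite -powRrM divff ?gt_eqF// powRr1// normc_ge0.
  rewrite lpn_rnormE; apply: ge0_ler_powR; rewrite ?invr_ge0 ?(ltW p0)//.
  - by rewrite nnegrE powR_ge0.
  - by rewrite nnegrE sumr_ge0// => k _; exact: powR_ge0.
  by rewrite (bigD1 j)//= lerDl sumr_ge0// => k _; exact: powR_ge0.
rewrite NE (bigD1 j)//= lerDl.
by apply: sumr_ge0 => k _; exact: clarkson_ge0.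
Qed.

Lemma lpn_coord_bound (x : lpn p1 n) (e : R) : 0 <= e ->
  (forall i, normc (lpn_coord i x) <= e) -> rnorm x <= n%:R * e.
Proof. by move=> e0 xe; rewrite lpn_rnormE; exact: (psum_le n (x := lpn_coord^~ x) e0 xe). Qed.

Lemma lpn_coord_approx (x : lpn p1 n) q : q < rnorm x -> exists2 e : R, 0 < e &
  forall y, (forall i, normc (lpn_coord i y) <= e) -> q < rnorm (x - y).
Proof.
move=> qx; have e0 : 0 < (rnorm x - q) / n.+1%:R by rewrite divr_gt0// subr_gt0.
exists ((rnorm x - q) / n.+1%:R); first exact: e0.
move=> y /(lpn_coord_bound (ltW e0)) hy.
have h3 : n%:R * ((rnorm x - q) / n.+1%:R) < rnorm x - q.
  by rewrite mulrCA gtr_pMr ?subr_gt0// ltr_pdivrMr// mul1r ltr_nat.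
have aux (a b c d s : R) : a - b <= c -> b <= d -> d < a - s -> s < c by lra.
have h1 := le_trans (ler_norm _) (ler_dist_rnorm x y).
exact: (aux _ _ _ _ _ h1 hy h3).
Qed.

End FiniteCoordinates.

Section InfiniteCoordinates.
Implicit Types x y : lp p1.

Definition lp_coord (i : nat) (x : lp p1) : R[i] := lp_val x i.

Let S x n : R := \sum_(k < n) normc (lp_coord k x) `^ p.

Lemma lp_rnorm_powR_cvg x : S x @ \oo --> rnorm x `^ p.
Proof.
have fx : lp_sum p x \is a fin_num.
  by rewrite ge0_fin_numE ?lp_sum_ge0//; have := valP x; rewrite inE.
have -> : rnorm x `^ p = fine (lp_sum p x).
  rewrite -[rnorm x]/(lp_norm p x) /lp_norm -powRrM mulVf ?gt_eqF// powRr1//.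
  by rewrite fine_ge0// lp_sum_ge0.
pose u (i : nat) := (normc (lp_coord i x) `^ p)%:E.
have : cvgn (fun n => \sum_(0 <= i < n) u i)%E.
  by apply: is_cvg_nneseries => i _ _; rewrite lee_fin powR_ge0.
rewrite -[X in _ --> X]/(lp_sum p x) -[lp_sum p x]fineK// => /fine_cvg.
by under eq_fun do rewrite /= sumEFin big_mkord /=.
Qed.

Lemma lp_partial_sum_le x n : S x n <= rnorm x `^ p.
Proof.
have /cvgr_to_ge := @lp_rnorm_powR_cvg x; apply.
near=> m; have nm : (n <= m)%N by near: m; exact: nbhs_infty_ge.
rewrite /S -(subnKC nm) big_split_ord /= lerDl sumr_ge0// => k _.
exact: powR_ge0.
Unshelve. all: by end_near. Qed.

(** Partial sums of the coordinate defects converge to the defect of the norms; once they include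
    index [i] they dominate the term at [i], all terms having one sign. *)
Lemma lp_clarkson_coordinate i : clarkson_coordinate p (lp_coord i).
Proof.
split => [x|x y].
  have -> : normc (lp_coord i x) = (normc (lp_coord i x) `^ p) `^ p^-1.
    by rewrite -powRrM divff ?gt_eqF// powRr1// normc_ge0.
  have -> : rnorm x = (rnorm x `^ p) `^ p^-1.
    by rewrite -powRrM divff ?gt_eqF// powRr1// rnorm_ge0.
  apply: ge0_ler_powR; rewrite ?invr_ge0 ?(ltW p0) ?nnegrE ?powR_ge0//.
  apply: le_trans (lp_partial_sum_le x i.+1).
  by rewrite /S big_ord_recr /= lerDr sumr_ge0// => k _; exact: powR_ge0.
pose C n : R := \sum_(k < n) Num.sg (2 - p) * clarkson p (lp_coord k x) (lp_coord k y).
have CE n : C n = Num.sg (2 - p) * (2 * S x n + 2 * S y n - S (x + y) n - S (x - y) n).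
  by rewrite /C -mulr_sumr; congr (_ * _); rewrite /S !mulr_sumr -big_split -!sumrB.
have : C @ \oo --> Num.sg (2 - p) * clarksonN p x y.
  rewrite (_ : C = fun n => Num.sg (2 - p) *
    (2 * S x n + 2 * S y n - S (x + y) n - S (x - y) n)); last exact/funext.
  apply: cvgMr; rewrite /clarksonN; apply: cvgB; last exact: lp_rnorm_powR_cvg.
  apply: cvgB; last exact: lp_rnorm_powR_cvg.
  by apply: cvgD; apply: cvgMr; exact: lp_rnorm_powR_cvg.
move=> /cvgr_to_ge; apply; near=> m.
have im : (i < m)%N by near: m; exact: nbhs_infty_gt.
rewrite /C (bigD1 (Ordinal im))//= lerDl.
by apply: sumr_ge0 => k _; exact: clarkson_ge0.
Unshelve. all: by end_near. Qed.

(** Finitely many coordinates already give a norm [r > q], and on these [K] coordinates a vector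
    with entries at most [(r - q) / K.+1] has norm below [r - q]. In [l^p] uniformly small
    coordinates do not force a small norm; this weaker property takes the place of that bound. *)
Lemma lp_coord_approx x q : q < rnorm x -> exists2 e : R, 0 < e &
  forall y, (forall i, normc (lp_coord i y) <= e) -> q < rnorm (x - y).
Proof.
have aux (a b c d r s : R) : r <= a + b -> b <= c -> c < r - s -> a <= d -> s < d.
  by lra.
move=> qx; have [q0|q0] := ltP q 0.
  exists 1; first exact: ltr01.
  by move=> y _; exact: (lt_le_trans q0 (rnorm_ge0 (x - y))).
have qp : q `^ p < rnorm x `^ p by apply: gt0_ltr_powR; rewrite ?nnegrE ?rnorm_ge0.
have [K _ /(_ K (leqnn K)) hK] := cvgr_gt _ (@lp_rnorm_powR_cvg x) _ qp.
pose r := S x K `^ p^-1.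
have S0 z n : 0 <= S z n by apply: sumr_ge0 => i _; exact: powR_ge0.
have qr : q < r.
  have -> : q = (q `^ p) `^ p^-1 by rewrite -powRrM divff ?gt_eqF// powRr1.
  by apply: gt0_ltr_powR; rewrite ?invr_gt0 ?nnegrE ?powR_ge0.
have e0 : 0 < (r - q) / K.+1%:R by rewrite divr_gt0// subr_gt0.
exists ((r - q) / K.+1%:R); first exact: e0.
move=> y ye.
have h1 : r <= S (x - y) K `^ p^-1 + S y K `^ p^-1.
  have := fin_lp_normD p1 K (lp_coord^~ (x - y)) (lp_coord^~ y).
  apply: le_trans; rewrite le_eqVlt; apply/orP; left; apply/eqP.
  congr (_ `^ _); apply: eq_bigr => i _; congr (normc _ `^ _).
  by rewrite -[lp_coord i (x - y)]/(lp_coord i x - lp_coord i y) subrK.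
have h2 : S y K `^ p^-1 <= K%:R * ((r - q) / K.+1%:R) := psum_le K (ltW e0) ye.
have h3 : K%:R * ((r - q) / K.+1%:R) < r - q.
  by rewrite mulrCA gtr_pMr ?subr_gt0// ltr_pdivrMr// mul1r ltr_nat.
have h4 : S (x - y) K `^ p^-1 <= rnorm (x - y).
  exact: (root_le (S0 (x - y) K) (rnorm_ge0 (x - y)) (lp_partial_sum_le (x - y) K)).
exact: (aux _ _ _ _ _ _ h1 h2 h3 h4).
Qed.

End InfiniteCoordinates.
End SequenceCoordinates.

(** * The test sets *)

Definition ndist (x y : nat) : nat := ((x - y) + (y - x))%N.

Lemma natr_ndist (R : realDomainType) x y : (ndist x y)%:R = `|x%:R - y%:R| :> R.
Proof.
rewrite /ndist; have [xy|/ltnW yx] := leqP x y.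
  have /eqP -> := xy; rewrite add0n natrB// distrC ger0_norm// subr_ge0 ler_nat//.
by have /eqP -> := yx; rewrite addn0 natrB// ger0_norm// subr_ge0 ler_nat.
Qed.

Section ScaleEstimates.
Variable R : realType.
Implicit Types (L Q x y t tau kap : R).

(* Throughout, [L = 2 ^+ l] is the scale of the dyadic approximations [a], [b]
   and [k] of [L * x], [L * tau] and [L * kap], and [Q = 2 ^+ d] is the inverse
   of the tolerance. *)
Lemma test_norm_sound L Q x (a b : R) : 0 < L -> 0 < Q -> 2 * Q <= b ->
  `|L * x - a| <= 2 -> `|a - b| * Q <= b -> `|x - b / L| <= 3 / Q * (b / L).
Proof.
move=> L0 Q0 Qb xa ab.
have {}ab : `|a - b| <= b / Q by rewrite ler_pdivlMr.
have {}Qb : 2 <= b / Q by rewrite ler_pdivlMr.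
have -> : x - b / L = (L * x - b) / L by field; rewrite gt_eqF.
rewrite normrM [`|L^-1|]gtr0_norm ?invr_gt0// mulrA ler_pM2r ?invr_gt0//.
have := ler_distD a (L * x) b; have -> : 3 / Q * b = 3 * (b / Q) by ring.
have : 0 <= b / Q by lra.
lra.
Qed.

(** Everything is scaled by [L * L], because two approximations are multiplied. The test, the error
    on [x] and the error on [kap] contribute at most [b * L / Q] each; the last one uses
    [2 <= L / Q]. *)
Lemma test_sum_sound L Q x kap (a b k : R) : 0 < L -> 0 < Q -> 2 * Q <= b -> b <= L ->
  `|L * x - a| <= 2 -> `|L * kap - k| <= 2 -> `|a * L - k * b| * Q <= b * L ->
  `|x - kap * (b / L)| <= 3 / Q * (b / L).
Proof.
move=> L0 Q0 Qb bL xa kk ab.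
have b0 : 0 < b by apply: lt_le_trans Qb; rewrite mulr_gt0.
have {}ab : `|a * L - k * b| <= b * L / Q by rewrite ler_pdivlMr.
have Q2 : 2 <= b / Q by rewrite ler_pdivlMr.
have L2 : 2 <= L / Q by rewrite ler_pdivlMr// (le_trans Qb).
have -> : x - kap * (b / L) = (L * (L * x) - L * kap * b) / (L * L).
  by field; rewrite gt_eqF.
have LL : 0 < L * L by rewrite mulr_gt0.
rewrite normrM [`|(L * L)^-1|]gtr0_norm ?invr_gt0// ler_pdivrMr//.
have -> : 3 / Q * (b / L) * (L * L) = 3 * (b * L / Q).
  by field; rewrite !gt_eqF.
have e1 : `|L * (L * x) - a * L| <= 2 * L.
  by rewrite mulrC -mulrBl normrM (gtr0_norm L0) ler_wpM2r ?(ltW L0).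
have e2 : `|k * b - L * kap * b| <= 2 * b.
  by rewrite -mulrBl normrM (gtr0_norm b0) ler_wpM2r ?(ltW b0)// distrC.
have e3 : 2 * L <= b * L / Q by rewrite mulrAC ler_wpM2r ?(ltW L0).
have e4 : 2 * b <= b * L / Q by rewrite -mulrA mulrC ler_wpM2l ?(ltW b0).
have := ler_distD (a * L) (L * (L * x)) (L * kap * b).
have := ler_distD (k * b) (a * L) (L * kap * b).
lra.
Qed.

Lemma test_norm_complete L Q x tau eta (a b : R) : 0 < L -> 1 <= Q ->
  20 * Q <= L * tau -> b <= L * tau -> L * tau < b + 1 ->
  `|x - tau| <= eta -> Q * eta <= tau / 8 ->
  `|L * x - a| <= 2 -> `|a - b| * Q <= b.
Proof.
move=> L0 Q1 LQ b1 b2 xt eQ xa.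
have e1 : `|L * x - L * tau| <= L * eta.
  by rewrite -mulrBr normrM gtr0_norm// ler_wpM2l ?(ltW L0).
have e2 : `|L * tau - b| <= 1 by rewrite ger0_norm; lra.
have : `|a - b| <= 3 + L * eta.
  have := ler_distD (L * x) a b; have := ler_distD (L * tau) (L * x) b.
  by rewrite (distrC a (L * x)); lra.
have Q0 : 0 <= Q by lra.
move=> /(ler_wpM2r Q0); rewrite mulrDl -mulrA (mulrC eta) => e3.
have e4 : L * (Q * eta) <= L * (tau / 8) by rewrite ler_wpM2l ?(ltW L0).
lra.
Qed.

(** Since [L * tau] is at least [20 * Q], the rounding term [6 * Q] takes at most 3/10 of it, and
    [eta] takes 1/4; the total stays below [L * tau - 1], hence below [b]. *)
Lemma test_sum_complete L Q x kap tau eta (a b k : R) : 0 < L -> 1 <= Q ->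
  0 <= kap <= 2 -> 0 <= b <= L ->
  20 * Q <= L * tau -> b <= L * tau -> L * tau < b + 1 ->
  `|x - kap * tau| <= 2 * eta -> Q * eta <= tau / 8 ->
  `|L * x - a| <= 2 -> `|L * kap - k| <= 2 -> `|a * L - k * b| * Q <= b * L.
Proof.
move=> L0 Q1 /andP[k0 k2] /andP[b0 bL] LQ b1 b2 xt eQ xa kk.
have L0' := ltW L0.
have e1 : `|L * (L * x) - L * (L * (kap * tau))| <= L * (L * (2 * eta)).
  by rewrite -!mulrBr !normrM gtr0_norm// !ler_wpM2l.
have e2 : `|L * kap * (L * tau) - L * kap * b| <= L * 2.
  rewrite -mulrBr normrM ger0_norm ?mulr_ge0// -mulrA ler_wpM2l//.
  have : `|L * tau - b| <= 1 by rewrite ger0_norm; lra.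
  by move=> /(ler_pM k0 (normr_ge0 _) k2); rewrite mulr1.
have e5 : `|L * (L * x) - a * L| <= L * 2.
  by rewrite (mulrC a) -mulrBr normrM (gtr0_norm L0) ler_wpM2l.
have e6 : `|k * b - L * kap * b| <= 2 * b.
  by rewrite -mulrBl normrM (ger0_norm b0) ler_wpM2r// distrC.
have e7 : `|a * L - k * b| <= L * (6 + 2 * (L * eta)).
  have := ler_distD (L * (L * x)) (a * L) (k * b).
  have := ler_distD (L * (L * (kap * tau))) (L * (L * x)) (k * b).
  have := ler_distD (L * kap * b) (L * (L * (kap * tau))) (k * b).
  rewrite (distrC (a * L) (L * (L * x))) (distrC (L * kap * b) (k * b)).
  have -> : L * (L * (kap * tau)) = L * kap * (L * tau) by ring.
  rewrite -[L * (L * (kap * tau))](_ : L * kap * (L * tau) = _) in e1; last by ring.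
  lra.
have Q0 : 0 <= Q by lra.
move: e7 => /(ler_wpM2r Q0) e7; apply: (le_trans e7).
have -> : L * (6 + 2 * (L * eta)) * Q = (6 * Q + 2 * (L * (Q * eta))) * L by ring.
rewrite ler_wpM2r//.
have e4 : L * (Q * eta) <= L * (tau / 8) by rewrite ler_wpM2l.
lra.
Qed.

End ScaleEstimates.

Section TestSet.
Variables (R : realType) (p : R) (p1 : 1 <= p).
Hypotheses (p_computable : computable_real p) (p_neq2 : p != 2).
Variables (U : normedModType R[i]) (P : presentation (lpsum p1 U (Lp01 p1))).
Hypothesis P_computable : computable_presentation P.

Local Notation W := (lpsum p1 U (Lp01 p1)).
Local Notation r := (rational_vector P).
Local Notation O0 := (charfun set0).

Definition coordinates (co : nat -> U -> R[i]) : Prop :=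
  (forall i, clarkson_coordinate p (fun w : W => co i w.1)) /\
  (forall i u v, co i (u + v) = co i u + co i v).

Lemma coordinate_sum co : coordinates co -> forall i N (g : nat -> W),
  normc (co i (\sum_(k < N) g k).1) <= \sum_(k < N) normc (co i (g k).1).
Proof.
move=> [_ coD] i N g; elim: N => [|N IH].
  rewrite !big_ord0; have -> : co i (0 : W).1 = 0.
    by apply: (addrI (co i 0)); rewrite -coD !addr0.
  by rewrite normc0.
rewrite !big_ord_recr /= coD (le_trans (le_normcD _ _))//.
by rewrite lerD2r.
Qed.

(* [L] codes a list of [N] rational vectors, and [b / 2 ^ l] approximates their
   common norm, with tolerance [2 ^- d]; the last conjunct says that their sum is
   within [c / 2 ^ e] of the [n]-th rational vector. *)
Definition test (D : nat) (a vs : nat -> nat -> nat) (K : nat -> nat)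
    (n j c e L N b l : nat) : bool :=
  let d := (D * N.+1 + 2)%N in
  let s i := code_nth L i in
  let va x y := vs x (vs 0%N y) in
  let sm := nat_rect _ 0%N (fun i w => va w (s i)) N in
  [&& (b * 2 ^ j <= 2 ^ l)%N, (2 * 2 ^ d <= b)%N,
      all (fun i => (ndist (a (s i) l) b * 2 ^ d <= b)%N) (iota 0 N),
      all (fun i => all (fun k =>
        (ndist (a (va (s i) (s k)) l * 2 ^ l) (K l * b) * 2 ^ d <= b * 2 ^ l)%N &&
        (ndist (a (vs (s i) (s k)) l * 2 ^ l) (K l * b) * 2 ^ d <= b * 2 ^ l)%N)
        (iota 0 i)) (iota 0 N) &
      ((a (vs n sm) l + 2) * 2 ^ e <= c * 2 ^ l)%N].

Lemma recb_test O D a vs K f1 f2 f3 f4 f5 f6 f7 f8 :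
  recf2 O a -> recf2 O vs -> recf O K ->
  recf O f1 -> recf O f2 -> recf O f3 -> recf O f4 ->
  recf O f5 -> recf O f6 -> recf O f7 -> recf O f8 ->
  recb O (fun x => test D a vs K (f1 x) (f2 x) (f3 x) (f4 x) (f5 x) (f6 x) (f7 x) (f8 x)).
Proof.
move=> ha hvs hK h1 h2 h3 h4 h5 h6 h7 h8.
have ca f g := @recf2_comp O a f g ha.
have cvs f g := @recf2_comp O vs f g hvs.
have cn f g := @recf2_comp O code_nth f g (recf_code_nth O).
have cK f := @recf_comp O K f hK.
have c1 f := @recf_comp O f1 f h1; have c2 f := @recf_comp O f2 f h2.
have c3 f := @recf_comp O f3 f h3; have c4 f := @recf_comp O f4 f h4.
have c5 f := @recf_comp O f5 f h5; have c6 f := @recf_comp O f6 f h6.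
have c7 f := @recf_comp O f7 f h7; have c8 f := @recf_comp O f8 f h8.
have hsm : recf O (fun x => nat_rect _ 0%N
    (fun i w => vs w (vs 0%N (code_nth (f5 x) i))) (f6 x)).
  apply: (@recf_nat_rect O (fun=> 0%N) (fun x i w => vs w (vs 0%N (code_nth (f5 x) i)))) => //.
    exact: recf_cst.
  auto 20 with recf nocore.
rewrite /test /ndist; apply: recb_and; first by auto 20 with recf nocore.
apply: recb_and; first by auto 20 with recf nocore.
apply: recb_and; first by apply: recb_all => //; auto 30 with recf nocore.
apply: recb_and; last by auto 30 with recf nocore.
apply: recb_all => //.
apply: recb_all; last by auto with recf nocore.
by auto 60 with recf nocore.
Qed.

(** Soundness applies [almost_disjoint_coordinate] to the list found by [test]. Completeness splits
    the [L^p[0,1]] part of [r n] into disjoint pieces of norm below [2 ^- j] and replaces them by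
    nearby rational vectors; the strict inequality provides the room. *)
Lemma test_set_exists co : coordinates co ->
  exists T : nat -> nat -> nat -> nat -> Prop,
  [/\ sig1 O0 (fun x => T (nfst (nfst x)) (nsnd (nfst x)) (nfst (nsnd x)) (nsnd (nsnd x))),
      forall n j c e, T n j c e -> exists w : W,
        (forall i, normc (co i w.1) <= 3 * 2 ^- j) /\
        rnorm (r n - w) <= c%:R / 2 ^+ e &
      forall n j c e, rnorm (r n).1 < c%:R / 2 ^+ e -> T n j c e].
Proof.
move=> hco; have [co_cl coD] := hco.
have [a ha pa] := recf_norm_approx P_computable.
have [vs hvs pvs] := recf_vector_sub R O0.
have [K hK pK] := recf_kappa_approx p1 p_computable.
have [D hD] := @almost_disjoint_coordinate R p p1 p_neq2 W.
(* Code 0 is the zero vector, so addition is obtained from subtraction. *)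
have pva x y : r (vs x (vs 0%N y)) = r x + r y.
  rewrite !pvs; have -> : r 0%N = 0.
    by rewrite (@rational_vectorE _ _ _ 0 0)// big_ord0.
  by rewrite sub0r opprK.
have psm L N : r (nat_rect _ 0%N (fun i w => vs w (vs 0%N (code_nth L i))) N) =
    \sum_(i < N) r (code_nth L i).
  elim: N => [|N IH]; first by rewrite big_ord0 (@rational_vectorE _ _ _ 0 0)// big_ord0.
  by rewrite big_ord_recr /= -IH -pva.
exists (fun n j c e => exists z, test D a vs K n j c e
  (nfst (nfst z)) (nsnd (nfst z)) (nfst (nsnd z)) (nsnd (nsnd z))); split.
- exists (fun x z => test D a vs K (nfst (nfst x)) (nsnd (nfst x)) (nfst (nsnd x))
    (nsnd (nsnd x)) (nfst (nfst z)) (nsnd (nfst z)) (nfst (nsnd z)) (nsnd (nsnd z))).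
    by apply: recb_test => //; auto 20 with recf nocore.
  by [].
- move=> n j c e [z]; move: (nfst (nfst z)) (nsnd (nfst z)) (nfst (nsnd z)) (nsnd (nsnd z)).
  move=> {z} L N b l /and5P[bj Qb /allP t1 /allP t2 t3].
  set d := (D * N.+1 + 2)%N in Qb t1 t2.
  (* The [+ 2] in [d] pays for the factor 3 lost in the soundness estimates. *)
  have d_small : 3 / 2 ^+ d <= 2 ^- (D * N.+1) :> R.
    have X0 : 0 < 2 ^+ (D * N.+1) :> R by rewrite exprn_gt0.
    have e0 : 0 < 2 ^+ d :> R by rewrite exprn_gt0.
    rewrite ler_pdivrMr// ler_pdivlMl// /d exprD; apply: (ler_wpM2l (ltW X0)).
    by rewrite -natrX ler_nat.
  pose g i := r (code_nth L i).
  exists (\sum_(i < N) g i).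
  have L0 : 0 < 2 ^+ l :> R by rewrite exprn_gt0.
  have Q0 : 0 < 2 ^+ d :> R by rewrite exprn_gt0.
  have QbR : 2 * 2 ^+ d <= b%:R :> R by rewrite -natrX -natrM ler_nat.
  have bL : b%:R <= 2 ^+ l :> R.
    by rewrite -natrX ler_nat (leq_trans _ bj)// leq_pmulr// expn_gt0.
  have tj : b%:R / 2 ^+ l <= 2 ^- j :> R.
    by rewrite ler_pdivrMr// ler_pdivlMl ?exprn_gt0// mulrC -!natrX -natrM ler_nat.
  have t0 : 0 <= b%:R / 2 ^+ l :> R by rewrite divr_ge0// ltW.
  split.
    move=> i; apply: (le_trans (@coordinate_sum co hco i N g)).
    apply: (@le_trans _ _ (3 * (b%:R / 2 ^+ l))); last by rewrite ler_wpM2l.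
    apply: (hD N (3 / 2 ^+ d) _ g (fun w : W => co i w.1)) => //.
      by rewrite d_small andbT divr_ge0// ltW.
    split => [i' iN|i' k iN ki].
      apply: (test_norm_sound L0 Q0 QbR (pa _ l)).
      have : i' \in iota 0 N by rewrite mem_iota.
      by move=> /t1; rewrite -(ler_nat R) natrM natrX natr_ndist.
    have /t2/allP/(_ k) : i' \in iota 0 N by rewrite mem_iota.
    rewrite mem_iota ki => /(_ isT)/andP[].
    rewrite -!(ler_nat R) !natrM natr_ndist natr_ndist !natrM !natrX => u1 u2.
    split.
      by rewrite -pva; apply: (test_sum_sound L0 Q0 QbR bL (pa _ l) (pK l)).
    by rewrite -pvs; apply: (test_sum_sound L0 Q0 QbR bL (pa _ l) (pK l)).
  rewrite -psm -pvs ler_pdivlMr ?exprn_gt0//.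
  move: t3; rewrite -(ler_nat R) !natrM natrD !natrX.
  set x := vs n _; have := pa x l; rewrite ler_distlC => /andP[h _] t3.
  rewrite -(ler_pM2r L0); apply: le_trans t3.
  rewrite mulrAC ler_wpM2r ?exprn_ge0// mulrC; lra.
move=> n j c e ne; set f := (r n).2.
(* [slack] is spent in halves: one on replacing the [N] pieces by rational vectors, the other on the
   rounding error, 4 at scale [2 ^ l], in the last conjunct of [test]. *)
pose slack := c%:R / 2 ^+ e - rnorm (r n).1.
have s0 : 0 < slack by rewrite subr_gt0.
have e0 : 0 < 2 ^- j :> R by rewrite invr_gt0 exprn_gt0.
have [N [tau [h [/andP[tau0 tauj] fE hn hs]]]] := Lp01_equal_split f e0.
set d := (D * N.+1 + 2)%N; pose Q : R := 2 ^+ d.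
have Q1 : 1 <= Q by rewrite exprn_ege1// ler1n.
have Q0 : 0 < Q by lra.
pose eta := Num.min (tau / (8 * Q)) (slack / (2 * N.+1%:R)).
have eta0 : 0 < eta by rewrite lt_min !divr_gt0// mulr_gt0.
have etaQ : Q * eta <= tau / 8.
  have : eta <= tau / (8 * Q) by rewrite ge_min lexx.
  move=> /(ler_wpM2l (ltW Q0)) /le_trans; apply.
  by rewrite le_eqVlt; apply/orP; left; apply/eqP; field; rewrite gt_eqF.
have etaN : N%:R * eta <= slack / 2.
  have : eta <= slack / (2 * N.+1%:R) by rewrite ge_min lexx orbT.
  move=> /(ler_wpM2l (ler0n R N)) /le_trans; apply.
  rewrite mulrA ler_pdivrMr ?mulr_gt0// mulrA divfK ?pnatr_eq0// mulrC.
  by apply: (ler_wpM2l (ltW s0)); rewrite ler_nat.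
pose v i : W := (0, h i).
have [q hq] := choice (fun i => @rational_vector_dense R _ P (v i) eta eta0).
pose L := CodeSeq.code (mkseq q N).
have Lq i : (i < N)%N -> code_nth L i = q i.
  by move=> iN; rewrite /code_nth /L CodeSeq.codeK nth_mkseq.
have [l hl] := exp2_unbounded (20 * Q / tau + 8 / slack).
have L0 : 0 < 2 ^+ l :> R by rewrite exprn_gt0.
have f1 : 0 <= 20 * Q / tau by rewrite divr_ge0 ?mulr_ge0 ?ltW.
have f2 : 0 <= 8 / slack by rewrite divr_ge0 ?ltW.
have LQ : 20 * Q <= 2 ^+ l * tau by rewrite -ler_pdivrMr//; lra.
have Ls : 8 <= 2 ^+ l * slack by rewrite -ler_pdivrMr//; lra.
have Lt0 : 0 <= 2 ^+ l * tau by rewrite mulr_ge0 ?ltW.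
pose b := Num.truncn (2 ^+ l * tau).
have /andP[b1 b2] := truncn_itv Lt0; rewrite -/b in b1 b2; rewrite -[b.+1%:R]natr1 in b2.
have bj : (b * 2 ^ j <= 2 ^ l)%N.
  rewrite -(ler_nat R) natrM !natrX; have ej : 0 < 2 ^+ j :> R by rewrite exprn_gt0.
  rewrite -ler_pdivlMr//; apply: (le_trans b1); exact: (ler_wpM2l (ltW L0) (ltW tauj)).
have bL : 0 <= (b%:R : R) <= 2 ^+ l.
  by rewrite ler0n -natrX ler_nat (leq_trans _ bj)// leq_pmulr// expn_gt0.
have Kk : 0 <= kappa p <= 2.
  by rewrite kappa_le2// andbT ltW// (lt_trans _ (kappa_gt1 p1)).
have close i : (i < N)%N -> `|rnorm (r (q i)) - tau| <= eta.
  move=> iN; rewrite -(hn i iN) -(rnorm_inr p1 U (h i)).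
  exact: le_trans (ler_dist_rnorm _ _) (ltW (hq i)).
have close2 i k (s : bool) : (i < N)%N -> (k < i)%N ->
    `|rnorm (r (q i) + (-1) ^+ s *: r (q k)) - kappa p * tau| <= 2 * eta.
  move=> iN ki; have [hp hm] := hs i k iN ki.
  have -> : kappa p * tau = rnorm (v i + (-1) ^+ s *: v k).
    case: s; rewrite ?expr1 ?expr0 ?scaleN1r ?scale1r.
      rewrite -hm -(rnorm_inr p1 U); congr rnorm; congr pair.
      by rewrite subr0.
    rewrite -hp -(rnorm_inr p1 U); congr rnorm; congr pair.
    by rewrite addr0.
  apply: (le_trans (ler_dist_rnorm _ _)).
  rewrite opprD addrACA -scalerBr; apply: (le_trans (rnormD _ _)).
  have -> : 2 * eta = eta + eta by ring.
  apply: lerD; first exact: ltW (hq i).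
  rewrite rnormZ; have -> : normc ((-1) ^+ s : R[i]) = 1.
    by case: s; rewrite ?expr1 ?expr0 /= ?oppr0 ?sqrrN expr1n expr0n addr0 sqrtr1.
  by rewrite mul1r; exact: ltW (hq k).
exists (npair (npair L N) (npair b l)); rewrite !(nfstE, nsndE).
have QE : (2 ^ d)%:R = Q by rewrite natrX.
apply/and5P; split => //.
- rewrite -(ler_nat R) natrM natrX -/d -/Q; lra.
- apply/allP => i; rewrite mem_iota add0n => iN; rewrite Lq// -/d.
  rewrite -(ler_nat R) natrM natr_ndist QE.
  exact: (test_norm_complete L0 Q1 LQ b1 b2 (close i iN) etaQ (pa _ l)).
- apply/allP => i; rewrite mem_iota add0n => iN; apply/allP => k.
  rewrite mem_iota add0n => ki; rewrite !Lq ?(ltn_trans ki)// -/d.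
  rewrite -!(ler_nat R) !natrM !natr_ndist !natrM QE natrX.
  have xp := close2 i k false iN ki; have xm := close2 i k true iN ki.
  rewrite expr0 scale1r -pva in xp; rewrite expr1 scaleN1r -pvs in xm.
  apply/andP; split.
    exact: (test_sum_complete L0 Q1 Kk bL LQ b1 b2 xp etaQ (pa _ l) (pK l)).
  exact: (test_sum_complete L0 Q1 Kk bL LQ b1 b2 xm etaQ (pa _ l) (pK l)).
set x := vs n _.
have hx : rnorm (r x) <= c%:R / 2 ^+ e - slack / 2.
  rewrite /x pvs psm.
  have sumv M : \sum_(i < M) v i = (0, \sum_(i < M) h i) :> W.
    elim: M => [|M IH]; first by rewrite !big_ord0.
    by rewrite !big_ord_recr /= IH; congr pair; rewrite addr0.
  have -> : r n - \sum_(i < N) r (code_nth L i) =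
      ((r n).1, 0) + \sum_(i < N) (v i - r (q i)) :> W.
    rewrite sumrB addrA; congr (_ - _).
      by rewrite sumv -fE /f; case: (r n) => u w; congr pair; rewrite /= ?addr0 ?add0r.
    by apply: eq_bigr => i _; rewrite Lq.
  apply: (le_trans (rnormD _ _)); rewrite rnorm_inl.
  have : rnorm (\sum_(i < N) (v i - r (q i)) : W) <= N%:R * eta.
    apply: (le_trans (rnorm_sum _ _ _)).
    have -> : N%:R * eta = \sum_(i < N) eta by rewrite sumr_const card_ord mulr_natl.
    by apply: ler_sum => i _; rewrite rnormB ltW.
  by rewrite /slack in etaN *; lra.
have := pa x l; rewrite ler_distlC => /andP[_ ha'].
have ee : 0 < 2 ^+ e :> R by rewrite exprn_gt0.
rewrite -(ler_nat R) !natrM natrD !natrX -ler_pdivlMr//.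
have h3 : 2 ^+ l * rnorm (r x) <= 2 ^+ l * (c%:R / 2 ^+ e - slack / 2).
  by rewrite ler_wpM2l// ltW.
have -> : c%:R * 2 ^+ l / 2 ^+ e = 2 ^+ l * (c%:R / 2 ^+ e) :> R by ring.
lra.
Qed.

End TestSet.

(** * Computing the projection *)

Section UniformProgram.

(** [recf] lets the program depend on the oracle, whereas a computable map needs one program for all
    names, so the reduction to [oracle_join] is written out. [X] sits at the even positions.
    [Pair Fst Snd] is the identity. *)
Definition double_prog :=
  Comp (Prec Zero (Comp Succ (Comp Succ (Comp Snd Snd)))) (Pair Zero (Pair Fst Snd)).

Lemma computes_double O n : computes O double_prog n n.*2.
Proof.
exists (npair 0 n).
  exists 0%N, n; split => //; exists (nfst n), (nsnd n).
  by split => //; rewrite npairK.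
rewrite /= nsndE nfstE; elim: n => [|n IH] //; exists n.*2 => //.
exists n.*2.+1 => //; exists n.*2 => //; exists (npair n n.*2).
  by rewrite nsndE.
by rewrite nsndE.
Qed.

(** Precision [k.+1] is requested both from the name and from [F], so that the two errors add up to
    [2 ^- k]. *)
Lemma recf_oracle_join X F : recf2 (charfun X) F ->
  exists c, forall g k, computes (oracle_join (charfun X) g) c k (F (g k.+1) k.+1).
Proof.
move=> [c hc]; exists (Comp (subst_query (Comp Query double_prog) c)
  (Pair (Comp Query (Comp Succ (Comp double_prog Succ))) Succ)) => g k.
exists (npair (g k.+1) k.+1).
  exists (g k.+1), k.+1; split => //; exists (k.+1).*2.+1.
    by exists (k.+1).*2 => //; exists k.+1 => //; exact: computes_double.
  by rewrite /= /oracle_join /= odd_double /= uphalf_double.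
apply: (@computes_subst (charfun X)).
  move=> n; exists n.*2; first exact: computes_double.
  by rewrite /= /oracle_join odd_double doubleK.
by have := hc (npair (g k.+1) k.+1); rewrite nfstE nsndE.
Qed.

End UniformProgram.

Section PowerDifference.
Variable R : realType.

(** A substitute for the mean value theorem: for [s = y / x <= 1], Bernoulli's inequality gives
    [1 - P * (1 - s) <= s ^ P <= s ^ p], and [x ^ p * (1 - s) = x ^ (p - 1) * (x - y)]. *)
Lemma powR_diff_le (p B x y d : R) (P : nat) : 1 <= p -> p <= P%:R ->
  0 <= y -> y <= x -> x <= B -> 1 <= B -> x - y <= d ->
  x `^ p - y `^ p <= P%:R * B ^+ P * d.
Proof.
move=> p1 pP y0 yx xB B1 xyd.
have p0 : 0 < p by apply: lt_le_trans p1.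
have d0 : 0 <= d by apply: le_trans xyd; rewrite subr_ge0.
have B0 : 0 <= B by lra.
have [x0|x0] := eqVneq x 0.
  have y00 : y = 0 by lra.
  by rewrite x0 y00 subrr !mulr_ge0// exprn_ge0.
have {}x0 : 0 < x by rewrite lt0r x0 (le_trans y0).
pose s := y / x.
have s0 : 0 <= s by rewrite divr_ge0// ltW.
have s1 : s <= 1 by rewrite ler_pdivrMr// mul1r.
have bern n : 1 - n%:R * (1 - s) <= s ^+ n.
  elim: n => [|n IH]; first by rewrite mul0r subr0.
  have := ler_wpM2l s0 IH; rewrite exprS -natr1.
  have : 0 <= n%:R * (1 - s) * (1 - s) by rewrite !mulr_ge0// subr_ge0.
  lra.
have sp : 1 - P%:R * (1 - s) <= s `^ p.
  have [s00|sn0] := eqVneq s 0.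
    rewrite s00 powR0 ?gt_eqF// subr0 mulr1 subr_le0 (le_trans p1)//.
  apply: (le_trans (bern P)); rewrite -powR_mulrn//.
  by apply: ger_powR => //; rewrite lt0r sn0 s0 s1.
have yE : y = x * s by rewrite /s mulrCA divff ?mulr1// gt_eqF.
have -> : y `^ p = x `^ p * s `^ p by rewrite {1}yE powRM// ltW.
have xp0 := powR_ge0 x p.
have h1 : x `^ p - x `^ p * s `^ p <= x `^ p * (P%:R * (1 - s)).
  have := ler_wpM2l xp0 sp; lra.
apply: (le_trans h1).
have -> : x `^ p * (P%:R * (1 - s)) = P%:R * x `^ (p - 1) * (x - y).
  by rewrite -(mulr_powRB1 (ltW x0) p0) yE; ring.
apply: ler_pM => //.
- by rewrite mulr_ge0// powR_ge0.
- by rewrite subr_ge0.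
rewrite ler_wpM2l// (@le_trans _ _ (B `^ (p - 1)))//.
  by apply: ge0_ler_powR; rewrite ?subr_ge0 ?nnegrE// ltW.
by rewrite -powR_mulrn//; apply: ler_powR => //; lra.
Qed.

End PowerDifference.

Section SearchArithmetic.
Variable R : realFieldType.
Implicit Types a b c e f q t E L x y : R.

Lemma ltr_scaled_trunc c t E x y : t <= E * x -> x * E <= y * E + 2^-1 -> c = t + 1 ->
  c - 2 < y * E.
Proof. lra. Qed.

Lemma ler_scaled_approx a c E L x : 0 <= E -> a <= L * x + 2 -> 4 * E <= L * (c - E * x) ->
  (a + 2) * E <= c * L.
Proof. by move=> E0 /(ler_wpM2r E0); lra. Qed.

Lemma ler_approx_scaled a L x : L * x - 2 <= a -> x * L <= a + 2.
Proof. lra. Qed.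

Lemma ler_distl_bound b e x y : `|x - y| <= b -> y <= e -> x - e <= b.
Proof. by rewrite ler_norml => /andP[]; lra. Qed.

Lemma ler_sub_triple c e x y y' : x <= c * e -> c * e - 2 * e <= y -> y - e <= y' ->
  x - y' <= 3 * e.
Proof. lra. Qed.

Lemma ler_add_four a c e x y z : 0 <= e <= 1 -> x <= c * e -> c * e - 2 * e <= y ->
  y <= z -> z - 2 <= a -> x <= a + 4.
Proof. by move=> /andP[]; lra. Qed.

Lemma ltr_add_quadruple e f q y : 0 < f -> e <= f -> y <= e -> q <= f -> y + q < 4 * f.
Proof. lra. Qed.

End SearchArithmetic.

(** * Searching for an approximation of the projection of a rational vector *)

Section ProjectionSearch.
Variables (R : realType) (p : R) (p1 : 1 <= p) (U V : normedModType R[i]).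
Variable P : presentation (lpsum p1 U V).
Hypothesis P_computable : computable_presentation P.
Variables (X : set nat) (T : nat -> nat -> nat -> nat -> Prop) (G : nat -> nat -> bool).

Local Notation W := (lpsum p1 U V).
Local Notation r := (rational_vector P).

Hypothesis T_dec : recb (charfun X)
  (fun x => `[< T (nfst (nfst x)) (nsnd (nfst x)) (nfst (nsnd x)) (nsnd (nsnd x)) >]).
Hypothesis T_complete : forall n j c e, rnorm (r n).1 < c%:R / 2 ^+ e -> T n j c e.
Hypothesis T_sound : forall n c e, c%:R / 2 ^+ e < rnorm (r n).1 -> exists j, ~ T n j c e.
Hypothesis G_dec : recb (charfun X) (fun x => G (nfst x) (nsnd x)).
Hypothesis G_sound : forall m e, G m e -> rnorm (r m).1 <= 2 ^- e.
Hypothesis G_complete : forall m e, rnorm (r m).1 < 2 ^- e.+1 -> G m e.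

Let p0 : 0 < p. Proof. exact: lt_le_trans p1. Qed.

(** Let [x] be the norm of [r n - r m], and [y], [q] those of its two components. The search
    condition forces [x - y <= 3 / 2 ^ e], and [q ^ p = x ^ p - y ^ p] then makes [q] small. Both
    parts of the theorem share this search and differ only in the oracle and in the guard [G]. *)
Lemma recf_projection : exists2 F, recf2 (charfun X) F &
  forall n k, rnorm (r (F n k) - (0, (r n).2)) < 2 ^- k.
Proof.
have [a ha0 pa] := recf_norm_approx P_computable.
have ha : recf2 (charfun X) a by exact: recf_oracle0.
have [vs hvs pvs] := recf_vector_sub R (charfun X).
pose M := (Num.truncn p).+1.
have pM : p <= M%:R by have /andP[_ /ltW] := truncn_itv (ltW p0).
(* A bound for [x] known before the search: [c / 2 ^ e] exceeds the norm of [r n] by at most 2, and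
   [a n 0] is within 2 of that norm. *)
pose B n := (a n 0 + 4)%N.
(* The summands pay, in order, for the M-th power of the target [2 ^- (k + 2)], and for
   [M <= 2 ^ M], [B n ^ M <= 2 ^ (B n * M)] and [3 <= 2 ^ 2] in the bound of [powR_diff_le]. *)
pose e n k := ((k + 2) * M + M + B n * M + 2)%N.
(* The search finds [m] with [r m] almost in [L^p] and
   [|r n - r m| <= c / 2 ^ e], while [(c - 2) / 2 ^ e] bounds the atomic part of
   [r n] from below, as certified by level [j] of the test set. *)
pose b n k z := let m := nfst (nfst z) in let j := nsnd (nfst z) in
  let c := nfst (nsnd z) in let l := nsnd (nsnd z) in
  [&& G m (e n k), ((a (vs n m) l + 2) * 2 ^ e n k <= c * 2 ^ l)%N &
      (c <= 2)%N || ~~ `[< T n j (c - 2)%N (e n k) >]].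
have [||F hF bF] := @recf2_search (charfun X) b.
- have ca f g := @recf2_comp _ a f g ha.
  have cvs f g := @recf2_comp _ vs f g hvs.
  have cG f g := @recb2_comp _ G f g G_dec.
  have cT f1 f2 f3 f4 : recf (charfun X) f1 -> recf (charfun X) f2 ->
      recf (charfun X) f3 -> recf (charfun X) f4 ->
      recb (charfun X) (fun x => `[< T (f1 x) (f2 x) (f3 x) (f4 x) >]).
    move=> h1 h2 h3 h4.
    apply: recb_ext (recb_comp T_dec (recf_npair (recf_npair h1 h2) (recf_npair h3 h4))).
    by move=> x; rewrite !(nfstE, nsndE).
  rewrite /b /e /B /=.
  apply: recb_and; first by apply: cG; auto 20 with recf nocore.
  apply: recb_and; first by auto 30 with recf nocore.
  apply: recb_or; first by auto 30 with recf nocore.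
  by apply: recb_neg; apply: cT; auto 30 with recf nocore.
- move=> n k; set ee := e n k.
  pose v : W := (0, (r n).2).
  have E0 : 0 < 2 ^+ ee :> R by rewrite exprn_gt0.
  have e0 : 0 < 2 ^- ee.+1 :> R by rewrite invr_gt0 exprn_gt0.
  have [m hm] := rational_vector_dense P v e0.
  have hG : G m ee.
    apply: G_complete; apply: le_lt_trans hm.
    have := lpsum_rnorm1 (r m - v); by rewrite [(r m - v).1]subr0.
  pose x := rnorm (r n - r m).
  have hx : x <= rnorm (r n).1 + 2 ^- ee.+1.
    rewrite /x -[r n - r m](_ : (r n - v) + (v - r m) = _); last by rewrite addrA subrK.
    apply: (le_trans (rnormD _ _)); apply: lerD; last by rewrite rnormB ltW.
    have -> : r n - v = ((r n).1, 0) :> W.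
      rewrite /v; case: (r n) => u w /=; congr pair; by rewrite ?subr0 ?subrr.
    by rewrite rnorm_inl.
  have x0 : 0 <= x by exact: rnorm_ge0.
  have Ex0 : 0 <= 2 ^+ ee * x by rewrite mulr_ge0// ltW.
  have /andP[c1 c2] := truncn_itv Ex0.
  (* Then [c - 1 <= 2 ^ ee * x], and [x] exceeds the atomic norm by at most half of [2 ^- ee]; so
     [c - 2] lies strictly below the scaled atomic norm, as [T_sound] requires. *)
  pose c := (Num.truncn (2 ^+ ee * x)).+1; rewrite -/c in c2.
  have cx : 0 < c%:R - 2 ^+ ee * x by rewrite subr_gt0.
  have [l hl] := exp2_unbounded (4 * 2 ^+ ee / (c%:R - 2 ^+ ee * x)).
  rewrite ler_pdivrMr// in hl.
  have hj : exists j, (c <= 2)%N || ~~ `[< T n j (c - 2)%N ee >].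
    (* For [c <= 2] the lower bound is trivial and is accepted without a certificate, which
       [T_sound] does not provide for a vanishing atomic part. *)
    have [c3|c3] := leqP c 2; first by exists 0%N.
    have [j nT] : exists j, ~ T n j (c - 2)%N ee.
      apply: T_sound; rewrite ltr_pdivrMr// natrB ?(ltnW c3)//.
      have h2 : 2 ^- ee.+1 * 2 ^+ ee = 2^-1 :> R.
        by rewrite exprS invfM -mulrA mulVf ?mulr1// gt_eqF.
      have := ler_wpM2r (ltW E0) hx; rewrite mulrDl h2 => h3.
      by apply: (ltr_scaled_trunc c1 h3); rewrite natr1.
    by exists j; apply/orP; right; apply/asboolPn.
  have [j hj'] := hj.
  exists (npair (npair m j) (npair c l)).
  rewrite /b !(nfstE, nsndE) -/ee hG hj' andbT /=.
  have := pa (vs n m) l; rewrite pvs -/x ler_distlC => /andP[_ h].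
  rewrite -(ler_nat R) !natrM natrD !natrX.
  exact: (ler_scaled_approx (ltW E0) h hl).
exists (fun n k => nfst (nfst (F n k))).
  exact/recf_nfst/recf_nfst.
move=> n k; have := bF n k; rewrite /b.
move: (nfst (nfst (F n k))) (nsnd (nfst (F n k))) (nfst (nsnd (F n k))) (nsnd (nsnd (F n k))).
move=> m j c l /and3P[/G_sound hG hx hT].
set ee := e n k in hG hx hT.
have E0 : 0 < 2 ^+ ee :> R by rewrite exprn_gt0.
have L0 : 0 < 2 ^+ l :> R by rewrite exprn_gt0.
pose x := rnorm (r n - r m).
have {}hx : x <= c%:R / 2 ^+ ee.
  rewrite ler_pdivlMr// -(ler_pM2r L0).
  move: hx; rewrite -(ler_nat R) !natrM natrD !natrX; apply: le_trans.
  have := pa (vs n m) l; rewrite pvs -/x ler_distlC => /andP[h _].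
  by rewrite mulrAC; apply: (ler_wpM2r (ltW E0)); exact: ler_approx_scaled.
have {}hT : (c%:R - 2) / 2 ^+ ee <= rnorm (r n).1.
  case/orP: hT => [c2|/asboolPn nT].
    apply: le_trans (rnorm_ge0 _); rewrite pmulr_lle0 ?invr_gt0// subr_le0.
    by rewrite (ler_nat R _ 2).
  rewrite leNgt; apply/negP => lt; apply: nT; apply: T_complete.
  apply: (lt_le_trans lt); rewrite ler_pM2r ?invr_gt0//.
  have [c2|c2] := leqP 2 c; first by rewrite natrB.
  have : c%:R < 2 :> R by rewrite (ltr_nat R _ 2).
  have : 0 <= (c - 2)%:R :> R by [].
  lra.
have Ei1 : 2 ^- ee <= 1 :> R by rewrite invf_le1// exprn_ege1// ler1n.
have Ei0 : 0 < 2 ^- ee :> R by rewrite invr_gt0.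
rewrite mulrBl in hT.
pose y := rnorm (r n - r m).1; pose q := rnorm (r n - r m).2.
have y0 : 0 <= y by exact: rnorm_ge0.
have yx : y <= x by exact: lpsum_rnorm1.
have hy : rnorm (r n).1 - 2 ^- ee <= y.
  exact: (ler_distl_bound (ler_dist_rnorm (r n).1 (r m).1) hG).
have hd : x - y <= 3 * 2 ^- ee by exact: (ler_sub_triple hx hT hy).
have xB : x <= (B n)%:R.
  have := pa n 0%N; rewrite expr0 mul1r ler_distlC => /andP[h _].
  rewrite /B natrD; apply: (ler_add_four _ hx hT (lpsum_rnorm1 (r n)) h).
  by rewrite ltW.
have B1 : 1 <= (B n)%:R :> R by rewrite ler1n /B addn4.
have := powR_diff_le p1 pM y0 yx xB B1 hd.
have -> : x `^ p - y `^ p = q `^ p by rewrite /x lpsum_rnorm_powR -/y -/q addrC addKr.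
move=> hq.
have q0 : 0 <= q by exact: rnorm_ge0.
have {}hq : q <= 2 ^- (k + 2).
  rewrite leNgt; apply/negP => lt.
  have K0 : 0 <= 2 ^- (k + 2) :> R by rewrite invr_ge0 exprn_ge0.
  have := gt0_ltr_powR p0; move=> /(_ _ _ _ _ lt); rewrite !nnegrE K0 q0 => /(_ isT isT).
  apply/negP; rewrite -leNgt; apply: (le_trans hq).
  have K1 : 0 < (2 ^- (k + 2) : R) <= 1.
    by rewrite invr_gt0 exprn_gt0//= invf_le1 ?exprn_gt0// exprn_ege1// ler1n.
  apply: le_trans (ger_powR K1 pM); rewrite powR_mulrn// exprVn -exprM.
  have e1 : M%:R <= 2 ^+ M :> R by rewrite -natrX ler_nat ltnW// ltn_expl.
  have e2 : (B n)%:R ^+ M <= 2 ^+ (B n * M) :> R.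
    rewrite exprM lerXn2r ?nnegrE ?exprn_ge0//.
    by rewrite -natrX ler_nat ltnW// ltn_expl.
  have e3 : M%:R * (B n)%:R ^+ M * (3 * 2 ^- ee) <=
      2 ^+ M * 2 ^+ (B n * M) * (2 ^+ 2 * 2 ^- ee) :> R.
    apply: ler_pM; rewrite ?mulr_ge0 ?exprn_ge0 ?(ltW Ei0)//.
      by apply: ler_pM; rewrite ?exprn_ge0.
    by apply: ler_wpM2r; [exact: ltW|rewrite -natrX ler_nat].
  apply: (le_trans e3); rewrite mulrA -!exprD ler_pdivrMr// ler_pdivlMl ?exprn_gt0//.
  rewrite -exprD ler_eXn2l ?ltr1n// /ee /e.
  by rewrite -!addnA !leq_add2l.
have eek : 2 ^- ee <= 2 ^- (k + 2) :> R.
  rewrite lef_pV2 ?posrE ?exprn_gt0// ler_eXn2l ?ltr1n// /ee /e.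
  by rewrite -!addnA (leq_trans (leq_pmulr (k + 2) (isT : 0 < M)%N))// leq_addr.
have -> : r m - (0, (r n).2) = ((r m).1, 0) + (0, (r m - r n).2) :> W.
  case: (r m) => u w; case: (r n) => u' w' /=; congr pair.
    by rewrite subr0 addr0.
  by rewrite add0r.
apply: (le_lt_trans (rnormD _ _)); rewrite rnorm_inl rnorm_inr.
have -> : rnorm (r m - r n).2 = q by rewrite /q -rnormN -[- (r m - r n).2]/(- (r m - r n)).2 opprB.
have -> : 2 ^- k = 4 * 2 ^- (k + 2) :> R.
  have e4 : 2 ^+ 2 = 4 :> R by ring.
  by rewrite exprD invfM e4 mulrCA divff ?mulr1// pnatr_eq0.
have K0 : 0 < 2 ^- (k + 2) :> R by rewrite invr_gt0 exprn_gt0.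
exact: (ltr_add_quadruple K0 eek hG hq).
Qed.

End ProjectionSearch.

Section ProjectionComputable.
Variables (R : realType) (p : R) (p1 : 1 <= p) (U V : normedModType R[i]).
Variable P : presentation (lpsum p1 U V).

Lemma is_nameP (v : lpsum p1 U V) g :
  is_name P v g <-> forall k, rnorm (rational_vector P (g k) - v) < 2 ^- k.
Proof.
have e k : 2 ^- k = (2 ^- k : R)%:C by rewrite fmorphV rmorphXn rmorph_nat.
by split=> h k; have := h k; rewrite rnormE e ltcR.
Qed.

(** The projection is 1-Lipschitz, so it is enough to apply [F] to one rational vector of the
    name. *)
Lemma proj_right_computable X (F : nat -> nat -> nat) : recf2 (charfun X) F ->
  (forall n k, rnorm (rational_vector P (F n k) - (0, (rational_vector P n).2)) < 2 ^- k) ->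
  computable_map X P P (@proj_right R p p1 U V).
Proof.
move=> /recf_oracle_join[c hc] pF; exists c => w g /is_nameP hg.
exists (fun k => F (g k.+1) k.+1); last exact: hc.
apply/is_nameP => k; set n := g k.+1.
rewrite -[_ - _](_ : (rational_vector P (F n k.+1) - (0, (rational_vector P n).2)) +
  (0, (rational_vector P n - w).2) = _); last first.
  case: (rational_vector P (F n k.+1)) => a b; case: (rational_vector P n) => a' b'.
  rewrite /proj_right; case: w {hg} => a'' b''; congr pair => /=.
    by rewrite !subr0 addr0.
  by rewrite addrA subrK.
apply: (le_lt_trans (rnormD _ _)); rewrite rnorm_inr.
have -> : 2 ^- k = 2 ^- k.+1 + 2 ^- k.+1 :> R.
  by rewrite exprS invfM [2^-1 * _]mulrC -splitr.
apply: ltrD; first exact: pF.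
exact: le_lt_trans (lpsum_rnorm2 _) (hg k.+1).
Qed.

End ProjectionComputable.

Section LpSumCoordinates.
Variables (R : realType) (p : R) (p1 : 1 <= p) (U V : normedModType R[i]).

(** The p-th powers of the norms add over the two summands, hence so do the defects, and the second
    summand contributes with the right sign. *)
Lemma lpsum_clarkson_coordinate (co : U -> R[i]) :
  (forall f g : V, 0 <= Num.sg (2 - p) * clarksonN p f g) ->
  clarkson_coordinate p co ->
  clarkson_coordinate p (fun w : lpsum p1 U V => co w.1).
Proof.
have split_sum (A B C D a b c d a' b' c' d' : R) :
    A = a + a' -> B = b + b' -> C = c + c' -> D = d + d' -> 2 * A + 2 * B - C - D =
    (2 * a + 2 * b - c - d) + (2 * a' + 2 * b' - c' - d').
  by move=> -> -> -> ->; ring.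
move=> V_ge0 [co1 co2]; split => [w|v w].
  exact: le_trans (co1 _) (lpsum_rnorm1 _).
have -> : clarksonN p v w = clarksonN p v.1 w.1 + clarksonN p v.2 w.2.
  exact: (split_sum _ _ _ _ _ _ _ _ _ _ _ _ (lpsum_rnorm_powR v)
    (lpsum_rnorm_powR w) (lpsum_rnorm_powR (v + w)) (lpsum_rnorm_powR (v - w))).
rewrite [leRHS]mulrDr; exact: (ler_wpDr (V_ge0 v.2 w.2) (co2 v.1 w.1)).
Qed.

End LpSumCoordinates.

(** * Deciding the guards with one or two jumps *)

Section TestSetDecision.
Variables (R : realType) (p : R) (p1 : 1 <= p).
Hypotheses (p_computable : computable_real p) (p_neq2 : p != 2).
Variables (U : normedModType R[i]) (P : presentation (lpsum p1 U (Lp01 p1))).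
Hypothesis P_computable : computable_presentation P.
Variable co : nat -> U -> R[i].
Hypothesis co_clarkson : forall i, clarkson_coordinate p (co i).
Hypothesis coD : forall i u v, co i (u + v) = co i u + co i v.
Hypothesis co_approx : forall u q, q < rnorm u -> exists2 e : R, 0 < e &
  forall v, (forall i, normc (co i v) <= e) -> q < rnorm (u - v).

Local Notation r := (rational_vector P).

Lemma coordinates_co : coordinates p1 co.
Proof.
split => // i; apply: lpsum_clarkson_coordinate => // f g.
exact: Lp_clarkson_ge0.
Qed.

(** If all levels held, vectors with atoms at most [3 * 2 ^- j] would lie within [c / 2 ^ e] of
    [r n] for every [j], against [co_approx]. *)
Lemma test_set_sound (T : nat -> nat -> nat -> nat -> Prop) :
  (forall n j c e, T n j c e -> exists w : lpsum p1 U (Lp01 p1),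
    (forall i, normc (co i w.1) <= 3 * 2 ^- j) /\ rnorm (r n - w) <= c%:R / 2 ^+ e) ->
  forall n c e, c%:R / 2 ^+ e < rnorm (r n).1 -> exists j, ~ T n j c e.
Proof.
move=> T_near n c e /co_approx[eps eps0 h].
have [j hj] := exp2_unbounded (3 / eps).
exists j => /T_near[w [wco wn]].
have {}wco i : normc (co i w.1) <= eps.
  apply: (le_trans (wco i)).
  by rewrite ler_pdivrMr ?exprn_gt0// mulrC -ler_pdivrMr.
have := le_lt_trans (le_trans (lpsum_rnorm1 (r n - w)) wn) (h _ wco).
by rewrite ltxx.
Qed.

(* With finitely many atoms, a single level of the test set bounds the atomic part. *)
Lemma proj_right_computable_bounded (C : nat) :
  (forall u (e : R), 0 <= e -> (forall i, normc (co i u) <= e) -> rnorm u <= C%:R * e) ->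
  computable_map (jump set0) P P (@proj_right R p p1 U (Lp01 p1)).
Proof.
move=> co_bound.
have [T [T_sig1 T_near T_complete]] :=
  test_set_exists p_computable p_neq2 P_computable coordinates_co.
have T_dec := sig1_jump T_sig1.
(* The guard allots [2 ^- e.+1] to the distance of [r m] from the level sum and as much to the
   atomic part of that sum: [C * 3 * 2 ^- (e + 3 + C)] fits since [C < 2 ^ C] and [3 <= 4]. *)
have [||||||F hF pF] := @recf_projection R p p1 U _ P P_computable (jump set0) T
  (fun m e => `[< T m (e + 3 + C)%N 1%N e.+1 >]).
- exact: T_dec.
- exact: T_complete.
- exact: test_set_sound.
- have arg : recf (charfun (jump set0)) (fun x => npair (npair (nfst x) (nsnd x + 3 + C))
    (npair 1 (nsnd x).+1)) by auto 20 with recf nocore.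
  apply: recb_ext (recb_comp T_dec arg) => x.
  by rewrite !(nfstE, nsndE).
- move=> m e /asboolP/T_near[w [wco wn]].
  have h1 : rnorm w.1 <= C%:R * (3 * 2 ^- (e + 3 + C)).
    by apply: co_bound => //; rewrite mulr_ge0// invr_ge0 exprn_ge0.
  have h2 := le_trans (lpsum_rnorm1 (r m - w)) wn.
  have h3 : C%:R * (3 * 2 ^- (e + 3 + C)) <= 2 ^- e.+1 :> R.
    rewrite mulrA ler_pdivrMr ?exprn_gt0// ler_pdivlMl ?exprn_gt0//.
    rewrite -!natrX -!natrM ler_nat.
    have := ltn_expl C (ltnSn 1); rewrite !expnD expnS.
    by have := expn_gt0 2 e; move: (2 ^ e)%N (2 ^ C)%N => x y; nia.
  have h4 : rnorm (r m).1 <= rnorm (r m - w).1 + rnorm w.1.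
    by apply: le_trans (rnormD _ _); rewrite -[(r m - w).1 + _]/((r m).1 - w.1 + w.1) subrK.
  have h5 : 1 / 2 ^+ e.+1 + 2 ^- e.+1 = 2 ^- e :> R.
    by rewrite mul1r exprS invfM [2^-1 * _]mulrC -splitr.
  rewrite -h5; apply: (le_trans h4); apply: lerD => //.
  exact: le_trans h1 h3.
- by move=> m e h; apply/asboolP/T_complete; rewrite mul1r.
exact: (proj_right_computable hF pF).
Qed.

(* No single level controls infinitely many atoms, but all levels together do. *)
Lemma proj_right_computable_jump2 :
  computable_map (jump (jump set0)) P P (@proj_right R p p1 U (Lp01 p1)).
Proof.
have [T [T_sig1 T_near T_complete]] :=
  test_set_exists p_computable p_neq2 P_computable coordinates_co.
have T_dec := sig1_jump T_sig1.
have T_sound := test_set_sound T_near.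
(* The guard quantifies over all levels; its complement is Sigma_1 relative to [0'], so one more
   jump decides it. *)
have G_sig1 : sig1 (charfun (jump set0))
    (fun x => exists j, ~ T (nfst x) j 1%N (nsnd x).+1).
  exists (fun x j => ~~ `[< T (nfst x) j 1%N (nsnd x).+1 >]).
    apply: recb_neg.
    have arg : recf (charfun (jump set0)) (fun t => npair (npair (nfst (nfst t)) (nsnd t))
      (npair 1 (nsnd (nfst t)).+1)) by auto 20 with recf nocore.
    apply: recb_ext (recb_comp T_dec arg) => x.
    by rewrite !(nfstE, nsndE).
  by move=> x; split=> -[j /asboolPn h]; exists j.
have G_dec := sig1_jump G_sig1.
have [||||||F hF pF] := @recf_projection R p p1 U _ P P_computable (jump (jump set0)) T
  (fun m e => ~~ `[< exists j, ~ T m j 1%N e.+1 >]).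
- exact: recf_jump T_dec.
- exact: T_complete.
- exact: T_sound.
- exact: recb_neg G_dec.
- move=> m e /asboolPn nT; rewrite leNgt; apply/negP => lt; apply: nT.
  apply: T_sound; apply: le_lt_trans lt.
  by rewrite mul1r lef_pV2 ?posrE ?exprn_gt0// ler_weXn2l// ler1n.
- move=> m e h; apply/asboolPn => -[j]; apply; apply: T_complete.
  by rewrite mul1r.
exact: (proj_right_computable hF pF).
Qed.

End TestSetDecision.

Theorem theorem4p1 (R : realType) (p : R) (p1 : 1 <= p)
    (p_computable : computable_real p) (p_neq2 : p != 2) :
  (forall (n : nat) (P : presentation (lpsum p1 (lpn p1 n) (Lp01 p1))),
    (1 <= n)%N -> computable_presentation P ->
    computable_map (jump set0) P P (@proj_right R p p1 (lpn p1 n) (Lp01 p1)))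
  /\
  (forall P : presentation (lpsum p1 (lp p1) (Lp01 p1)),
    computable_presentation P ->
    computable_map (jump (jump set0)) P P
      (@proj_right R p p1 (lp p1) (Lp01 p1))).
Proof.
split=> [n P _ hP|P hP].
  apply: (@proj_right_computable_bounded R p p1 p_computable p_neq2 _ P hP
    (fun i => @lpn_coord R p p1 n i)).
  - exact: lpn_clarkson_coordinate.
  - exact: lpn_coordD.
  - exact: lpn_coord_approx.
  - exact: lpn_coord_bound.
apply: (@proj_right_computable_jump2 R p p1 p_computable p_neq2 _ P hP
  (fun i => @lp_coord R p p1 i)).
- exact: lp_clarkson_coordinate.
- by [].
- exact: lp_coord_approx.
Qed.
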